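(* Let $f\not\equiv 0$ be a weakly holomorphic modular function for $\mathrm{SL}(2,\mathbb{Z})$ such that $f(e^{it})$ is real and non-negative for all $t\in[\pi/3,2\pi/3]$, and let $\phi=\frac{1+\sqrt5}{2}$. For every $x\in\mathbb{P}^1(\mathbb{R})$ we have $0\le\Lambda_f(x)\le\Lambda_f(\phi)$. Moreover every value in $[0,\Lambda_f(\phi)]$ is attained by $\Lambda_f$, i.e. $\Lambda_f(\mathbb{P}^1(\mathbb{R}))=[0,\Lambda_f(\phi)]$.
   Context: Let $T=\begin{pmatrix}1&1\\0&1\end{pmatrix}$, $V=\begin{pmatrix}1&0\\1&1\end{pmatrix}$, acting by Möbius transformations. For hyperbolic $A\in\mathrm{SL}(2,\mathbb{Z})$ with repelling/attracting fixed points $w,\tilde w$, let $Q(x,y)=ax^2+bxy+cy^2$ be the primitive integral form vanishing at $(w,1),(\tilde w,1)$ with $\mathrm{sgn}(a)=\mathrm{sgn}(w-\tilde w)$, $D=b^2-4ac$, and $I_f(A)=\int_{\tau_0}^{A\tau_0}\frac{f(\tau)\sqrt D}{Q(\tau,1)}d\tau$ ($\tau_0\in\mathbb{H}$ arbitrary); $I_f(A)=0$ if $A$ is not hyperbolic. For $x\in(0,\infty)$ let $(A_n)_{n\ge0}$ be the unique sequence in $\mathrm{SL}(2,\mathbb{Z}_{\ge0})$ with $A_0=I$, $A_n^{-1}A_{n+1}\in\{T,V\}$, $A_n(1)\to x$, whose letters contain infinitely many $T$'s and $V$'s if $x$ is irrational and are eventually all $V$ if $x$ is rational (the Farey path of $x$;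 for $x=[a_1;a_2,\dots]$ irrational, $A_n$ is the prefix of length $n$ of the infinite word $T^{a_1}V^{a_2}T^{a_3}V^{a_4}\cdots$). Define $\Lambda_f(x)=\limsup_{n}\mathrm{Re}(I_f(A_n))/n$ for $x\in(0,\infty)$, and extend to $\mathbb{P}^1(\mathbb{R})$ by $\Lambda_f(x)=\Lambda_f(-x)$ for $x<0$ and $\Lambda_f(0)=\Lambda_f(\infty)=0$ (this is the $\mathrm{GL}(2,\mathbb{Z})$-invariant extension). *)

(* Defs.v *)
From Stdlib Require Import Reals ZArith QArith Qreals ClassicalEpsilon.
From Coquelicot Require Import Coquelicot.

Open Scope R_scope.

Record mat2 := Mat2 { ma : Z; mb : Z; mc : Z; md : Z }.

Definition mI : mat2 := Mat2 1 0 0 1.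
Definition mT : mat2 := Mat2 1 1 0 1.
Definition mV : mat2 := Mat2 1 0 1 1.

Definition mmul (A B : mat2) : mat2 :=
  Mat2 (ma A * ma B + mb A * mc B) (ma A * mb B + mb A * md B)
       (mc A * ma B + md A * mc B) (mc A * mb B + md A * md B).

(* The adjugate, which is the inverse on SL(2,Z). *)
Definition minv (A : mat2) : mat2 := Mat2 (md A) (- mb A) (- mc A) (ma A).

Definition SL2Z (A : mat2) : Prop := (ma A * md A - mb A * mc A = 1)%Z.

Definition SL2Znonneg (A : mat2) : Prop :=
  SL2Z A /\ (0 <= ma A)%Z /\ (0 <= mb A)%Z /\ (0 <= mc A)%Z /\ (0 <= md A)%Z.

Definition hyperbolic (A : mat2) : Prop :=
  SL2Z A /\ (2 < Z.abs (ma A + md A))%Z.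

Definition ZtoC (n : Z) : C := RtoC (IZR n).

Definition mobiusR (A : mat2) (x : R) : R :=
  (IZR (ma A) * x + IZR (mb A)) / (IZR (mc A) * x + IZR (md A)).

Definition mobiusC (A : mat2) (tau : C) : C :=
  ((ZtoC (ma A) * tau + ZtoC (mb A)) / (ZtoC (mc A) * tau + ZtoC (md A)))%C.

Definition upper_half (tau : C) : Prop := 0 < Im tau.

(* q = exp (2 pi i tau) *)
Definition qexp (tau : C) : C :=
  (RtoC (exp (- (2 * PI * Im tau))) *
   (cos (2 * PI * Re tau), sin (2 * PI * Re tau)))%C.

(* Only the values of [f] on the upper half-plane matter.  Meromorphy at the
   cusp is a q-expansion with finitely many negative exponents: f is q^(-N)
   times a power series in q. *)
Definition weakly_holomorphic_modular_function (f : C -> C) : Prop :=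
  (forall tau : C, upper_half tau ->
     ex_derive (K := C_AbsRing) (V := C_NormedModule) f tau) /\
  (forall (A : mat2) (tau : C), SL2Z A -> upper_half tau ->
     f (mobiusC A tau) = f tau) /\
  (exists (N : nat) (a : nat -> C), forall tau : C, upper_half tau ->
     is_pseries (K := C_AbsRing) (V := C_NormedModule) a (qexp tau)
       (Cpow (qexp tau) N * f tau)%C).

Definition fixed_point (A : mat2) (w : R) : Prop :=
  IZR (mc A) * w + IZR (md A) <> 0 /\ mobiusR A w = w.

Definition repelling_fixed_point (A : mat2) (w : R) : Prop :=
  fixed_point A w /\ 1 < Rabs (Derive (mobiusR A) w).

Definition attracting_fixed_point (A : mat2) (w : R) : Prop :=
  fixed_point A w /\ Rabs (Derive (mobiusR A) w) < 1.

Record form := Form { fa : Z; fb : Z; fc : Z }.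

Definition form_R (Q : form) (x y : R) : R :=
  IZR (fa Q) * x ^ 2 + IZR (fb Q) * x * y + IZR (fc Q) * y ^ 2.

Definition form_C (Q : form) (x y : C) : C :=
  (ZtoC (fa Q) * Cpow x 2 + ZtoC (fb Q) * x * y + ZtoC (fc Q) * Cpow y 2)%C.

Definition primitive (Q : form) : Prop :=
  Z.gcd (fa Q) (Z.gcd (fb Q) (fc Q)) = 1%Z.

Definition disc (Q : form) : Z := (fb Q * fb Q - 4 * fa Q * fc Q)%Z.

Definition is_form_of (A : mat2) (Q : form) : Prop :=
  exists w w' : R,
    repelling_fixed_point A w /\ attracting_fixed_point A w' /\
    primitive Q /\ form_R Q w 1 = 0 /\ form_R Q w' 1 = 0 /\
    sign (IZR (fa Q)) = sign (w - w').

(* For hyperbolic [A] there is exactly one such form. *)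
Definition form_of (A : mat2) : form :=
  epsilon (inhabits (Form 0 0 0)) (is_form_of A).

(* Integral along the straight segment; it stands for the path-independent
   integral of a holomorphic function between two points of the (convex)
   upper half-plane. *)
Definition Cint (g : C -> C) (z0 z1 : C) : C :=
  RInt (V := C_R_CompleteNormedModule)
    (fun t : R => (g (z0 + RtoC t * (z1 - z0)) * (z1 - z0))%C) 0 1.

Definition I_f (f : C -> C) (tau0 : C) (A : mat2) : C :=
  if excluded_middle_informative (hyperbolic A) then
    Cint (fun tau =>
            (f tau * RtoC (sqrt (IZR (disc (form_of A))))
             / form_C (form_of A) tau (RtoC 1))%C)
      tau0 (mobiusC A tau0)
  else RtoC 0.

Definition rational (x : R) : Prop := exists r : Q, Q2R r = x.

Definition letter (A : nat -> mat2) (n : nat) : mat2 :=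
  mmul (minv (A n)) (A (S n)).

Definition is_farey_path (x : R) (A : nat -> mat2) : Prop :=
  (forall n, SL2Znonneg (A n)) /\
  A 0%nat = mI /\
  (forall n, letter A n = mT \/ letter A n = mV) /\
  is_lim_seq (fun n => mobiusR (A n) 1) x /\
  (~ rational x ->
     (forall N : nat, exists n : nat, (N <= n)%nat /\ letter A n = mT) /\
     (forall N : nat, exists n : nat, (N <= n)%nat /\ letter A n = mV)) /\
  (rational x ->
     exists N : nat, forall n : nat, (N <= n)%nat -> letter A n = mV).

(* For 0 < x there is exactly one such sequence. *)
Definition farey_path (x : R) : nat -> mat2 :=
  epsilon (inhabits (fun _ => mI)) (is_farey_path x).

Definition Lambda_pos (f : C -> C) (tau0 : C) (x : R) : Rbar :=
  LimSup_seq (fun n => Re (I_f f tau0 (farey_path x n)) / INR n).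

Inductive P1R := P1_fin (x : R) | P1_inf.

Definition Lambda (f : C -> C) (tau0 : C) (x : P1R) : Rbar :=
  match x with
  | P1_inf => Finite 0
  | P1_fin x =>
      if Rlt_dec 0 x then Lambda_pos f tau0 x
      else if Rlt_dec x 0 then Lambda_pos f tau0 (- x)
      else Finite 0
  end.

Definition phi : R := (1 + sqrt 5) / 2.

(* Main.v *)
(* The arc of the unit circle from rho^2 = e^{2 pi i/3} to rho = e^{i pi/3} is the first
   step of an invariant trivalent tree: T and V both send rho^2 to rho.  By Cauchy's theorem
   the cycle integral of a word A = L_0 ... L_{n-1} in T and V is therefore the sum over k of
   the integrals over this arc of f times the geodesic kernel with endpoints
   -u_k and v_k, where u_{k+1} = L_k u_k and v_k = L_k v_{k+1} are positive.  On the arc the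
   real part of the k-th integral splits, by the symmetry t -> pi - t, as F(u_k) + F(v_k) with
   F(z) = int f(e^{it}) sin t c / (c^2 - 4 cos^2 t) dt and c = z + 1/z.

   In terms of r = max(z, 1/z) a letter acts by r -> 1 + r when it repeats the previous letter
   and by r -> 1 + 1/r when it differs from it.  For each t the integrand at the new r plus the
   increment of a bounded potential is at most its value at phi; telescoping over a period
   gives Re I_f(A_n) <= 2 n F(phi).  Long repetitions contribute o(1) per letter and long
   alternations F(phi) + o(1), so a word whose letters alternate with density theta, in runs
   whose number below n is o(n), has Lambda_f = 2 F(phi) theta.  The word of phi alternates
   always, and every theta in (0,1) occurs. *)
Require Import Defs.
From Stdlib Require Import Reals Lra Lia ZArith Qreals ClassicalEpsilon.
From Coquelicot Require Import Coquelicot.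
Open Scope R_scope.

(** * Complex derivatives *)

(* Coquelicot equips C with two different uniform structures, by coordinates and by modulus;
   this epsilon-delta form does not depend on the choice. *)
Definition cderiv (f : C -> C) (z l : C) : Prop :=
  forall eps, 0 < eps -> exists d, 0 < d /\ forall y,
    Cmod (y - z) < d -> Cmod (f y - f z - (y - z) * l) <= eps * Cmod (y - z).

Lemma cderiv_is_derive (f : C -> C) (z l : C) :
  cderiv f z l <->
  is_derive (K := C_AbsRing) (V := AbsRing_NormedModule C_AbsRing) f z l.
Proof.
  split.
  - intros H. split.
    + apply is_linear_scal_l.
    + intros x Hx eps.
      replace x with z by (apply (@is_filter_lim_locally_unique C_AbsRing (AbsRing_NormedModule C_AbsRing)); exact Hx).
      destruct (H eps (cond_pos eps)) as [d [Hd Hy]].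
      exists (mkposreal d Hd). intros y By. apply (Hy y). exact By.
  - intros [_ H] eps Heps.
    destruct (H z (fun P H0 => H0) (mkposreal eps Heps)) as [d Hd].
    exists d. split. apply cond_pos. intros y Hy. apply (Hd y Hy).
Qed.

Lemma is_derive_cderiv (f : C -> C) (z l : C) :
  is_derive (K := C_AbsRing) (V := C_NormedModule) f z l -> cderiv f z l.
Proof.
  intros [_ H] eps Heps.
  destruct (H z (fun P H0 => H0) (mkposreal eps Heps)) as [d Hd].
  exists d. split. apply cond_pos. intros y Hy. apply (Hd y Hy).
Qed.

Lemma cderiv_mult f g z df dg : cderiv f z df -> cderiv g z dg ->
  cderiv (fun y => f y * g y)%C z (df * g z + f z * dg)%C.
Proof.
  rewrite !cderiv_is_derive. intros Hf Hg.
  apply (is_derive_mult (K := C_AbsRing) f g z df dg Hf Hg). apply Cmult_comm.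
Qed.

Lemma cderiv_plus f g z df dg : cderiv f z df -> cderiv g z dg ->
  cderiv (fun y => f y + g y)%C z (df + dg)%C.
Proof.
  rewrite !cderiv_is_derive. intros Hf Hg.
  apply (is_derive_plus (K := C_AbsRing) (V := AbsRing_NormedModule C_AbsRing) f g z df dg Hf Hg).
Qed.

Lemma cderiv_minus f g z df dg : cderiv f z df -> cderiv g z dg ->
  cderiv (fun y => f y - g y)%C z (df - dg)%C.
Proof.
  rewrite !cderiv_is_derive. intros Hf Hg.
  apply (is_derive_minus (K := C_AbsRing) (V := AbsRing_NormedModule C_AbsRing) f g z df dg Hf Hg).
Qed.

Lemma cderiv_const c z : cderiv (fun _ => c) z (RtoC 0).
Proof.
  rewrite cderiv_is_derive. apply (is_derive_const (K := C_AbsRing) (V := AbsRing_NormedModule C_AbsRing)).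
Qed.

Lemma cderiv_id z : cderiv (fun y => y) z (RtoC 1).
Proof.
  rewrite cderiv_is_derive. apply (is_derive_id (K := C_AbsRing)).
Qed.

Lemma cderiv_comp f g z df dg : cderiv f (g z) df -> cderiv g z dg ->
  cderiv (fun y => f (g y)) z (dg * df)%C.
Proof.
  rewrite !cderiv_is_derive. intros Hf Hg.
  apply (is_derive_comp (K := C_AbsRing) (V := AbsRing_NormedModule C_AbsRing) f g z df dg Hf Hg).
Qed.

Lemma cderiv_ext f g z l : (forall y, f y = g y) -> cderiv f z l -> cderiv g z l.
Proof.
  intros E H eps He. destruct (H eps He) as [d [Hd K]]. exists d. split; auto.
  intros y Hy. rewrite <- !E. auto.
Qed.

Lemma cderiv_eq f z l l' : l = l' -> cderiv f z l -> cderiv f z l'.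
Proof. now intros ->. Qed.

Lemma cderiv_inv (z : C) : z <> 0%R -> cderiv Cinv z (- / (z * z))%C.
Proof.
  intros Hz eps Heps.
  assert (Pz : 0 < Cmod z) by now apply Cmod_gt_0.
  exists (Rmin (Cmod z / 2) (eps * (Cmod z) ^ 3 / 2)).
  split. { apply Rmin_pos; [lra|]. pose proof (pow_lt _ 3 Pz). nra. }
  intros y Hy.
  assert (H1 := Rlt_le_trans _ _ _ Hy (Rmin_l _ _)).
  assert (H2 := Rlt_le_trans _ _ _ Hy (Rmin_r _ _)). clear Hy.
  assert (Py : Cmod z / 2 <= Cmod y).
  { pose proof (Cmod_triangle (z - y) y). replace (z - y + y)%C with z in H by ring.
    rewrite <- (Cmod_opp (z - y)) in H. replace (- (z - y))%C with (y - z)%C in H by ring. lra. }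
  assert (Ny : y <> 0%R). { apply Cmod_gt_0. lra. }
  replace (/ y - / z - (y - z) * - / (z * z))%C with ((y - z) * ((y - z) / (z * z * y)))%C
    by (field; auto).
  rewrite Cmod_mult, Rmult_comm. apply Rmult_le_compat_r. apply Cmod_ge_0.
  rewrite Cmod_div, !Cmod_mult by (repeat apply Cmult_neq_0; auto).
  assert (0 < Cmod z * Cmod z * Cmod y) by (repeat apply Rmult_lt_0_compat; lra).
  apply Rle_div_l. auto.
  apply Rle_trans with (eps * (Cmod z * Cmod z * (Cmod z / 2))). nra.
  apply Rmult_le_compat_l. lra. apply Rmult_le_compat_l. nra. auto.
Qed.

Lemma norm_C_R (z : C) : norm (V := C_R_NormedModule) z = Cmod z.
Proof.
  unfold norm; simpl. unfold prod_norm, norm; simpl. unfold abs; simpl. unfold Cmod. f_equal.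
  rewrite !Rmult_1_r, <- !Rabs_mult, !Rabs_pos_eq; try apply Rle_0_sqr. ring.
Qed.

Definition curve_deriv (p : R -> C) (t : R) (l : C) : Prop :=
  is_derive (K := R_AbsRing) (V := C_R_NormedModule) p t l.

Lemma curve_derivP (p : R -> C) t l : curve_deriv p t l <->
  forall eps, 0 < eps -> exists d, 0 < d /\ forall s,
    Rabs (s - t) < d -> Cmod (p s - p t - RtoC (s - t) * l) <= eps * Rabs (s - t).
Proof.
  assert (E : forall s, norm (V := C_R_NormedModule)
    (minus (minus (p s) (p t)) (scal (s - t) l)) = Cmod (p s - p t - RtoC (s - t) * l)).
  { intros s. rewrite norm_C_R. f_equal.
    unfold minus, plus, opp, scal; simpl. unfold prod_scal, prod_plus, prod_opp; simpl.
    unfold scal, opp, plus, mult; simpl. unfold mult; simpl.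
    unfold Cminus, Cplus, Copp, Cmult, RtoC; simpl. f_equal; ring. }
  split.
  - intros [_ H] eps He.
    destruct (H t (fun P H0 => H0) (mkposreal eps He)) as [d Hd].
    exists d. split. apply cond_pos. intros s Hs. rewrite <- E. apply (Hd s Hs).
  - intros H. split. apply is_linear_scal_l.
    intros x Hx eps.
    replace x with t by (apply is_filter_lim_locally_unique; exact Hx).
    destruct (H eps (cond_pos eps)) as [d [Hd K]].
    exists (mkposreal d Hd). intros s Hs. specialize (K s Hs). rewrite <- E in K. exact K.
Qed.

Lemma cderiv_curve (f : C -> C) (p : R -> C) t l dp :
  cderiv f (p t) l -> curve_deriv p t dp ->
  curve_deriv (fun s => f (p s)) t (l * dp)%C.
Proof.
  rewrite !curve_derivP. intros Hf Hp eps He.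
  set (M := Cmod dp + 1). assert (PM : 0 < M) by (unfold M; pose proof (Cmod_ge_0 dp); lra).
  assert (Pl := Cmod_ge_0 l).
  destruct (Hf (eps / (2 * M))) as [d [Hd Kf]]. { apply Rdiv_lt_0_compat; lra. }
  set (e2 := Rmin 1 (eps / (2 * (Cmod l + 1)))).
  assert (Pe2 : 0 < e2). { apply Rmin_pos. lra. apply Rdiv_lt_0_compat; lra. }
  destruct (Hp e2 Pe2) as [d2 [Hd2 Kp]].
  exists (Rmin d2 (d / M)). split. { apply Rmin_pos; auto. apply Rdiv_lt_0_compat; lra. }
  intros s Hs. specialize (Kp s (Rlt_le_trans _ _ _ Hs (Rmin_l _ _))).
  assert (Hs2 := Rlt_le_trans _ _ _ Hs (Rmin_r _ _)). apply Rlt_div_r in Hs2; [|lra].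
  assert (Pa := Rabs_pos (s - t)).
  assert (B : Cmod (p s - p t) <= M * Rabs (s - t)).
  { replace (p s - p t)%C with ((p s - p t - RtoC (s - t) * dp) + RtoC (s - t) * dp)%C by ring.
    eapply Rle_trans. apply Cmod_triangle. rewrite Cmod_mult, Cmod_R.
    assert (e2 <= 1) by apply Rmin_l. unfold M. nra. }
  specialize (Kf (p s) ltac:(lra)).
  replace (f (p s) - f (p t) - RtoC (s - t) * (l * dp))%C with
    ((f (p s) - f (p t) - (p s - p t) * l) + l * (p s - p t - RtoC (s - t) * dp))%C by ring.
  eapply Rle_trans. apply Cmod_triangle. rewrite Cmod_mult.
  assert (H1 : eps / (2 * M) * Cmod (p s - p t) <= eps / 2 * Rabs (s - t)).
  { replace (eps / 2 * Rabs (s - t)) with (eps / (2 * M) * (M * Rabs (s - t))) by (field; lra).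
    apply Rmult_le_compat_l; auto. apply Rlt_le, Rdiv_lt_0_compat; lra. }
  assert (H2 : Cmod l * e2 <= eps / 2).
  { apply Rle_trans with ((Cmod l + 1) * (eps / (2 * (Cmod l + 1)))).
    apply Rmult_le_compat; try lra. apply Rmin_r. right. field. lra. }
  assert (Cmod l * Cmod (p s - p t - RtoC (s - t) * dp) <= Cmod l * (e2 * Rabs (s - t)))
    by (apply Rmult_le_compat_l; auto).
  nra.
Qed.

Lemma curve_deriv_line (z0 z1 : C) t :
  curve_deriv (fun s => z0 + RtoC s * (z1 - z0))%C t (z1 - z0)%C.
Proof.
  apply curve_derivP. intros eps He. exists 1. split. lra. intros s _.
  replace (_ - _ - _)%C with (RtoC 0).
  rewrite Cmod_0. pose proof (Rabs_pos (s - t)). nra.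
  rewrite RtoC_minus. ring.
Qed.

Lemma curve_deriv_continuous (p : R -> C) t l : curve_deriv p t l ->
  continuous (T := R_UniformSpace) (U := C_UniformSpace) p t.
Proof.
  intros H. apply (ex_derive_continuous (V := C_R_NormedModule) p t). exists l. exact H.
Qed.

Lemma FTC_curve (p q : R -> C) a b :
  (forall t, Rmin a b <= t <= Rmax a b -> curve_deriv p t (q t)) ->
  (forall t, Rmin a b <= t <= Rmax a b ->
     continuous (T := R_UniformSpace) (U := C_UniformSpace) q t) ->
  RInt (V := C_R_CompleteNormedModule) q a b = (p b - p a)%C.
Proof.
  intros H1 H2. apply is_RInt_unique.
  apply (is_RInt_derive (V := C_R_CompleteNormedModule) p q a b H1 H2).
Qed.

(** * Segment integrals of holomorphic functions *)

Definition holoH (g : C -> C) : Prop :=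
  forall z, upper_half z -> exists l, cderiv g z l.

Definition seg (z0 z1 : C) (t : R) : C := (z0 + RtoC t * (z1 - z0))%C.

Lemma seg_upper z0 z1 t : upper_half z0 -> upper_half z1 -> 0 <= t <= 1 ->
  upper_half (seg z0 z1 t).
Proof.
  unfold upper_half, seg, Im; destruct z0, z1; simpl. intros.
  replace (_ + _) with ((1 - t) * r0 + t * r2) by ring.
  destruct (Req_dec t 0). subst; lra. assert (0 < t * r2) by nra.
  assert (0 <= (1 - t) * r0) by nra. lra.
Qed.

Lemma holo_curve_continuous g (p : R -> C) t dp :
  holoH g -> upper_half (p t) -> curve_deriv p t dp ->
  continuous (T := R_UniformSpace) (U := C_UniformSpace) (fun s => g (p s)) t.
Proof.
  intros Hg Hp Hd. destruct (Hg _ Hp) as [l Hl].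
  apply (curve_deriv_continuous _ t (l * dp)%C). now apply cderiv_curve.
Qed.

Lemma holoH_scal g c : holoH g -> holoH (fun z => g z * c)%C.
Proof.
  intros Hg z Hz. destruct (Hg z Hz) as [l Hl]. eexists.
  apply cderiv_mult. exact Hl. apply cderiv_const.
Qed.

Lemma holoH_minus g h : holoH g -> holoH h -> holoH (fun z => g z - h z)%C.
Proof.
  intros Hg Hh z Hz. destruct (Hg z Hz) as [l Hl], (Hh z Hz) as [k Hk]. eexists.
  apply cderiv_minus; eassumption.
Qed.

Section Path_integrals.
Variables (z0 z1 : C).
Hypotheses (H0 : upper_half z0) (H1 : upper_half z1).

Lemma seg_integrand_continuous g t : holoH g -> 0 <= t <= 1 ->
  continuous (T := R_UniformSpace) (U := C_UniformSpace)
    (fun t => g (seg z0 z1 t) * (z1 - z0))%C t.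
Proof.
  intros Hg Ht.
  apply (holo_curve_continuous (fun z => g z * (z1 - z0))%C (seg z0 z1) t (z1 - z0)%C).
  now apply holoH_scal. now apply seg_upper. apply curve_deriv_line.
Qed.

Lemma ex_Cint g a b : holoH g -> 0 <= a <= 1 -> 0 <= b <= 1 ->
  ex_RInt (V := C_R_CompleteNormedModule) (fun t => g (seg z0 z1 t) * (z1 - z0))%C a b.
Proof.
  intros Hg Ha Hb. apply (ex_RInt_continuous (V := C_R_CompleteNormedModule)).
  intros t Ht. apply seg_integrand_continuous; auto.
  unfold Rmin, Rmax in Ht. destruct (Rle_dec a b); lra.
Qed.

Lemma Cint_FTC g G : holoH g -> (forall z, upper_half z -> cderiv G z (g z)) ->
  Cint g z0 z1 = (G z1 - G z0)%C.
Proof.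
  intros Hg HG. unfold Cint.
  replace (G z1) with (G (seg z0 z1 1)) by (f_equal; unfold seg; ring).
  replace (G z0) with (G (seg z0 z1 0)) by (f_equal; unfold seg; ring).
  apply (FTC_curve (fun t => G (seg z0 z1 t))); rewrite Rmin_left, Rmax_right by lra; intros t Ht.
  - apply cderiv_curve. apply HG, seg_upper; auto. apply curve_deriv_line.
  - now apply seg_integrand_continuous.
Qed.

Lemma Cint_minus g h : holoH g -> holoH h ->
  Cint (fun z => g z - h z)%C z0 z1 = (Cint g z0 z1 - Cint h z0 z1)%C.
Proof.
  intros Hg Hh.
  eapply eq_trans; [|exact (RInt_minus (V := C_R_CompleteNormedModule)
    (fun t => g (seg z0 z1 t) * (z1 - z0))%C (fun t => h (seg z0 z1 t) * (z1 - z0))%C 0 1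
    (ex_Cint g 0 1 Hg ltac:(lra) ltac:(lra)) (ex_Cint h 0 1 Hh ltac:(lra) ltac:(lra)))].
  apply (RInt_ext (V := C_R_CompleteNormedModule)). intros t _.
  change (((g (seg z0 z1 t) - h (seg z0 z1 t)) * (z1 - z0))%C =
    (g (seg z0 z1 t) * (z1 - z0) - h (seg z0 z1 t) * (z1 - z0))%C). ring.
Qed.

Lemma Cint_bound g M : holoH g ->
  (forall t, 0 <= t <= 1 -> Cmod (g (seg z0 z1 t)) <= M) ->
  Cmod (Cint g z0 z1) <= M * Cmod (z1 - z0).
Proof.
  intros Hg HM.
  assert (H := RInt_correct (V := C_R_CompleteNormedModule) _ 0 1 (ex_Cint g 0 1 Hg ltac:(lra) ltac:(lra))).
  apply (norm_RInt_le_const _ 0 1 _ (M * Cmod (z1 - z0)) Rle_0_1) in H.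
  - rewrite norm_C_R in H. unfold Cint. unfold seg in H. lra.
  - intros t Ht. rewrite norm_C_R, Cmod_mult.
    apply Rmult_le_compat_r. apply Cmod_ge_0. auto.
Qed.
End Path_integrals.

Lemma Cint_swap g z0 z1 : upper_half z0 -> upper_half z1 -> holoH g ->
  Cint g z1 z0 = (- Cint g z0 z1)%C.
Proof.
  intros H0 H1 Hg. unfold Cint.
  rewrite <- (opp_RInt_swap (V := C_R_CompleteNormedModule)) by
    (apply (ex_RInt_swap (V := C_R_CompleteNormedModule)); apply (ex_Cint z1 z0); auto; lra).
  change (fun t : R => g (z1 + t * (z0 - z1)) * (z0 - z1))%C with
   (fun t : R => g (seg z1 z0 t) * (z0 - z1))%C.
  apply (f_equal Copp).
  assert (E := RInt_comp_lin (V := C_R_CompleteNormedModule)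
     (fun t => g (seg z1 z0 t) * (z0 - z1))%C (-1) 1 0 1).
  replace (-1 * 0 + 1) with 1 in E by ring. replace (-1 * 1 + 1) with 0 in E by ring.
  rewrite <- E by (apply ex_Cint; auto; lra).
  apply (RInt_ext (V := C_R_CompleteNormedModule)). intros t _.
  replace (seg z1 z0 (-1 * t + 1)) with (seg z0 z1 t)
    by (unfold seg; apply injective_projections; simpl; ring).
  rewrite scal_R_Cmult. unfold seg. set (w := g _).
  replace (RtoC (-1)) with (- RtoC 1)%C by now rewrite <- RtoC_opp.
  change ((- RtoC 1 * (w * (z0 - z1)))%C = (w * (z1 - z0))%C). ring.
Qed.

Lemma Cint_midpoint g z0 z1 : upper_half z0 -> upper_half z1 -> holoH g ->
  Cint g z0 z1 = (Cint g z0 ((z0 + z1) / RtoC 2) + Cint g ((z0 + z1) / RtoC 2) z1)%C.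
Proof.
  intros H0 H1 Hg.
  assert (N2 : RtoC 2 <> 0%R) by (intros K; apply RtoC_inj in K; lra).
  assert (Hh : RtoC (1 / 2) = (/ RtoC 2)%C)
    by (rewrite <- RtoC_inv by lra; f_equal; lra).
  set (F := (fun t => g (seg z0 z1 t) * (z1 - z0))%C).
  change (Cint g z0 z1) with (RInt (V := C_R_CompleteNormedModule) F 0 1).
  rewrite <- (RInt_Chasles (V := C_R_CompleteNormedModule) F 0 (1/2) 1)
    by (apply ex_Cint; auto; lra).
  apply (f_equal2 Cplus); unfold Cint.
  - assert (E := RInt_comp_lin (V := C_R_CompleteNormedModule) F (1/2) 0 0 1).
    replace (1/2 * 0 + 0) with 0 in E by lra. replace (1/2 * 1 + 0) with (1/2) in E by lra.
    rewrite <- E by (apply ex_Cint; auto; lra).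
    apply (RInt_ext (V := C_R_CompleteNormedModule)). intros t _. unfold F.
    replace (z0 + t * ((z0 + z1) / 2 - z0))%C with (seg z0 z1 (1/2 * t + 0))
      by (unfold seg; rewrite RtoC_plus, RtoC_mult, Hh; field; auto).
    set (w := g _).
    replace ((z0 + z1) / 2 - z0)%C with (RtoC (1/2) * (z1 - z0))%C by (rewrite Hh; field; auto).
    rewrite scal_R_Cmult.
    apply injective_projections; simpl; ring.
  - assert (E := RInt_comp_lin (V := C_R_CompleteNormedModule) F (1/2) (1/2) 0 1).
    replace (1/2 * 0 + 1/2) with (1/2) in E by lra. replace (1/2 * 1 + 1/2) with 1 in E by lra.
    rewrite <- E by (apply ex_Cint; auto; lra).
    apply (RInt_ext (V := C_R_CompleteNormedModule)). intros t _. unfold F.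
    replace ((z0 + z1) / 2 + t * (z1 - (z0 + z1) / 2))%C with (seg z0 z1 (1/2 * t + 1/2))
      by (unfold seg; rewrite RtoC_plus, RtoC_mult, Hh; field; auto).
    set (w := g _).
    replace (z1 - (z0 + z1) / 2)%C with (RtoC (1/2) * (z1 - z0))%C by (rewrite Hh; field; auto).
    rewrite scal_R_Cmult.
    apply injective_projections; simpl; ring.
Qed.

(** * Goursat's theorem and primitives *)

Definition mid (a b : C) : C := ((a + b) / RtoC 2)%C.

Lemma mid_eq a b : mid a b = ((fst a + fst b) / 2, (snd a + snd b) / 2).
Proof.
  unfold mid, Cdiv. replace (/ RtoC 2)%C with (RtoC (/ 2)) by (rewrite RtoC_inv; auto; lra).
  apply injective_projections; simpl; field.
Qed.

Lemma mid_upper a b : upper_half a -> upper_half b -> upper_half (mid a b).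
Proof. unfold upper_half, Im. rewrite mid_eq; simpl. lra. Qed.

Lemma mid_sub_l a b : Cmod (mid a b - a) = Cmod (b - a) / 2.
Proof.
  replace (mid a b - a)%C with (RtoC (/ 2) * (b - a))%C
    by (rewrite mid_eq; apply injective_projections; simpl; field).
  rewrite Cmod_mult, Cmod_R, Rabs_pos_eq; lra.
Qed.

Lemma mid_sub_mid a b c : Cmod (mid a b - mid a c) = Cmod (b - c) / 2.
Proof.
  replace (mid a b - mid a c)%C with (RtoC (/ 2) * (b - c))%C
    by (rewrite !mid_eq; apply injective_projections; simpl; field).
  rewrite Cmod_mult, Cmod_R, Rabs_pos_eq; lra.
Qed.

Lemma mid_comm a b : mid a b = mid b a.
Proof. unfold mid. f_equal. ring. Qed.

Lemma Cmod_sub_comm a b : Cmod (a - b) = Cmod (b - a).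
Proof. rewrite <- Cmod_opp. f_equal. ring. Qed.

Lemma geometric_cauchy (x : nat -> R) s : 0 <= s ->
  (forall n, Rabs (x (S n) - x n) <= s / 2 ^ n) ->
  exists l, forall n, Rabs (x n - l) <= 2 * s / 2 ^ n.
Proof.
  intros Hs H.
  assert (P : forall n, 0 < 2 ^ n) by (intros; apply pow_lt; lra).
  assert (Q : forall n, 0 <= 2 * s / 2 ^ n)
    by (intros n; apply Rmult_le_pos; [lra|apply Rlt_le, Rinv_0_lt_compat, P]).
  assert (St : forall n, 2 * s / 2 ^ n = s / 2 ^ n + 2 * s / 2 ^ S n).
  { intros n. simpl. field. specialize (P n). lra. }
  assert (Lo : forall n k, x n - 2 * s / 2 ^ n <= x (n + k)%nat - 2 * s / 2 ^ (n + k)).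
  { intros n k. induction k. rewrite Nat.add_0_r. lra.
    rewrite Nat.add_succ_r. eapply Rle_trans. apply IHk.
    specialize (H (n + k)%nat). apply Rabs_le_between in H. rewrite (St (n + k)%nat). lra. }
  assert (Up : forall n k, x (n + k)%nat + 2 * s / 2 ^ (n + k) <= x n + 2 * s / 2 ^ n).
  { intros n k. induction k. rewrite Nat.add_0_r. lra.
    rewrite Nat.add_succ_r. eapply Rle_trans; [|apply IHk].
    specialize (H (n + k)%nat). apply Rabs_le_between in H. rewrite (St (n + k)%nat). lra. }
  assert (B : forall n m, x n - 2 * s / 2 ^ n <= x m + 2 * s / 2 ^ m).
  { intros n m. destruct (Nat.le_ge_cases n m) as [L|L].
    - specialize (Lo n (m - n)%nat). replace (n + (m - n))%nat with m in Lo by lia.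
      specialize (Q m). lra.
    - specialize (Up m (n - m)%nat). replace (m + (n - m))%nat with n in Up by lia.
      specialize (Q n). lra. }
  destruct (completeness (fun y => exists n, y = x n - 2 * s / 2 ^ n)) as [l [L1 L2]].
  - exists (x O + 2 * s / 2 ^ 0). intros y [n ->]. apply B.
  - eexists. now exists O.
  - exists l. intros n. apply Rabs_le_between.
    assert (x n - 2 * s / 2 ^ n <= l) by (apply L1; now exists n).
    assert (l <= x n + 2 * s / 2 ^ n) by (apply L2; intros y [m ->]; apply B).
    lra.
Qed.

Lemma exists_pow2_small (a e : R) : 0 < e -> exists n : nat, a / 2 ^ n < e.
Proof.
  intros He. destruct (archimed_cor1 (e / (Rabs a + 1))) as [N [HN N0]].
  { apply Rdiv_lt_0_compat; auto. pose proof (Rabs_pos a). lra. }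
  exists N.
  assert (P : INR N < 2 ^ N).
  { clear. induction N. simpl; lra. rewrite S_INR. simpl.
    assert (1 <= 2 ^ N) by (apply pow_R1_Rle; lra). lra. }
  assert (N1 : 0 < INR N) by (apply lt_0_INR; lia).
  assert (Pa := Rabs_pos a). apply Rle_lt_trans with (Rabs a / INR N).
  - apply Rle_trans with (Rabs a / 2 ^ N).
    apply Rmult_le_compat_r. apply Rlt_le, Rinv_0_lt_compat; lra. apply Rle_abs.
    apply Rmult_le_compat_l; auto. apply Rinv_le_contravar; lra.
  - apply Rlt_div_r in HN; [|lra]. unfold Rdiv. rewrite Rmult_comm. nra.
Qed.

Section Goursat.
Variable g : C -> C.
Hypothesis Hg : holoH g.

Definition tri : Type := (C * C * C)%type.
Definition contour (t : tri) : C :=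
  let '(a, b, c) := t in (Cint g a b + Cint g b c + Cint g c a)%C.
Definition in_upper (t : tri) : Prop :=
  let '(a, b, c) := t in upper_half a /\ upper_half b /\ upper_half c.

Definition quarter1 (t : tri) : tri := let '(a, b, c) := t in (a, mid a b, mid a c).
Definition quarter2 (t : tri) : tri := let '(a, b, c) := t in (mid a b, b, mid b c).
Definition quarter3 (t : tri) : tri := let '(a, b, c) := t in (mid a c, mid b c, c).
Definition quarter4 (t : tri) : tri := let '(a, b, c) := t in (mid b c, mid a c, mid a b).

Definition heavy_quarter (t : tri) : tri :=
  if Rle_dec (Cmod (contour t) / 4) (Cmod (contour (quarter1 t))) then quarter1 t else
  if Rle_dec (Cmod (contour t) / 4) (Cmod (contour (quarter2 t))) then quarter2 t else
  if Rle_dec (Cmod (contour t) / 4) (Cmod (contour (quarter3 t))) then quarter3 t else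
  quarter4 t.

Lemma contour_split t : in_upper t ->
  contour t = (contour (quarter1 t) + contour (quarter2 t) + contour (quarter3 t)
               + contour (quarter4 t))%C.
Proof.
  destruct t as [[a b] c]. intros (Ha & Hb & Hc). simpl.
  rewrite (Cint_midpoint g a b), (Cint_midpoint g b c), (Cint_midpoint g c a) by auto.
  fold (mid a b) (mid b c) (mid c a). rewrite (mid_comm c a).
  rewrite (Cint_swap g (mid a b) (mid a c)), (Cint_swap g (mid a b) (mid b c)),
    (Cint_swap g (mid b c) (mid a c)) by (auto using mid_upper). ring.
Qed.

Lemma heavy_quarter_ge t : in_upper t ->
  Cmod (contour t) <= 4 * Cmod (contour (heavy_quarter t)).
Proof.
  intros Ht. unfold heavy_quarter. repeat destruct Rle_dec; try lra.
  assert (E := contour_split t Ht). apply (f_equal Cmod) in E.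
  pose proof (Cmod_triangle (contour (quarter1 t) + contour (quarter2 t) + contour (quarter3 t))
    (contour (quarter4 t))).
  pose proof (Cmod_triangle (contour (quarter1 t) + contour (quarter2 t)) (contour (quarter3 t))).
  pose proof (Cmod_triangle (contour (quarter1 t)) (contour (quarter2 t))).
  lra.
Qed.

Definition sides_le (t : tri) (s : R) : Prop :=
  let '(a, b, c) := t in Cmod (b - a) <= s /\ Cmod (c - b) <= s /\ Cmod (a - c) <= s.

Definition above (m : R) (t : tri) : Prop :=
  let '(a, b, c) := t in m <= Im a /\ m <= Im b /\ m <= Im c.

Definition vertex (t : tri) : C := let '(a, b, c) := t in a.

Lemma heavy_quarter_cases (P : tri -> Prop) t :
  P (quarter1 t) -> P (quarter2 t) -> P (quarter3 t) -> P (quarter4 t) ->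
  P (heavy_quarter t).
Proof. intros. unfold heavy_quarter. repeat destruct Rle_dec; auto. Qed.

Lemma heavy_quarter_above m t : above m t -> above m (heavy_quarter t).
Proof.
  destruct t as [[a b] c]. intros (Ha & Hb & Hc).
  unfold Im in *.
  apply heavy_quarter_cases; unfold above, quarter1, quarter2, quarter3, quarter4, Im;
   rewrite ?mid_eq; simpl; repeat split; lra.
Qed.

Lemma heavy_quarter_sides t s : sides_le t s -> sides_le (heavy_quarter t) (s / 2).
Proof.
  destruct t as [[a b] c]. intros (Ha & Hb & Hc).
  assert (E1 := mid_sub_l a b). assert (E2 := mid_sub_l a c).
  assert (E3 := mid_sub_l b a). assert (E4 := mid_sub_l b c).
  assert (E5 := mid_sub_l c a). assert (E6 := mid_sub_l c b).
  assert (E7 := mid_sub_mid a b c). assert (E8 := mid_sub_mid b c a).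
  assert (E9 := mid_sub_mid c a b).
  rewrite (mid_comm b a) in *. rewrite (mid_comm c a) in *. rewrite (mid_comm c b) in *.
  rewrite (Cmod_sub_comm a b) in *. rewrite (Cmod_sub_comm b c) in *.
  rewrite (Cmod_sub_comm c a) in *.
  apply heavy_quarter_cases; simpl; repeat split; try lra; rewrite Cmod_sub_comm; lra.
Qed.

Lemma heavy_quarter_vertex t s : sides_le t s ->
  Cmod (vertex (heavy_quarter t) - vertex t) <= s.
Proof.
  destruct t as [[a b] c]. intros (Ha & Hb & Hc).
  assert (Hs := Rle_trans _ _ _ (Cmod_ge_0 _) Ha).
  apply heavy_quarter_cases; simpl.
  - replace (a - a)%C with (RtoC 0) by ring. now rewrite Cmod_0.
  - rewrite mid_sub_l. lra.
  - rewrite mid_sub_l, Cmod_sub_comm. lra.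
  - replace (mid b c - a)%C with ((mid b c - mid b a) + (mid a b - a))%C
      by (rewrite (mid_comm b a); ring).
    eapply Rle_trans. apply Cmod_triangle. rewrite mid_sub_l, mid_sub_mid, (Cmod_sub_comm c a). lra.
Qed.

Lemma seg_dist z0 z1 z t r : 0 <= t <= 1 -> Cmod (z0 - z) <= r -> Cmod (z1 - z) <= r ->
  Cmod (seg z0 z1 t - z) <= r.
Proof.
  intros Ht H0 H1.
  replace (seg z0 z1 t - z)%C with (RtoC (1 - t) * (z0 - z) + RtoC t * (z1 - z))%C
    by (unfold seg; rewrite RtoC_minus; ring).
  eapply Rle_trans. apply Cmod_triangle.
  rewrite !Cmod_mult, !Cmod_R, !Rabs_pos_eq by lra. nra.
Qed.

Lemma contour_near z l eps d t r s : 0 <= eps -> in_upper t -> sides_le t s ->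
  (forall y, Cmod (y - z) < d -> Cmod (g y - g z - (y - z) * l) <= eps * Cmod (y - z)) ->
  r < d -> (let '(a, b, c) := t in Cmod (a - z) <= r /\ Cmod (b - z) <= r /\ Cmod (c - z) <= r) ->
  Cmod (contour t) <= 3 * (eps * r * s).
Proof.
  destruct t as [[a b] c]. intros He (Ua & Ub & Uc) (S1 & S2 & S3) Hd Hr (Ra & Rb & Rc).
  set (lin := fun y => (g z + (y - z) * l)%C).
  set (Lin := fun y => (g z * y + (y - z) * (y - z) * (l * RtoC (/ 2)))%C).
  assert (HL : forall y, cderiv Lin y (lin y)).
  { intros y. unfold Lin, lin.
    eapply cderiv_eq; cycle 1.
    apply cderiv_plus. apply cderiv_mult. apply cderiv_const. apply cderiv_id.
    apply cderiv_mult; [|apply cderiv_const].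
    apply cderiv_mult; (apply cderiv_minus; [apply cderiv_id|apply cderiv_const]).
    simpl. apply injective_projections; simpl; field. }
  assert (hl : holoH lin).
  { intros y _. eexists. unfold lin. apply cderiv_plus. apply cderiv_const.
    apply cderiv_mult; [|apply cderiv_const].
    apply cderiv_minus; [apply cderiv_id|apply cderiv_const]. }
  assert (E : contour (a, b, c) = (Cint (fun y => g y - lin y) a b +
     Cint (fun y => g y - lin y) b c + Cint (fun y => g y - lin y) c a)%C).
  { rewrite !Cint_minus by auto. simpl.
    rewrite !(Cint_FTC _ _ ) with (g := lin) (G := Lin) by auto. ring. }
  rewrite E.
  assert (B : forall x y, upper_half x -> upper_half y -> Cmod (x - z) <= r -> Cmod (y - z) <= r ->
    Cmod (y - x) <= s -> Cmod (Cint (fun y => g y - lin y)%C x y) <= eps * r * s).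
  { intros x y Ux Uy Hx Hy Hs.
    assert (r0 := Rle_trans _ _ _ (Cmod_ge_0 _) Hx).
    apply Rle_trans with (eps * r * Cmod (y - x)).
    - apply Cint_bound; auto. now apply holoH_minus.
      intros t Ht. assert (K := seg_dist x y z t r Ht Hx Hy).
      specialize (Hd (seg x y t) ltac:(lra)). unfold lin.
      replace (_ - _)%C with (g (seg x y t) - g z - (seg x y t - z) * l)%C by ring.
      eapply Rle_trans. apply Hd. apply Rmult_le_compat_l; auto.
    - apply Rmult_le_compat_l; auto. now apply Rmult_le_pos. }
  eapply Rle_trans. apply Cmod_triangle.
  eapply Rle_trans. apply Rplus_le_compat_r. apply Cmod_triangle.
  pose proof (B a b Ua Ub Ra Rb S1). pose proof (B b c Ub Uc Rb Rc S2).
  pose proof (B c a Uc Ua Rc Ra S3). lra.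
Qed.

Lemma goursat t : in_upper t -> contour t = RtoC 0.
Proof.
  intros Ht. apply Cmod_eq_0.
  assert (exists m, 0 < m /\ above m t) as (m & Hm & Ab).
  { destruct t as [[a b] c]. destruct Ht as (Ha & Hb & Hc).
    exists (Rmin (Im a) (Rmin (Im b) (Im c))). split. repeat apply Rmin_pos; auto.
    repeat split. apply Rmin_l. eapply Rle_trans. apply Rmin_r. apply Rmin_l.
    eapply Rle_trans. apply Rmin_r. apply Rmin_r. }
  assert (exists s, 0 < s /\ sides_le t s) as (s & Hs & Sd).
  { destruct t as [[a b] c]. exists (Cmod (b - a) + Cmod (c - b) + Cmod (a - c) + 1).
    pose proof (Cmod_ge_0 (b - a)). pose proof (Cmod_ge_0 (c - b)). pose proof (Cmod_ge_0 (a - c)).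
    simpl. repeat split; lra. }
  set (T := fun n => Nat.iter n heavy_quarter t).
  assert (TA : forall n, above m (T n)).
  { induction n; auto. now apply heavy_quarter_above. }
  assert (TU : forall n, in_upper (T n)).
  { intros n. specialize (TA n). destruct (T n) as [[a b] c]. destruct TA as (A & B & D).
    unfold in_upper, upper_half. lra. }
  assert (TS : forall n, sides_le (T n) (s / 2 ^ n)).
  { induction n. simpl. now rewrite Rdiv_1_r.
    replace (s / 2 ^ S n) with (s / 2 ^ n / 2) by (simpl; field; apply pow_nonzero; lra).
    now apply heavy_quarter_sides. }
  assert (TG : forall n, Cmod (contour t) <= 4 ^ n * Cmod (contour (T n))).
  { induction n. simpl; lra. eapply Rle_trans. apply IHn.
    simpl. rewrite (Rmult_comm 4), Rmult_assoc. apply Rmult_le_compat_l. apply pow_le; lra.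
    now apply heavy_quarter_ge. }
  assert (TV : forall n, Cmod (vertex (T (S n)) - vertex (T n)) <= s / 2 ^ n).
  { intros n. apply heavy_quarter_vertex. apply TS. }
  destruct (geometric_cauchy (fun n => Re (vertex (T n))) s) as [x Hx]. lra.
  { intros n. eapply Rle_trans; [|apply TV]. eapply Rle_trans; [|apply re_le_Cmod]. apply Req_le.
    reflexivity. }
  destruct (geometric_cauchy (fun n => Im (vertex (T n))) s) as [y Hy]. lra.
  { intros n. eapply Rle_trans; [|apply TV]. eapply Rle_trans; [|apply Rmax_Cmod].
    eapply Rle_trans; [|apply Rmax_r]. apply Req_le. reflexivity. }
  set (z := (x, y)).
  assert (P : forall n, 0 < 2 ^ n) by (intros; apply pow_lt; lra).
  assert (Uz : upper_half z).
  { destruct (exists_pow2_small (2 * s) m Hm) as [n Hn]. specialize (Hy n). specialize (TA n).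
    destruct (T n) as [[a b] c]. simpl in *. destruct TA as (A & _ & _).
    apply Rabs_le_between in Hy. unfold upper_half, z; simpl. unfold Im in *. lra. }
  assert (Zn : forall n, let '(a, b, c) := T n in Cmod (a - z) <= 5 * s / 2 ^ n /\
     Cmod (b - z) <= 5 * s / 2 ^ n /\ Cmod (c - z) <= 5 * s / 2 ^ n).
  { intros n. specialize (Hx n). specialize (Hy n). specialize (TS n).
    destruct (T n) as [[a b] c]. simpl in *. destruct TS as (S1 & S2 & S3).
    assert (A : Cmod (a - z) <= 4 * s / 2 ^ n).
    { replace (a - z)%C with (RtoC (Re a - x) + RtoC (Im a - y) * Ci)%C
        by (apply injective_projections; simpl; unfold Re, Im; ring).
      eapply Rle_trans. apply Cmod_triangle. rewrite Cmod_mult, Cmod_Ci, !Cmod_R. lra. }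
    pose proof (Cmod_triangle (b - a) (a - z)). replace (b - a + (a - z))%C with (b - z)%C in H by ring.
    pose proof (Cmod_triangle (- (a - c)) (a - z)). rewrite Cmod_opp in H0.
    replace (- (a - c) + (a - z))%C with (c - z)%C in H0 by ring.
    assert (0 < s / 2 ^ n) by (apply Rdiv_lt_0_compat; auto). unfold Rdiv in *. repeat split; lra. }
  destruct (Hg z Uz) as [l Hl].
  assert (Main : forall eps, 0 < eps -> Cmod (contour t) <= 15 * s * s * eps).
  { intros eps He. destruct (Hl eps He) as [d [Hd K]].
    destruct (exists_pow2_small (5 * s) d Hd) as [n Hn].
    eapply Rle_trans. apply (TG n).
    assert (N := contour_near z l eps d (T n) _ (s / 2 ^ n) (Rlt_le _ _ He) (TU n) (TS n) K Hn (Zn n)).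
    eapply Rle_trans. apply Rmult_le_compat_l. apply pow_le; lra. apply N.
    right. replace 4 with (2 * 2) by ring. rewrite Rpow_mult_distr. field. specialize (P n). lra. }
  apply Rle_antisym; [|apply Cmod_ge_0].
  apply Rnot_lt_le. intros Hc.
  specialize (Main (Cmod (contour t) / (30 * s * s))).
  assert (0 < 30 * s * s) by nra.
  specialize (Main ltac:(apply Rdiv_lt_0_compat; auto)).
  replace (15 * s * s * (Cmod (contour t) / (30 * s * s))) with (Cmod (contour t) / 2) in Main
   by (field; lra). lra.
Qed.

Theorem primitive_exists : exists G, forall z, upper_half z -> cderiv G z (g z).
Proof.
  exists (fun z => Cint g Ci z). intros z Hz eps He.
  assert (UI : upper_half Ci) by (unfold upper_half, Ci; simpl; lra).
  destruct (Hg z Hz) as [l Hl]. destruct (Hl 1 Rlt_0_1) as [d [Hd K]].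
  set (M := 1 + Cmod l). assert (0 < M) by (unfold M; pose proof (Cmod_ge_0 l); lra).
  exists (Rmin (Im z) (Rmin d (eps / M))). split.
  { repeat apply Rmin_pos; auto. apply Rdiv_lt_0_compat; auto. }
  intros y Hy.
  assert (H1 := Rlt_le_trans _ _ _ Hy (Rmin_l _ _)).
  assert (H2 := Rlt_le_trans _ _ _ Hy (Rmin_r _ _)).
  assert (H3 := Rlt_le_trans _ _ _ H2 (Rmin_l _ _)).
  assert (H4 := Rlt_le_trans _ _ _ H2 (Rmin_r _ _)). clear H2 Hy.
  apply Rlt_div_r in H4; auto.
  assert (Uy : upper_half y).
  { pose proof (Rle_trans _ _ _ (Rmax_r _ _) (Rmax_Cmod (y - z)%C)) as Q.
    apply Rabs_le_between in Q. unfold upper_half, Im in *. simpl in *. lra. }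
  assert (E := goursat (Ci, z, y) (conj UI (conj Hz Uy))). simpl in E.
  rewrite (Cint_swap g Ci y) in E by auto.
  replace (Cint g Ci y - Cint g Ci z)%C with (Cint g z y).
  2:{ replace (Cint g z y) with ((Cint g Ci z + Cint g z y + - Cint g Ci y) - Cint g Ci z + Cint g Ci y)%C
       by ring. rewrite E. ring. }
  assert (Hc : holoH (fun _ => g z)) by (intros ? _; eexists; apply cderiv_const).
  replace ((y - z) * g z)%C with (Cint (fun _ => g z) z y).
  2:{ rewrite (Cint_FTC z y Hz Uy (fun _ => g z) (fun y => g z * y)%C Hc).
    ring. intros x _. eapply cderiv_eq; cycle 1.
    apply cderiv_mult. apply cderiv_const. apply cderiv_id. simpl. ring. }
  rewrite <- Cint_minus by auto.
  apply Cint_bound; auto. now apply holoH_minus.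
  intros t Ht.
  assert (D := seg_dist z y z t (Cmod (y - z)) Ht). replace (z - z)%C with (RtoC 0) in D by ring.
  specialize (D ltac:(rewrite Cmod_0; apply Cmod_ge_0) (Rle_refl _)).
  specialize (K _ (Rle_lt_trans _ _ _ D H3)).
  replace (g (seg z y t) - g z)%C with ((g (seg z y t) - g z - (seg z y t - z) * l) +
    (seg z y t - z) * l)%C by ring.
  eapply Rle_trans. apply Cmod_triangle. rewrite Cmod_mult.
  pose proof (Cmod_ge_0 l). unfold M in *. nra.
Qed.
End Goursat.

(** * Transport along the tree of arcs *)

Definition mat_of_letter (b : bool) : mat2 := if b then mT else mV.
Definition letter_act (b : bool) (z : R) : R := if b then z + 1 else z / (z + 1).

Lemma letter_act_pos b z : 0 < z -> 0 < letter_act b z.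
Proof. intros. destruct b; simpl. lra. apply Rdiv_lt_0_compat; lra. Qed.

Lemma upper_neq_real z x : upper_half z -> (z - RtoC x)%C <> 0%R.
Proof.
  unfold upper_half, Im. intros H E. apply (f_equal snd) in E. simpl in E. lra.
Qed.

Lemma RtoC_neq0 x : x <> 0 -> RtoC x <> 0%R.
Proof. intros H E. apply RtoC_inj in E. auto. Qed.

(* For w repelling, w' attracting and Q vanishing at both, with the sign convention on Q,
   sqrt D / Q(z,1) = (w - w') / ((z - w) (z - w')). *)
Definition geodesic_kernel (f : C -> C) (w w' : R) (z : C) : C :=
  (f z * (RtoC (w - w') * (/ (z - RtoC w) * / (z - RtoC w'))))%C.

Definition primitive_on_upper (G g : C -> C) : Prop :=
  forall z, upper_half z -> cderiv G z (g z).

Lemma cderiv_translate z x : cderiv (fun y => y - RtoC x)%C z (RtoC 1).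
Proof.
  eapply cderiv_eq; cycle 1. apply cderiv_minus. apply cderiv_id. apply cderiv_const. ring.
Qed.

Lemma cderiv_inv_translate z x : upper_half z -> exists l,
  cderiv (fun y => / (y - RtoC x))%C z l.
Proof.
  intros H. eexists. apply (cderiv_comp Cinv (fun y => y - RtoC x)%C).
  apply cderiv_inv. now apply upper_neq_real. apply cderiv_translate.
Qed.

Lemma geodesic_kernel_holo f w w' : holoH f -> holoH (geodesic_kernel f w w').
Proof.
  intros Hf z Hz. destruct (Hf z Hz) as [l Hl].
  destruct (cderiv_inv_translate z w Hz) as [l1 H1].
  destruct (cderiv_inv_translate z w' Hz) as [l2 H2].
  eexists. apply cderiv_mult. exact Hl. apply cderiv_mult. apply cderiv_const.
  apply cderiv_mult; eassumption.
Qed.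

Lemma mobiusC_T z : mobiusC mT z = (z + RtoC 1)%C.
Proof. unfold mobiusC, ZtoC; simpl. field. Qed.

Lemma upper_neq_m1 z : upper_half z -> (z + RtoC 1)%C <> 0%R.
Proof. intros H. replace (z + RtoC 1)%C with (z - RtoC (-1))%C. now apply upper_neq_real.
  apply injective_projections; simpl; ring. Qed.

Lemma mobiusC_V z : mobiusC mV z = (z / (z + RtoC 1))%C.
Proof. unfold mobiusC, ZtoC; simpl. f_equal; [ring|f_equal; ring]. Qed.

Lemma mobiusC_letter_upper b z : upper_half z -> upper_half (mobiusC (mat_of_letter b) z).
Proof.
  intros H. destruct b; simpl.
  - rewrite mobiusC_T. unfold upper_half, Im in *. simpl. lra.
  - rewrite mobiusC_V. assert (N := upper_neq_m1 z H). destruct z as [x y].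
    unfold upper_half, Im, Re in *. simpl in *.
    assert (P : 0 < (x + 1) * (x + 1) + y * y).
    { pose proof (Rle_0_sqr (x + 1)). pose proof (Rmult_lt_0_compat y y H H). unfold Rsqr in *. lra. }
    apply Rlt_le_trans with (y / ((x + 1) * (x + 1) + y * y)). now apply Rdiv_lt_0_compat.
    right. field. lra.
Qed.

Lemma cderiv_mobiusC_letter b z : upper_half z ->
  cderiv (mobiusC (mat_of_letter b)) z
    (if b then RtoC 1 else (/ ((z + RtoC 1) * (z + RtoC 1)))%C).
Proof.
  intros H. assert (N := upper_neq_m1 z H). destruct b; simpl.
  - eapply cderiv_ext. intros y. symmetry. apply mobiusC_T.
    eapply cderiv_eq; cycle 1. apply cderiv_plus. apply cderiv_id. apply cderiv_const. ring.
  - eapply cderiv_ext. intros y. symmetry. apply mobiusC_V.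
    eapply cderiv_eq; cycle 1. apply cderiv_mult. apply cderiv_id.
    apply (cderiv_comp Cinv (fun y => y + RtoC 1)%C). apply cderiv_inv; auto.
    apply cderiv_plus. apply cderiv_id. apply cderiv_const. simpl. field. auto.
Qed.

Lemma SL2Z_letter b : SL2Z (mat_of_letter b).
Proof. destruct b; reflexivity. Qed.

Section Modular.
Variable f : C -> C.
Hypothesis f_holo : holoH f.
Hypothesis f_inv : forall A z, SL2Z A -> upper_half z -> f (mobiusC A z) = f z.

Lemma primitive_letter b G u v : 0 < u -> 0 < v ->
  primitive_on_upper G (geodesic_kernel f (- u) (letter_act b v)) ->
  primitive_on_upper (fun z => G (mobiusC (mat_of_letter b) z))
    (geodesic_kernel f (- letter_act b u) v).
Proof.
  intros Hu Hv HG z Hz. eapply cderiv_eq; cycle 1.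
  { apply (cderiv_comp G). apply HG. now apply mobiusC_letter_upper.
    now apply cderiv_mobiusC_letter. }
  unfold geodesic_kernel. rewrite f_inv by (auto; apply SL2Z_letter).
  assert (N := upper_neq_m1 z Hz).
  assert (N1 := upper_neq_real z (- letter_act b u) Hz). assert (N2 := upper_neq_real z v Hz).
  destruct b; simpl letter_act in *; simpl mat_of_letter.
  - rewrite mobiusC_T.
    replace (z + RtoC 1 - RtoC (- u))%C with (z - RtoC (- (u + 1)))%C
      by (apply injective_projections; simpl; ring).
    replace (z + RtoC 1 - RtoC (v + 1))%C with (z - RtoC v)%C
      by (apply injective_projections; simpl; ring).
    replace (- u - (v + 1)) with (- (u + 1) - v) by ring. ring.
  - rewrite mobiusC_V.
    assert (NU : RtoC (u + 1) <> 0%R) by (apply RtoC_neq0; lra).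
    assert (NV : RtoC (v + 1) <> 0%R) by (apply RtoC_neq0; lra).
    replace (z / (z + RtoC 1) - RtoC (- u))%C
      with (RtoC (u + 1) * (z - RtoC (- (u / (u + 1)))) / (z + RtoC 1))%C.
    2:{ rewrite !RtoC_opp, RtoC_div, RtoC_plus by lra. rewrite RtoC_plus in NU. field; auto. }
    replace (z / (z + RtoC 1) - RtoC (v / (v + 1)))%C
      with ((z - RtoC v) / ((z + RtoC 1) * RtoC (v + 1)))%C.
    2:{ rewrite RtoC_div, RtoC_plus by lra. rewrite RtoC_plus in NV. field; auto. }
    replace (- (u / (u + 1)) - v) with ((- u - v / (v + 1)) * (v + 1) / (u + 1)) by (field; lra).
    rewrite (RtoC_div (_ * _)), (RtoC_mult _ (v + 1)) by lra.
    set (X := (z - RtoC (- (u / (u + 1))))%C) in *. set (Y := (z - RtoC v)%C) in *.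
    set (U := RtoC (u + 1)) in *. set (V := RtoC (v + 1)) in *.
    set (Z := (z + RtoC 1)%C) in *. field. repeat split; auto.
Qed.

Definition arc (t : R) : C := (cos t, sin t).
Definition darc (t : R) : C := (- sin t, cos t).

Lemma curve_deriv_pair (p q : R -> R) t dp dq : is_derive p t dp -> is_derive q t dq ->
  curve_deriv (fun s => (p s, q s)) t (dp, dq).
Proof.
  intros [_ Hp] [_ Hq]. apply curve_derivP. intros eps He.
  assert (He2 : 0 < eps / 2) by lra.
  destruct (Hp t (fun P H0 => H0) (mkposreal _ He2)) as [d1 H1].
  destruct (Hq t (fun P H0 => H0) (mkposreal _ He2)) as [d2 H2].
  exists (Rmin d1 d2). split. apply Rmin_pos; apply cond_pos.
  intros s Hs.
  specialize (H1 s (Rlt_le_trans _ _ _ Hs (Rmin_l _ _))).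
  specialize (H2 s (Rlt_le_trans _ _ _ Hs (Rmin_r _ _))).
  simpl in H1, H2. unfold norm, minus, plus, opp, scal in H1, H2; simpl in H1, H2.
  unfold abs, mult in H1, H2; simpl in H1, H2.
  replace (_ - _ - _)%C with (RtoC (p s + - p t + - ((s + - t) * dp)) +
    RtoC (q s + - q t + - ((s + - t) * dq)) * Ci)%C
    by (apply injective_projections; simpl; ring).
  eapply Rle_trans. apply Cmod_triangle. rewrite Cmod_mult, Cmod_Ci, !Cmod_R.
  unfold Rminus in *. lra.
Qed.

Lemma arc_deriv t : curve_deriv arc t (darc t).
Proof.
  apply curve_deriv_pair; auto_derive; auto; ring.
Qed.

Lemma arc_upper t : 0 < t < PI -> upper_half (arc t).
Proof. intros H. apply sin_gt_0; tauto. Qed.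

Lemma arc_bounds t : PI / 3 <= t <= 2 * PI / 3 ->
  0 < sin t /\ - (1 / 2) <= cos t <= 1 / 2.
Proof.
  intros H. assert (P := PI_RGT_0).
  split. apply sin_gt_0; lra.
  rewrite <- cos_PI3. split.
  - replace (- cos (PI / 3)) with (cos (2 * (PI / 3))). apply cos_decr_1; lra.
    rewrite cos_2PI3, cos_PI3. lra.
  - apply cos_decr_1; lra.
Qed.

Definition arc_weight (t : R) : R := Re (f (arc t)) * sin t.

Definition arc_integral (k : R -> R) : R :=
  RInt (fun t => arc_weight t * k t) (PI / 3) (2 * PI / 3).

Lemma arc_weight_continuous t : 0 < t < PI -> continuous arc_weight t.
Proof.
  intros Ht. unfold arc_weight. apply (continuous_mult (fun t => Re (f (arc t)))).
  - assert (K := holo_curve_continuous f arc t _ f_holo (arc_upper t Ht) (arc_deriv t)).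
    apply (continuous_comp (U := R_UniformSpace) (V := C_UniformSpace) (W := R_UniformSpace) (fun t => f (arc t)) (fun z : C => fst z) t K).
    apply continuous_fst.
  - apply (ex_derive_continuous sin). auto_derive. auto.
Qed.

Lemma ex_arc_integral k :
  (forall t, PI / 3 <= t <= 2 * PI / 3 -> continuous k t) ->
  ex_RInt (fun t => arc_weight t * k t) (PI / 3) (2 * PI / 3).
Proof.
  intros Hk. assert (P := PI_RGT_0).
  apply (ex_RInt_continuous (V := R_CompleteNormedModule)).
  rewrite Rmin_left, Rmax_right by lra. intros t Ht.
  apply (continuous_mult arc_weight k). apply arc_weight_continuous; lra. auto.
Qed.

Lemma arc_weight_sym t : 0 < t < PI -> arc_weight (PI - t) = arc_weight t.
Proof.
  intros Ht. unfold arc_weight. replace (sin (PI - t)) with (sin t) by (rewrite sin_PI_x; auto).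
  do 2 f_equal. rewrite <- (f_inv (Mat2 0 (-1) 1 0) (arc t)) by (reflexivity || now apply arc_upper).
  f_equal. unfold mobiusC, ZtoC, arc; simpl ma; simpl mb; simpl mc; simpl md.
  replace (PI - t) with (- (t - PI)) by ring.
  rewrite cos_neg, sin_neg.
  assert (E := sin2_cos2 t). unfold Rsqr in E.
  replace (cos (t - PI)) with (- cos t) by (rewrite cos_minus, cos_PI, sin_PI; ring).
  replace (sin (t - PI)) with (- sin t) by (rewrite sin_minus, cos_PI, sin_PI; ring).
  assert (NZ : cos t * (cos t * 1) + sin t * (sin t * 1) <> 0) by lra.
  assert (E' : cos t * (cos t * 1) + sin t * (sin t * 1) = 1) by lra.
  apply injective_projections; simpl; rewrite ?Rplus_0_l, ?Rplus_0_r, ?Rmult_1_l, ?Rmult_0_l,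
    ?Rminus_0_r, ?Rplus_0_l, ?Rplus_0_r, ?Rmult_1_r in *;
    rewrite E'; field.
Qed.

Definition arc_value (c : R) : R := arc_integral (fun t => c / (c * c - 4 * (cos t * cos t))).

Lemma continuous_of_ex_derive (k : R -> R) t : ex_derive k t -> continuous k t.
Proof. intros. now apply (ex_derive_continuous k). Qed.

Lemma arc_denominators c t : 2 <= c -> PI / 3 <= t <= 2 * PI / 3 ->
  0 < c + 2 * cos t /\ 0 < c - 2 * cos t /\ 0 < c * c - 4 * (cos t * cos t).
Proof.
  intros Hc Ht. destruct (arc_bounds t Ht) as [_ B]. repeat split; nra.
Qed.

Lemma arc_integral_reflect k :
  (forall t, PI / 3 <= t <= 2 * PI / 3 -> continuous k t) ->
  arc_integral (fun t => k (PI - t)) = arc_integral k.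
Proof.
  intros Hk. unfold arc_integral. assert (P := PI_RGT_0).
  assert (E := RInt_comp_lin (V := R_CompleteNormedModule) (fun t => arc_weight t * k t)
     (-1) PI (PI / 3) (2 * PI / 3)).
  replace (-1 * (PI / 3) + PI) with (2 * PI / 3) in E by field.
  replace (-1 * (2 * PI / 3) + PI) with (PI / 3) in E by field.
  specialize (E (ex_RInt_swap _ _ _ (ex_arc_integral k Hk))).
  rewrite <- (opp_RInt_swap _ _ _ (ex_RInt_swap _ _ _ (ex_arc_integral k Hk))), <- E.
  rewrite <- (RInt_opp (V := R_CompleteNormedModule)).
  2:{ apply (ex_RInt_comp_lin (V := R_CompleteNormedModule) (fun t => arc_weight t * k t)).
      replace (-1 * (PI / 3) + PI) with (2 * PI / 3) by field.
      replace (-1 * (2 * PI / 3) + PI) with (PI / 3) by field.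
      apply ex_RInt_swap. now apply ex_arc_integral. }
  apply RInt_ext. rewrite Rmin_left, Rmax_right by lra. intros t Ht.
  replace (-1 * t + PI) with (PI - t) by ring. rewrite arc_weight_sym by lra.
  unfold opp, scal; simpl. unfold mult; simpl. ring.
Qed.

Lemma arc_integral_sum k1 k2 :
  (forall t, PI / 3 <= t <= 2 * PI / 3 -> continuous k1 t) ->
  (forall t, PI / 3 <= t <= 2 * PI / 3 -> continuous k2 t) ->
  arc_integral k1 + arc_integral k2 = arc_integral (fun t => k1 t + k2 t).
Proof.
  intros H1 H2. unfold arc_integral.
  eapply eq_trans.
  symmetry. apply (RInt_plus (V := R_CompleteNormedModule) _ _ _ _
     (ex_arc_integral k1 H1) (ex_arc_integral k2 H2)).
  apply RInt_ext. intros t _. unfold plus; simpl. ring.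
Qed.

Lemma arc_integral_ext k1 k2 :
  (forall t, PI / 3 <= t <= 2 * PI / 3 -> k1 t = k2 t) -> arc_integral k1 = arc_integral k2.
Proof.
  intros H. unfold arc_integral. apply RInt_ext. assert (P := PI_RGT_0).
  rewrite Rmin_left, Rmax_right by lra. intros t Ht. rewrite H; lra.
Qed.

Lemma arc_value_half c : 2 <= c ->
  arc_integral (fun t => / (c - 2 * cos t)) = arc_value c /\
  arc_integral (fun t => / (c + 2 * cos t)) = arc_value c.
Proof.
  intros Hc.
  assert (C1 : forall t, PI / 3 <= t <= 2 * PI / 3 -> continuous (fun t => / (c - 2 * cos t)) t).
  { intros t Ht. apply continuous_of_ex_derive. auto_derive.
    pose proof (arc_denominators c t Hc Ht). lra. }
  assert (C2 : forall t, PI / 3 <= t <= 2 * PI / 3 -> continuous (fun t => / (c + 2 * cos t)) t).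
  { intros t Ht. apply continuous_of_ex_derive. auto_derive.
    pose proof (arc_denominators c t Hc Ht). lra. }
  assert (C3 : forall t, PI / 3 <= t <= 2 * PI / 3 ->
    continuous (fun t => c / (c * c - 4 * (cos t * cos t))) t).
  { intros t Ht. apply continuous_of_ex_derive. auto_derive.
    pose proof (arc_denominators c t Hc Ht). lra. }
  assert (E1 := arc_integral_reflect _ C1).
  rewrite (arc_integral_ext _ (fun t => / (c + 2 * cos t))) in E1.
  2:{ intros t _. rewrite cos_minus, cos_PI, sin_PI. f_equal. ring. }
  assert (E2 := arc_integral_sum _ _ C1 C2 : arc_integral (fun t => / (c - 2 * cos t)) +
    arc_integral (fun t => / (c + 2 * cos t)) = arc_integral (fun t => / (c - 2 * cos t) + / (c + 2 * cos t))).
  assert (E3 := arc_integral_sum _ _ C3 C3 : arc_value c + arc_value c = arc_integral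
    (fun t => c / (c * c - 4 * (cos t * cos t)) + c / (c * c - 4 * (cos t * cos t)))).
  assert (E4 : arc_integral (fun t => / (c - 2 * cos t) + / (c + 2 * cos t)) =
    arc_integral (fun t => c / (c * c - 4 * (cos t * cos t)) + c / (c * c - 4 * (cos t * cos t)))).
  { apply arc_integral_ext. intros t Ht. destruct (arc_denominators c t Hc Ht) as (D1 & D2 & D3).
    field. repeat split; apply Rgt_not_eq; assumption. }
  change (arc_integral (fun t => / (c + 2 * cos t)) = arc_integral (fun t => / (c - 2 * cos t))) in E1.
  lra.
Qed.

Hypothesis f_real : forall t, PI / 3 <= t <= 2 * PI / 3 -> Im (f (arc t)) = 0.

Lemma kernel_on_arc u v t : 0 < u -> 0 < v -> PI / 3 <= t <= 2 * PI / 3 ->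
  Re (geodesic_kernel f (- u) v (arc t) * darc t)%C =
  - (arc_weight t * (/ (u + / u + 2 * cos t) + / (v + / v - 2 * cos t))).
Proof.
  intros Hu Hv Ht. destruct (arc_bounds t Ht) as [Hs Hc].
  unfold geodesic_kernel, arc_weight. assert (I := f_real t Ht).
  destruct (f (arc t)) as [a b]. unfold Im, Re in *; simpl in I. subst b.
  assert (E := sin2_cos2 t). unfold Rsqr in E.
  set (x := cos t) in *. set (y := sin t) in *.
  assert (E' : y * y = 1 - x * x) by lra.
  assert (NU : 0 < 1 + 2 * u * x + u * u) by nra.
  assert (NV : 0 < 1 - 2 * v * x + v * v) by nra.
  replace (/ (arc t - RtoC (- u)))%C with
    ((x + u) / (1 + 2 * u * x + u * u), - y / (1 + 2 * u * x + u * u)).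
  2:{ unfold arc. fold x y. unfold Cinv; simpl.
      replace ((x + - - u) * ((x + - - u) * 1) + (y + - 0) * ((y + - 0) * 1))
        with (1 + 2 * u * x + u * u). apply injective_projections; simpl; f_equal; ring.
      rewrite Rmult_1_r. ring_simplify. ring_simplify in E'. rewrite E'. ring. }
  replace (/ (arc t - RtoC v))%C with
    ((x - v) / (1 - 2 * v * x + v * v), - y / (1 - 2 * v * x + v * v)).
  2:{ unfold arc. fold x y. unfold Cinv; simpl.
      replace ((x + - v) * ((x + - v) * 1) + (y + - 0) * ((y + - 0) * 1))
        with (1 - 2 * v * x + v * v). apply injective_projections; simpl; f_equal; ring.
      rewrite Rmult_1_r. ring_simplify. ring_simplify in E'. rewrite E'. ring. }
  replace (/ (u + / u + 2 * x)) with (u / (1 + 2 * u * x + u * u)) by (field; split; nra).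
  replace (/ (v + / v - 2 * x)) with (v / (1 - 2 * v * x + v * v)) by (field; split; nra).
  unfold darc. fold x y. simpl.
  field_simplify_eq; [|split; nra].
  replace (y ^ 3) with (y * (y * y)) by ring. rewrite E'. ring.
Qed.

Definition rho : C := arc (PI / 3).
Definition rho2 : C := arc (2 * PI / 3).

Lemma arc_step G u v : 0 < u -> 0 < v ->
  primitive_on_upper G (geodesic_kernel f (- u) v) ->
  Re (G rho - G rho2)%C = arc_value (u + / u) + arc_value (v + / v).
Proof.
  intros Hu Hv HG. assert (P := PI_RGT_0).
  assert (two : forall x, 0 < x -> 2 <= x + / x).
  { intros x Hx. apply Rminus_le_0. replace (x + / x - 2) with ((x - 1) * (x - 1) * / x) by (field; lra).
    apply Rmult_le_pos. apply Rle_0_sqr. now apply Rlt_le, Rinv_0_lt_compat. }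
  set (k := geodesic_kernel f (- u) v).
  assert (Hk : holoH k) by now apply geodesic_kernel_holo.
  set (q := fun t => (k (arc t) * darc t)%C).
  assert (Cq : forall t, 0 < t < PI -> continuous (T := R_UniformSpace) (U := C_UniformSpace) q t).
  { intros t Ht. apply (continuous_ext (fun t => k (arc t) * (arc t * Ci))%C).
    - intros s. unfold q. f_equal. apply injective_projections; simpl; ring.
    - apply (holo_curve_continuous (fun z => k z * (z * Ci))%C arc t (darc t)).
      + intros z Hz. destruct (Hk z Hz) as [l Hl]. eexists. apply cderiv_mult. exact Hl.
        apply cderiv_mult. apply cderiv_id. apply cderiv_const.
      + now apply arc_upper.
      + apply arc_deriv. }
  assert (E : RInt (V := C_R_CompleteNormedModule) q (PI / 3) (2 * PI / 3) = (G rho2 - G rho)%C).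
  { apply (FTC_curve (fun t => G (arc t)) q); rewrite Rmin_left, Rmax_right by lra; intros t Ht.
    - apply cderiv_curve. apply HG, arc_upper; lra. apply arc_deriv.
    - apply Cq. lra. }
  assert (Eq : ex_RInt (V := C_R_CompleteNormedModule) q (PI / 3) (2 * PI / 3)).
  { apply (ex_RInt_continuous (V := C_R_CompleteNormedModule)).
    rewrite Rmin_left, Rmax_right by lra. intros t Ht. apply Cq. lra. }
  apply (RInt_correct (V := C_R_CompleteNormedModule)) in Eq. rewrite E in Eq.
  apply (is_RInt_fct_extend_fst (U := R_NormedModule) (V := R_NormedModule)) in Eq.
  apply (is_RInt_unique (V := R_CompleteNormedModule)) in Eq.
  replace (Re (G rho - G rho2)%C) with (- fst (G rho2 - G rho)%C) by (unfold Re; simpl; ring).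
  change (RInt (V := R_CompleteNormedModule) (fun t => fst (q t)) (PI / 3) (2 * PI / 3) =
    fst (G rho2 - G rho)%C) in Eq.
  rewrite <- Eq.
  assert (Cu : forall t, PI / 3 <= t <= 2 * PI / 3 -> continuous (fun t => / (u + / u + 2 * cos t)) t).
  { intros t Ht. apply continuous_of_ex_derive. auto_derive.
    destruct (arc_denominators _ t (two u Hu) Ht). lra. }
  assert (Cv : forall t, PI / 3 <= t <= 2 * PI / 3 -> continuous (fun t => / (v + / v - 2 * cos t)) t).
  { intros t Ht. apply continuous_of_ex_derive. auto_derive.
    destruct (arc_denominators _ t (two v Hv) Ht). lra. }
  rewrite <- (proj2 (arc_value_half _ (two u Hu))), <- (proj1 (arc_value_half _ (two v Hv))).
  eapply eq_trans; [|symmetry; apply (arc_integral_sum _ _ Cu Cv)].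
  unfold arc_integral.
  assert (C3 : forall t, PI / 3 <= t <= 2 * PI / 3 ->
     continuous (fun t => / (u + / u + 2 * cos t) + / (v + / v - 2 * cos t)) t).
  { intros t Ht. apply (continuous_plus (fun t => / (u + / u + 2 * cos t))); auto. }
  assert (Ex := ex_arc_integral _ C3).
  assert (EE : RInt (fun t => fst (q t)) (PI / 3) (2 * PI / 3) =
    RInt (fun t => opp (arc_weight t * (/ (u + / u + 2 * cos t) + / (v + / v - 2 * cos t))))
     (PI / 3) (2 * PI / 3)).
  { apply RInt_ext. rewrite Rmin_left, Rmax_right by lra. intros t Ht.
    apply (kernel_on_arc u v t Hu Hv). lra. }
  eapply eq_trans. apply f_equal. exact EE.
  rewrite (RInt_opp (V := R_CompleteNormedModule)) by exact Ex.
  apply Ropp_involutive.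
Qed.

Fixpoint prefix_map (l : nat -> bool) (n : nat) (z : C) : C :=
  match n with
  | O => z
  | S n => prefix_map l n (mobiusC (mat_of_letter (l n)) z)
  end.

Fixpoint rsum (a : nat -> R) (n : nat) : R :=
  match n with O => 0 | S n => rsum a n + a n end.

Lemma prefix_map_upper l n z : upper_half z -> upper_half (prefix_map l n z).
Proof.
  revert z. induction n; intros z Hz; auto. simpl. apply IHn. now apply mobiusC_letter_upper.
Qed.

Lemma mobiusC_letter_rho2 b : mobiusC (mat_of_letter b) rho2 = rho.
Proof.
  unfold rho, rho2, arc. replace (2 * PI / 3) with (2 * (PI / 3)) by field.
  rewrite cos_2PI3, sin_2PI3, cos_PI3, sin_PI3.
  assert (Q : sqrt 3 * sqrt 3 = 3) by (apply sqrt_sqrt; lra).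
  destruct b; simpl mat_of_letter.
  - rewrite mobiusC_T. apply injective_projections; simpl; field.
  - rewrite mobiusC_V.
    assert (D : (-1 / 2 + 1) * ((-1 / 2 + 1) * 1) + (sqrt 3 / 2 + 0) * ((sqrt 3 / 2 + 0) * 1) = 1) by nra.
    apply injective_projections; simpl; rewrite D; nra.
Qed.

Section Path.
Variables (l : nat -> bool) (n : nat) (u v : nat -> R) (G : C -> C).
Hypotheses (u_pos : forall k, (k <= n)%nat -> 0 < u k) (v_pos : forall k, (k <= n)%nat -> 0 < v k).
Hypothesis u_rec : forall k, (k < n)%nat -> u (S k) = letter_act (l k) (u k).
Hypothesis v_rec : forall k, (k < n)%nat -> v k = letter_act (l k) (v (S k)).
Hypothesis HG : primitive_on_upper G (geodesic_kernel f (- u O) (v O)).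

Lemma primitive_prefix k : (k <= n)%nat ->
  primitive_on_upper (fun z => G (prefix_map l k z)) (geodesic_kernel f (- u k) (v k)).
Proof.
  induction k; intros Hk. exact HG.
  specialize (IHk ltac:(lia)). rewrite v_rec in IHk by lia.
  rewrite u_rec by lia.
  apply (primitive_letter (l k) (fun z => G (prefix_map l k z))); auto.
  apply u_pos; lia.
Qed.

Lemma path_sum k : (k <= n)%nat -> Re (G (prefix_map l k rho2) - G rho2)%C =
  rsum (fun j => arc_value (u j + / u j) + arc_value (v j + / v j)) k.
Proof.
  induction k; intros Hk. simpl. unfold Re; simpl; ring.
  simpl. rewrite mobiusC_letter_rho2, <- IHk by lia.
  rewrite <- (arc_step (fun z => G (prefix_map l k z))); [|apply u_pos; lia|apply v_pos; lia|].
  unfold Re; simpl; ring. apply primitive_prefix; lia.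
Qed.

Lemma period_integral z0 : upper_half z0 -> u n = u O -> v n = v O ->
  Re (Cint (geodesic_kernel f (- u O) (v O)) z0 (prefix_map l n z0)) =
  rsum (fun j => arc_value (u j + / u j) + arc_value (v j + / v j)) n.
Proof.
  intros H0 Hu Hv. assert (P := PI_RGT_0).
  assert (Ur : upper_half rho2) by (apply arc_upper; lra).
  rewrite (Cint_FTC z0 _ H0 (prefix_map_upper l n z0 H0) _ G); auto using geodesic_kernel_holo.
  rewrite <- (path_sum n) by auto. f_equal.
  set (D := fun z => (G (prefix_map l n z) - G z)%C).
  change (D z0 = D rho2).
  assert (Z0 : holoH (fun _ => RtoC 0)) by (intros z _; eexists; apply cderiv_const).
  assert (E1 := Cint_FTC z0 rho2 H0 Ur (fun _ => RtoC 0) D Z0).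
  assert (E2 := Cint_FTC z0 rho2 H0 Ur (fun _ => RtoC 0) (fun _ => RtoC 0) Z0).
  rewrite E2 in E1 by (intros z _; apply cderiv_const).
  assert (E3 : (RtoC 0 - RtoC 0)%C = (D rho2 - D z0)%C).
  { apply E1. intros z Hz. eapply cderiv_eq; cycle 1.
    apply cderiv_minus. apply (primitive_prefix n (le_n n) z Hz). apply (HG z Hz).
    rewrite Hu, Hv. ring. }
  replace (D rho2) with (D z0 + (D rho2 - D z0))%C by ring. rewrite <- E3. ring.
Qed.
End Path.
End Modular.

(** * The cycle integral of a word *)

Fixpoint prefix (l : nat -> bool) (n : nat) : mat2 :=
  match n with
  | O => mI
  | S n => mmul (prefix l n) (mat_of_letter (l n))
  end.

Lemma prefix_SL2Z l n : SL2Z (prefix l n).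
Proof.
  induction n. reflexivity. unfold SL2Z in *. simpl.
  destruct (prefix l n) as [a b c d]; destruct (l n); simpl in *; nia.
Qed.

Lemma prefix_bounds l n : (1 <= ma (prefix l n) /\ 0 <= mb (prefix l n) /\
  0 <= mc (prefix l n) /\ 1 <= md (prefix l n))%Z.
Proof.
  induction n. simpl; lia. simpl.
  destruct (prefix l n) as [a b c d]; destruct (l n); simpl in *; lia.
Qed.

Lemma prefix_S_T l n : l n = true -> let A := prefix l n in
  prefix l (S n) = Mat2 (ma A) (ma A + mb A) (mc A) (mc A + md A).
Proof. intros H. simpl. rewrite H. unfold mmul; simpl. f_equal; ring. Qed.

Lemma prefix_S_V l n : l n = false -> let A := prefix l n in
  prefix l (S n) = Mat2 (ma A + mb A) (mb A) (mc A + md A) (md A).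
Proof. intros H. simpl. rewrite H. unfold mmul; simpl. f_equal; ring. Qed.

Lemma automorphy_neq0 A z : SL2Z A -> upper_half z -> (ZtoC (mc A) * z + ZtoC (md A))%C <> 0%R.
Proof.
  intros HA Hz E. unfold SL2Z, upper_half, Im, ZtoC in *.
  destruct z as [x y]. simpl in *.
  assert (E1 := f_equal fst E). assert (E2 := f_equal snd E). simpl in E1, E2.
  assert (E3 : IZR (mc A) = 0) by (apply Rmult_eq_reg_r with y; lra).
  rewrite E3 in E1. assert (E4 : IZR (md A) = 0) by lra.
  apply eq_IZR in E3, E4. rewrite E3, E4 in HA. lia.
Qed.

Lemma prefix_map_mobiusC l n z : upper_half z -> mobiusC (prefix l n) z = prefix_map l n z.
Proof.
  revert z. induction n; intros z Hz.
  - simpl. unfold mobiusC, ZtoC; simpl. field.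
  - simpl prefix_map. rewrite <- IHn by now apply mobiusC_letter_upper.
    assert (Hz' := mobiusC_letter_upper (l n) z Hz).
    assert (N1 := automorphy_neq0 _ _ (prefix_SL2Z l n) Hz').
    assert (N2 := automorphy_neq0 _ _ (SL2Z_letter (l n)) Hz).
    assert (N3 := automorphy_neq0 _ _ (prefix_SL2Z l (S n)) Hz).
    simpl prefix in *. unfold mobiusC in *. set (B := mat_of_letter (l n)) in *.
    set (A := prefix l n) in *. unfold ZtoC in *. simpl in *.
    rewrite !plus_IZR, !mult_IZR, !RtoC_plus, !RtoC_mult in *.
    field. repeat split; auto. intros K. apply N3. rewrite <- K. ring.
Qed.

Lemma fixed_point_eq A w : fixed_point A w ->
  IZR (ma A) * w + IZR (mb A) = w * (IZR (mc A) * w + IZR (md A)).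
Proof.
  intros [H1 H2]. unfold mobiusR in H2. rewrite <- H2 at 2. field. auto.
Qed.

Lemma Derive_mobiusR A x : SL2Z A -> IZR (mc A) * x + IZR (md A) <> 0 ->
  Derive (mobiusR A) x = / (IZR (mc A) * x + IZR (md A)) ^ 2.
Proof.
  intros HA H. apply is_derive_unique. unfold mobiusR. auto_derive. auto.
  unfold SL2Z in HA. apply (f_equal IZR) in HA. rewrite minus_IZR, !mult_IZR in HA.
  field_simplify_eq; auto. lra.
Qed.

Definition positive_entries (A : mat2) : Prop :=
  SL2Z A /\ (1 <= ma A)%Z /\ (1 <= mb A)%Z /\ (1 <= mc A)%Z /\ (1 <= md A)%Z.

Lemma hyperbolic_prefix l n : hyperbolic (prefix l n) <->
  (1 <= mb (prefix l n) /\ 1 <= mc (prefix l n))%Z.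
Proof.
  assert (H1 := prefix_SL2Z l n). assert (H2 := prefix_bounds l n).
  unfold hyperbolic, SL2Z in *. destruct (prefix l n) as [a b c d]; simpl in *. split.
  - intros [_ H]. rewrite Z.abs_eq in H by lia. split; nia.
  - intros H. split; auto. rewrite Z.abs_eq by lia. nia.
Qed.

Lemma repelling_neg A w : positive_entries A -> repelling_fixed_point A w -> w < 0.
Proof.
  intros (H & Ha & Hb & Hc & Hd) [Hf Hr]. assert (E := fixed_point_eq A w Hf).
  rewrite Derive_mobiusR in Hr by (auto; apply Hf).
  apply IZR_le in Ha, Hb, Hc, Hd.
  apply Rnot_le_lt. intros Hw.
  set (c := IZR (mc A)) in *. set (d := IZR (md A)) in *.
  destruct (Req_dec w 0) as [->|]. lra.
  assert (1 < c * w + d) by nra. rewrite Rabs_pos_eq in Hr.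
  2:{ apply Rlt_le, Rinv_0_lt_compat. nra. }
  assert (1 <= (c * w + d) ^ 2) by nra. apply Rinv_le_contravar in H2; lra.
Qed.

Lemma attracting_pos A w w' : positive_entries A -> repelling_fixed_point A w ->
  attracting_fixed_point A w' -> 0 < w'.
Proof.
  intros P Hr [Ff Fa]. assert (Nw := repelling_neg A w P Hr). destruct Hr as [Hf Hr].
  destruct P as (H & Ha & Hb & Hc & Hd).
  assert (E := fixed_point_eq A w Hf). assert (E' := fixed_point_eq A w' Ff).
  apply IZR_le in Ha, Hb, Hc, Hd.
  apply Rnot_le_lt. intros Hw. assert (N : w <> w') by (intros ->; lra).
  set (c := IZR (mc A)) in *. set (d := IZR (md A)) in *.
  set (a := IZR (ma A)) in *. set (b := IZR (mb A)) in *.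
  assert (K : (w - w') * (c * (w + w') + d - a) = 0) by nra.
  apply Rmult_integral in K. destruct K as [K|K]. lra.
  assert (b = - c * (w * w')) by nra.
  assert (0 <= w * w') by nra. nra.
Qed.

Lemma form_exists A : positive_entries A -> exists Q, is_form_of A Q.
Proof.
  intros (H & Ha & Hb & Hc & Hd).
  set (g := Z.gcd (mc A) (Z.gcd (ma A - md A) (mb A))).
  assert (Hg : (0 < g)%Z).
  { assert (0 <= g)%Z by apply Z.gcd_nonneg. assert (g <> 0)%Z; [|lia].
    intros E. apply Z.gcd_eq_0 in E. lia. }
  assert (D1 : (g | mc A)%Z) by apply Z.gcd_divide_l.
  assert (D2 : (g | ma A - md A)%Z).
  { eapply Z.divide_trans. apply Z.gcd_divide_r. apply Z.gcd_divide_l. }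
  assert (D3 : (g | mb A)%Z).
  { eapply Z.divide_trans. apply Z.gcd_divide_r. apply Z.gcd_divide_r. }
  destruct D1 as [c' D1], D2 as [m' D2], D3 as [b' D3].
  assert (Pr : Z.gcd c' (Z.gcd m' b') = 1%Z).
  { assert (E : g = (g * Z.gcd c' (Z.gcd m' b'))%Z).
    { rewrite <- !Z.gcd_mul_mono_l_nonneg by lia.
      rewrite !(Z.mul_comm g), <- D1, <- D2, <- D3. reflexivity. }
    nia. }
  assert (c'pos : (0 < c')%Z) by nia.
  unfold SL2Z in H. assert (HR := f_equal IZR H). rewrite minus_IZR, !mult_IZR in HR.
  assert (D1R := f_equal IZR D1). assert (D2R := f_equal IZR D2). assert (D3R := f_equal IZR D3).
  rewrite mult_IZR in D1R, D2R, D3R. rewrite minus_IZR in D2R.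
  apply IZR_le in Ha, Hb, Hc, Hd. apply IZR_lt in Hg. apply IZR_lt in c'pos.
  set (a := IZR (ma A)) in *. set (b := IZR (mb A)) in *.
  set (c := IZR (mc A)) in *. set (d := IZR (md A)) in *.
  set (s := sqrt ((a + d) ^ 2 - 4)).
  assert (bc : 0 < b * c) by nra.
  assert (Hs2 : s * s = (a + d) ^ 2 - 4) by (apply sqrt_sqrt; nra).
  assert (Hs0 : 0 <= s) by apply sqrt_pos.
  assert (Hs1 : (a - d) * (a - d) < s * s) by nra.
  assert (S1 : a - d < s) by nra. assert (S2 : - s < a - d) by nra.
  set (w := (a - d - s) / (2 * c)). set (w' := (a - d + s) / (2 * c)).
  assert (W1 : c * w = (a - d - s) / 2) by (unfold w; field; lra).
  assert (W2 : c * w' = (a - d + s) / 2) by (unfold w'; field; lra).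
  assert (Q1 : c * (w * w) = (a - d) * w + b).
  { apply Rmult_eq_reg_l with c; [|lra]. nra. }
  assert (Q2 : c * (w' * w') = (a - d) * w' + b).
  { apply Rmult_eq_reg_l with c; [|lra]. nra. }
  assert (Ps : 0 < s) by nra.
  assert (Den1 : c * w + d = (a + d - s) / 2) by lra.
  assert (Den2 : c * w' + d = (a + d + s) / 2) by lra.
  assert (X1 : 0 < c * w + d < 1). { rewrite Den1. split; nra. }
  assert (X2 : 1 < c * w' + d) by (rewrite Den2; nra).
  exists (Form (- c') m' b'). exists w, w'.
  assert (F1 : fixed_point A w).
  { split. fold c d. lra. unfold mobiusR. fold a b c d. apply Rmult_eq_reg_r with (c * w + d); [|lra].
    field_simplify; lra. }
  assert (F2 : fixed_point A w').
  { split. fold c d. lra. unfold mobiusR. fold a b c d. apply Rmult_eq_reg_r with (c * w' + d); [|lra].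
    field_simplify; lra. }
  repeat split; try apply F1; try apply F2.
  - rewrite Derive_mobiusR by (auto; apply F1). fold c d.
    rewrite Rabs_pos_eq by (apply Rlt_le, Rinv_0_lt_compat; nra).
    rewrite <- Rinv_1. apply Rinv_lt_contravar; nra.
  - rewrite Derive_mobiusR by (auto; apply F2). fold c d.
    rewrite Rabs_pos_eq by (apply Rlt_le, Rinv_0_lt_compat; nra).
    rewrite <- Rinv_1. apply Rinv_lt_contravar; nra.
  - unfold Defs.primitive; cbn [fa fb fc]. rewrite Z.gcd_opp_l. exact Pr.
  - unfold form_R; cbn [fa fb fc]. rewrite opp_IZR. apply Rmult_eq_reg_r with (IZR g); [|lra].
    apply Rminus_diag_uniq. transitivity (- (IZR c' * IZR g) * (w * w) + (IZR m' * IZR g) * w + IZR b' * IZR g).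
    ring. rewrite <- D1R, <- D2R, <- D3R. lra.
  - unfold form_R; cbn [fa fb fc]. rewrite opp_IZR. apply Rmult_eq_reg_r with (IZR g); [|lra].
    apply Rminus_diag_uniq. transitivity (- (IZR c' * IZR g) * (w' * w') + (IZR m' * IZR g) * w' + IZR b' * IZR g).
    ring. rewrite <- D1R, <- D2R, <- D3R. lra.
  - cbn [fa]. rewrite !sign_eq_m1; auto.
    apply Rmult_lt_reg_l with c. lra. rewrite Rmult_minus_distr_l. lra.
    rewrite opp_IZR. lra.
Qed.

Lemma form_of_factor A : positive_entries A -> exists w w',
  w < 0 /\ 0 < w' /\ fixed_point A w /\ fixed_point A w' /\
  forall z, upper_half z ->
   (RtoC (sqrt (IZR (Defs.disc (form_of A)))) / form_C (form_of A) z (RtoC 1))%C =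
   (RtoC (w - w') * (/ (z - RtoC w) * / (z - RtoC w')))%C.
Proof.
  intros P. assert (S := epsilon_spec (inhabits (Form 0 0 0)) (is_form_of A) (form_exists A P)).
  fold (form_of A) in S. set (Q := form_of A) in *.
  destruct S as (w & w' & Hw & Hw' & _ & Q1 & Q2 & Sg). exists w, w'.
  assert (Nw := repelling_neg A w P Hw). assert (Pw := attracting_pos A w w' P Hw Hw').
  repeat split; auto; try apply Hw; try apply Hw'.
  intros z Hz.
  rewrite (sign_eq_m1 (w - w')) in Sg by lra.
  assert (Neg : IZR (fa Q) < 0).
  { destruct (Rlt_le_dec (IZR (fa Q)) 0) as [|L]; auto.
    destruct L as [L|L]. rewrite sign_eq_1 in Sg; lra. rewrite <- L, sign_0 in Sg. lra. }
  unfold form_R in Q1, Q2.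
  assert (B : IZR (fb Q) = - IZR (fa Q) * (w + w')).
  { apply Rmult_eq_reg_r with (w - w'); [|lra]. nra. }
  assert (Cc : IZR (fc Q) = IZR (fa Q) * (w * w')).
  { rewrite B in Q1. lra. }
  assert (Sq : sqrt (IZR (Defs.disc Q)) = IZR (fa Q) * (w - w')).
  { unfold Defs.disc. rewrite minus_IZR, !mult_IZR, B, Cc.
    replace (_ - _) with (Rsqr (IZR (fa Q) * (w - w'))) by (unfold Rsqr; ring).
    apply sqrt_Rsqr. nra. }
  rewrite Sq. unfold form_C, ZtoC. rewrite B, Cc.
  assert (N1 := upper_neq_real z w Hz). assert (N2 := upper_neq_real z w' Hz).
  assert (N3 : RtoC (IZR (fa Q)) <> 0%R) by (apply RtoC_neq0; lra).
  replace (_ + _ + _)%C with (RtoC (IZR (fa Q)) * ((z - RtoC w) * (z - RtoC w')))%C.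
  rewrite RtoC_mult. field. auto.
  rewrite !RtoC_mult, RtoC_opp, RtoC_plus. simpl. ring.
Qed.

Section Orbits.
Variable l : nat -> bool.

Fixpoint forward_orbit (x : R) (n : nat) : R :=
  match n with O => x | S n => letter_act (l n) (forward_orbit x n) end.

Lemma forward_orbit_pos x n : 0 < x -> 0 < forward_orbit x n.
Proof. intros Hx. induction n; auto. now apply letter_act_pos. Qed.

Lemma backward_orbit n y : 0 < y -> exists v : nat -> R,
  (forall k, 0 < v k) /\ v n = y /\ forall k, (k < n)%nat -> v k = letter_act (l k) (v (S k)).
Proof.
  revert y. induction n; intros y Hy. exists (fun _ => y). repeat split; auto; lia.
  destruct (IHn (letter_act (l n) y) (letter_act_pos _ _ Hy)) as (v & V1 & V2 & V3).
  exists (fun k => if (k <=? n)%nat then v k else y). split; [|split].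
  - intros k. destruct (k <=? n)%nat; auto.
  - destruct (Nat.leb_spec (S n) n); auto; lia.
  - intros k Hk. destruct (Nat.leb_spec k n); [|lia]. destruct (Nat.leb_spec (S k) n).
    apply V3; lia. replace k with n by lia. auto.
Qed.

Lemma forward_orbit_prefix x n : 0 < x -> let A := prefix l n in let y := forward_orbit x n in
  0 < - IZR (mc A) * y + IZR (md A) /\
  - IZR (ma A) * y + IZR (mb A) = - x * (- IZR (mc A) * y + IZR (md A)).
Proof.
  intros Hx. induction n. simpl. split; lra.
  cbv zeta in *. destruct IHn as [I1 I2].
  assert (Py := forward_orbit_pos x n Hx). simpl forward_orbit.
  set (y := forward_orbit x n) in *. destruct (l n) eqn:El.
  - rewrite prefix_S_T by auto. simpl. rewrite !plus_IZR. split; [lra|]. lra.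
  - rewrite prefix_S_V by auto. simpl. rewrite !plus_IZR.
    set (a := IZR (ma _)) in *. set (b := IZR (mb _)) in *.
    set (c := IZR (mc _)) in *. set (d := IZR (md _)) in *.
    replace (- (c + d) * (y / (y + 1)) + d) with ((- c * y + d) * / (y + 1)) by (field; lra).
    replace (- (a + b) * (y / (y + 1)) + b) with ((- a * y + b) * / (y + 1)) by (field; lra).
    split. apply Rmult_lt_0_compat; auto. apply Rinv_0_lt_compat; lra. rewrite I2. ring.
Qed.

Lemma backward_orbit_prefix n (v : nat -> R) : (forall k, 0 < v k) ->
  (forall k, (k < n)%nat -> v k = letter_act (l k) (v (S k))) ->
  forall k, (k <= n)%nat -> let A := prefix l k in
  IZR (ma A) * v k + IZR (mb A) = v O * (IZR (mc A) * v k + IZR (md A)).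
Proof.
  intros Hv Hr k. induction k; intros Hk. simpl; lra.
  cbv zeta in *. specialize (IHk ltac:(lia)). rewrite (Hr k) in IHk by lia.
  specialize (Hv (S k)). destruct (l k) eqn:El.
  - rewrite prefix_S_T by auto. simpl. rewrite !plus_IZR. simpl in IHk. lra.
  - rewrite prefix_S_V by auto. simpl. rewrite !plus_IZR. simpl in IHk.
    set (a := IZR (ma _)) in *. set (b := IZR (mb _)) in *.
    set (c := IZR (mc _)) in *. set (d := IZR (md _)) in *. set (y := v (S k)) in *.
    apply Rmult_eq_reg_r with (/ (y + 1)). 2: { apply Rgt_not_eq, Rinv_0_lt_compat; lra. }
    replace (((a + b) * y + b) * / (y + 1)) with (a * (y / (y + 1)) + b) by (field; lra).
    rewrite IHk. field. lra.
Qed.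
End Orbits.

Section Modular.
Variable f : C -> C.
Hypothesis f_holo : holoH f.
Hypothesis f_inv : forall A z, SL2Z A -> upper_half z -> f (mobiusC A z) = f z.
Hypothesis f_real : forall t, PI / 3 <= t <= 2 * PI / 3 -> Im (f (arc t)) = 0.

Lemma Re_I_f_prefix l n z0 : upper_half z0 -> hyperbolic (prefix l n) ->
  exists (u v : nat -> R), (forall k, 0 < u k) /\ (forall k, 0 < v k) /\
   (forall k, u (S k) = letter_act (l k) (u k)) /\
   (forall k, (k < n)%nat -> v k = letter_act (l k) (v (S k))) /\ u n = u O /\ v n = v O /\
   Re (I_f f z0 (prefix l n)) =
     rsum (fun j => arc_value f (u j + / u j) + arc_value f (v j + / v j)) n.
Proof.
  intros Hz0 Hyp.
  assert (P : positive_entries (prefix l n)).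
  { assert (H2 := prefix_bounds l n). assert (H1 := prefix_SL2Z l n).
    apply hyperbolic_prefix in Hyp. repeat split; auto; tauto. }
  destruct (form_of_factor _ P) as (w & w' & Hw & Hw' & Fw & Fw' & Ker).
  destruct (backward_orbit l n w' Hw') as (v & V1 & V2 & V3).
  set (u := forward_orbit l (- w)).
  assert (Pu : forall k, 0 < u k) by (intros k; apply forward_orbit_pos; lra).
  destruct P as (_ & Ha & Hb & Hc & Hd). apply IZR_le in Ha, Hb, Hc, Hd.
  assert (V0 : v O = w').
  { assert (E := backward_orbit_prefix l n v V1 V3 n (le_n n)). cbv zeta in E.
    rewrite V2, (fixed_point_eq _ _ Fw') in E.
    apply Rmult_eq_reg_r with (IZR (mc (prefix l n)) * w' + IZR (md (prefix l n))). auto.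
    apply Rgt_not_eq. nra. }
  assert (Un : u n = - w).
  { destruct (forward_orbit_prefix l (- w) n ltac:(lra)) as [_ E]. fold u in E.
    assert (E' := fixed_point_eq _ _ Fw).
    apply Rmult_eq_reg_l with (IZR (ma (prefix l n)) - w * IZR (mc (prefix l n))).
    2:{ apply Rgt_not_eq. nra. } lra. }
  exists u, v. split; [auto|]. split; [auto|]. split; [reflexivity|]. split; [auto|].
  split; [auto|]. split; [congruence|].
  destruct (primitive_exists (geodesic_kernel f (- u O) (v O))) as [G HG].
  { now apply geodesic_kernel_holo. }
  rewrite <- (period_integral f f_holo f_inv f_real l n u v G) with (z0 := z0); auto; try congruence.
  f_equal. unfold I_f. destruct excluded_middle_informative as [_|K]; [|tauto].
  rewrite <- prefix_map_mobiusC by auto. unfold Cint.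
  apply (RInt_ext (V := C_R_CompleteNormedModule)). rewrite Rmin_left, Rmax_right by lra. intros t Ht.
  apply (f_equal (fun x => Cmult x _)).
  assert (Us : upper_half (seg z0 (mobiusC (prefix l n) z0) t)).
  { apply seg_upper; auto; [|lra]. rewrite prefix_map_mobiusC by auto. now apply prefix_map_upper. }
  fold (seg z0 (mobiusC (prefix l n) z0) t). unfold geodesic_kernel.
  rewrite V0. replace (- u O) with w by (unfold u; simpl; ring). rewrite <- Ker by auto.
  unfold Cdiv. ring.
Qed.
End Modular.

(** * The arc value as a function of the size *)

(* The weight of the potential - 1 / (r + 1), determined by the vanishing at v = phi of the
   v-derivative of the left-hand side of [kernel_alternation]; here m stands for 4 cos^2 t. *)
Definition tilt (m : R) : R := (3 * sqrt 5 + 5) * (5 + m) / (10 * (5 - m) ^ 2).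

Lemma sqrt5_sq : sqrt 5 * sqrt 5 = 5.
Proof. apply sqrt_sqrt; lra. Qed.

Lemma sqrt5_bounds : 2.236 < sqrt 5 < 2.237.
Proof.
  assert (H := sqrt5_sq). assert (P := sqrt_pos 5). split.
  - apply Rnot_le_lt. intros K. nra.
  - apply Rnot_le_lt. intros K. nra.
Qed.

Lemma kernel_alternation m v : 0 <= m <= 1 -> 1 <= v ->
  v * (v ^ 2 + 1) / ((v ^ 2 + 1) ^ 2 - m * v ^ 2) + tilt m * ((v - 1) / v - / (v + 1))
  <= sqrt 5 / (5 - m).
Proof.
  intros Hm Hv. assert (S2 := sqrt5_sq). assert (Sb := sqrt5_bounds). unfold tilt.
  set (s := sqrt 5) in *. clearbody s.
  assert (D : 0 < (v ^ 2 + 1) ^ 2 - m * v ^ 2).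
  { replace ((v ^ 2 + 1) ^ 2 - m * v ^ 2) with (v ^ 4 + 1 + (2 - m) * v ^ 2) by ring.
    assert (0 <= v ^ 4) by (apply pow_le; lra). assert (0 <= v ^ 2) by (apply pow_le; lra). nra. }
  set (t := v - 1). assert (Ht : 0 <= t) by (unfold t; lra).
  (* The difference of the two sides is (v - phi)^2 P up to a positive factor, and the
     coefficients p_i of P in t = v - 1 are positive for m in [0,1]. *)
  set (p0 := (240 * s - 200) + (135 - 77 * s) * m + (3 * s - 25) * m ^ 2).
  set (p1 := (530 * s - 450) + (260 - 194 * s) * m + (6 * s - 60) * m ^ 2).
  set (p2 := (480 * s - 400) + (145 - 179 * s) * m + (3 * s - 45) * m ^ 2).
  set (p3 := (215 * s - 175) + (15 - 77 * s) * m - 10 * m ^ 2).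
  set (p4 := (35 * s - 25) - (5 + 13 * s) * m).
  assert (P0 : 0 <= p0) by (unfold p0; nra). assert (P1 : 0 <= p1) by (unfold p1; nra).
  assert (P2 : 0 <= p2) by (unfold p2; nra). assert (P3 : 0 <= p3) by (unfold p3; nra).
  assert (P4 : 0 <= p4) by (unfold p4; nra).
  set (P := p0 + p1 * t + p2 * t ^ 2 + p3 * t ^ 3 + p4 * t ^ 4).
  assert (HP : 0 <= P).
  { unfold P. pose proof (pow_le t 2 Ht). pose proof (pow_le t 3 Ht). pose proof (pow_le t 4 Ht).
    do 4 (apply Rplus_le_le_0_compat; [|apply Rmult_le_pos; assumption]). assumption. }
  assert (DD : 0 < 10 * (5 - m) ^ 2 * v * (v + 1) * ((v ^ 2 + 1) ^ 2 - m * v ^ 2)).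
  { apply Rmult_lt_0_compat; [|exact D]. apply Rmult_lt_0_compat; [|lra].
    apply Rmult_lt_0_compat; [|lra]. pose proof (pow_lt (5 - m) 2). lra. }
  apply Rminus_le_0.
  replace (_ - _) with ((v - (1 + s) / 2) ^ 2 * P /
    (10 * (5 - m) ^ 2 * v * (v + 1) * ((v ^ 2 + 1) ^ 2 - m * v ^ 2))).
  - apply Rmult_le_pos. apply Rmult_le_pos; auto. apply pow2_ge_0.
    apply Rlt_le, Rinv_0_lt_compat. exact DD.
  - unfold P, p0, p1, p2, p3, p4, t. clear - S2 D DD Hm Hv.
    apply Rmult_eq_reg_r with (10 * (5 - m) ^ 2 * v * (v + 1) * ((v ^ 2 + 1) ^ 2 - m * v ^ 2)).
    2:{ apply Rgt_not_eq. exact DD. }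
    field_simplify; [|repeat split; try lra; apply Rgt_not_eq, D |lra].
    field_simplify_eq. assert (S2' : s ^ 2 = 5) by lra. ring [S2'].
Qed.

Lemma kernel_repetition m v : 0 <= m <= 1 -> 2 <= v ->
  v * (v ^ 2 + 1) / ((v ^ 2 + 1) ^ 2 - m * v ^ 2) + tilt m * (/ v - / (v + 1))
  <= sqrt 5 / (5 - m).
Proof.
  intros Hm Hv. eapply Rle_trans; [|apply (kernel_alternation m 2 Hm); lra].
  assert (T : 0 <= tilt m).
  { unfold tilt. pose proof (sqrt_pos 5). apply Rmult_le_pos. nra.
    apply Rlt_le, Rinv_0_lt_compat. nra. }
  apply Rplus_le_compat.
  - assert (D : 0 < (v ^ 2 + 1) ^ 2 - m * v ^ 2).
    { replace ((v ^ 2 + 1) ^ 2 - m * v ^ 2) with (v ^ 4 + 1 + (2 - m) * v ^ 2) by ring.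
      assert (0 <= v ^ 4) by (apply pow_le; lra). assert (0 <= v ^ 2) by (apply pow_le; lra). nra. }
    apply Rle_div_l; auto. apply Rmult_le_reg_r with ((2 ^ 2 + 1) ^ 2 - m * 2 ^ 2). lra.
    replace (2 * (2 ^ 2 + 1) / ((2 ^ 2 + 1) ^ 2 - m * 2 ^ 2) * ((v ^ 2 + 1) ^ 2 - m * v ^ 2) * ((2 ^ 2 + 1) ^ 2 - m * 2 ^ 2))
     with (10 * ((v ^ 2 + 1) ^ 2 - m * v ^ 2)) by (field; lra).
    apply Rminus_le_0.
    replace (_ - _) with ((v - 2) * (2 * v - 1) * (5 * (v ^ 2 + 1) + 2 * m * v)) by ring.
    repeat apply Rmult_le_pos; nra.
  - apply Rmult_le_compat_l; auto.
    replace (/ v - / (v + 1)) with (/ (v * (v + 1))) by (field; lra).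
    replace ((2 - 1) / 2 - / (2 + 1)) with (/ 6) by field.
    apply Rinv_le_contravar; nra.
Qed.

Definition rsize (z : R) : R := Rmax z (/ z).

Lemma rsize_ge1 z : 0 < z -> 1 <= rsize z.
Proof.
  intros Hz. unfold rsize. destruct (Rle_dec 1 z).
  - eapply Rle_trans; [|apply Rmax_l]. lra.
  - eapply Rle_trans; [|apply Rmax_r]. rewrite <- Rinv_1. apply Rinv_le_contravar; lra.
Qed.

Lemma rsize_of_ge1 z : 1 <= z -> rsize z = z.
Proof.
  intros Hz. apply Rmax_left. apply Rle_trans with 1; auto.
  rewrite <- Rinv_1. apply Rinv_le_contravar; lra.
Qed.

Lemma rsize_of_le1 z : 0 < z <= 1 -> rsize z = / z.
Proof.
  intros Hz. apply Rmax_right. apply Rle_trans with 1. lra.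
  rewrite <- Rinv_1. apply Rinv_le_contravar; lra.
Qed.

Lemma rsize_sum z : 0 < z -> z + / z = rsize z + / rsize z.
Proof.
  intros Hz. unfold rsize, Rmax. destruct Rle_dec; auto. rewrite Rinv_inv. ring.
Qed.

Definition rstep (alt : bool) (r : R) : R := 1 + (if alt then / r else r).

Lemma rsize_letter q z : 0 < z -> rsize (letter_act q z) = 1 + (if q then z else / z).
Proof.
  intros Hz. assert (Hi := Rinv_0_lt_compat z Hz). destruct q; simpl.
  - rewrite rsize_of_ge1; lra.
  - rewrite rsize_of_le1. field. lra.
    split. apply Rdiv_lt_0_compat; lra. apply Rle_div_l; lra.
Qed.

Lemma rsize_two_letters q p z : 0 < z ->
  rsize (letter_act q (letter_act p z)) = rstep (xorb q p) (rsize (letter_act p z)).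
Proof.
  intros Hz. rewrite (rsize_letter q), (rsize_letter p); auto using letter_act_pos.
  unfold rstep. destruct q, p; simpl; try field; lra.
Qed.

Lemma rsize_letter_cases q z : 0 < z -> exists d, rsize (letter_act q z) = rstep d (rsize z).
Proof.
  intros Hz. rewrite rsize_letter by auto. unfold rsize, Rmax, rstep.
  destruct q, (Rle_dec z (/ z)).
  - exists true. now rewrite Rinv_inv.
  - now exists false.
  - now exists false.
  - now exists true.
Qed.

Lemma rsum_ext a b n : (forall k, (k < n)%nat -> a k = b k) -> rsum a n = rsum b n.
Proof. induction n; simpl; intros H; auto. rewrite IHn by auto. rewrite H; auto. Qed.

Lemma rsum_le a b n : (forall k, (k < n)%nat -> a k <= b k) -> rsum a n <= rsum b n.
Proof.
  induction n; simpl; intros H. lra.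
  specialize (IHn ltac:(auto)). specialize (H n ltac:(auto)). lra.
Qed.

Lemma rsum_plus a b n : rsum (fun k => a k + b k) n = rsum a n + rsum b n.
Proof. induction n; simpl; lra. Qed.

Lemma rsum_scal c a n : rsum (fun k => c * a k) n = c * rsum a n.
Proof. induction n; simpl; [ring|rewrite IHn; ring]. Qed.

Lemma rsum_const c n : rsum (fun _ => c) n = INR n * c.
Proof. induction n. simpl; ring. cbn [rsum]. rewrite IHn, S_INR. ring. Qed.

Lemma rsum_shift a n : rsum (fun k => a (S k)) n = rsum a n + a n - a O.
Proof. induction n; simpl; [ring|rewrite IHn; ring]. Qed.

Lemma rsum_abs a n : Rabs (rsum a n) <= rsum (fun k => Rabs (a k)) n.
Proof.
  induction n; simpl. rewrite Rabs_R0; lra.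
  eapply Rle_trans. apply Rabs_triang. lra.
Qed.

Section Weights.
Variable f : C -> C.
Hypothesis f_holo : holoH f.
Hypothesis f_pos : forall t, PI / 3 <= t <= 2 * PI / 3 -> 0 <= Re (f (arc t)).

Definition integrable_kernel (k : R -> R) : Prop :=
  forall t, PI / 3 <= t <= 2 * PI / 3 -> continuous k t.

Lemma arc_weight_nonneg t : PI / 3 <= t <= 2 * PI / 3 -> 0 <= arc_weight f t.
Proof.
  intros Ht. destruct (arc_bounds t Ht). unfold arc_weight. apply Rmult_le_pos; auto. lra.
Qed.

Lemma arc_integral_le k1 k2 : integrable_kernel k1 -> integrable_kernel k2 ->
  (forall t, PI / 3 <= t <= 2 * PI / 3 -> k1 t <= k2 t) ->
  arc_integral f k1 <= arc_integral f k2.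
Proof.
  intros C1 C2 H. assert (P := PI_RGT_0). apply RInt_le. lra.
  now apply ex_arc_integral. now apply ex_arc_integral.
  intros t Ht. apply Rmult_le_compat_l. apply arc_weight_nonneg; lra. apply H; lra.
Qed.

Lemma arc_integral_scal a k : integrable_kernel k ->
  arc_integral f (fun t => a * k t) = a * arc_integral f k.
Proof.
  intros Hk. unfold arc_integral.
  eapply eq_trans; [|apply (RInt_scal (V := R_CompleteNormedModule) _ _ _ a (ex_arc_integral f f_holo k Hk))].
  apply RInt_ext. intros t _. unfold scal; simpl. unfold mult; simpl. ring.
Qed.

Lemma kernel_continuous c : 2 <= c ->
  integrable_kernel (fun t => c / (c * c - 4 * (cos t * cos t))).
Proof.
  intros Hc t Ht. apply continuous_of_ex_derive. auto_derive.
  destruct (arc_denominators c t Hc Ht) as (_ & _ & D). lra.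
Qed.

Lemma cos_sq_bounds t : PI / 3 <= t <= 2 * PI / 3 -> 0 <= 4 * (cos t * cos t) <= 1.
Proof. intros Ht. destruct (arc_bounds t Ht). nra. Qed.

Lemma tilt_continuous : integrable_kernel (fun t => tilt (4 * (cos t * cos t))).
Proof.
  intros t Ht. apply continuous_of_ex_derive. unfold tilt. auto_derive.
  pose proof (cos_sq_bounds t Ht). nra.
Qed.

Definition arc_mass : R := arc_integral f (fun _ => 1).
Definition tilt_mass : R := arc_integral f (fun t => tilt (4 * (cos t * cos t))).
Definition rvalue (r : R) : R := arc_value f (r + / r).
Definition golden_value : R := arc_value f (sqrt 5).

Lemma two_le_sum_inv r : 1 <= r -> 2 <= r + / r.
Proof.
  intros Hr. apply Rminus_le_0. replace (r + / r - 2) with ((r - 1) * (r - 1) * / r) by (field; lra).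
  apply Rmult_le_pos. nra. apply Rlt_le, Rinv_0_lt_compat; lra.
Qed.

Lemma arc_value_nonneg c : 2 <= c -> 0 <= arc_value f c.
Proof.
  intros Hc. replace 0 with (arc_integral f (fun _ => 0 * 0)).
  - apply arc_integral_le. intros t _. apply continuous_const. now apply kernel_continuous.
    intros t Ht. destruct (arc_denominators c t Hc Ht) as (_ & _ & D).
    rewrite Rmult_0_l. apply Rmult_le_pos. lra. now apply Rlt_le, Rinv_0_lt_compat.
  - rewrite arc_integral_scal. ring. intros t _. apply continuous_const.
Qed.

Lemma arc_mass_nonneg : 0 <= arc_mass.
Proof.
  replace 0 with (arc_integral f (fun _ => 0 * 0)).
  - apply arc_integral_le; try (intros t _; apply continuous_const). intros; lra.
  - rewrite arc_integral_scal. ring. intros t _. apply continuous_const.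
Qed.

Lemma arc_value_decay c : 2 <= c -> arc_value f c <= arc_mass / (c - 1).
Proof.
  intros Hc. unfold Rdiv. rewrite Rmult_comm. unfold arc_mass.
  rewrite <- arc_integral_scal by (intros t _; apply continuous_const).
  apply arc_integral_le. now apply kernel_continuous. intros t _; apply continuous_const.
  intros t Ht. destruct (arc_denominators c t Hc Ht) as (_ & _ & D).
  assert (B := cos_sq_bounds t Ht).
  rewrite Rmult_1_r. apply Rle_div_l; auto. apply Rmult_le_reg_l with (c - 1). lra.
  rewrite <- Rmult_assoc, Rinv_r by lra. nra.
Qed.

Lemma arc_value_lipschitz c c' : 2 <= c -> 2 <= c' ->
  arc_value f c - arc_value f c' <= arc_mass * Rabs (c - c').
Proof.
  intros Hc Hc'. apply Rle_minus_l. rewrite (Rmult_comm arc_mass). unfold arc_mass.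
  rewrite <- arc_integral_scal by (intros t _; apply continuous_const).
  eapply Rle_trans; [|apply Req_le; symmetry; apply arc_integral_sum; auto].
  - apply arc_integral_le. now apply kernel_continuous.
    intros t Ht. apply (continuous_plus (fun _ => _ * 1)). apply continuous_const. now apply kernel_continuous.
    intros t Ht. destruct (arc_denominators c t Hc Ht) as (_ & _ & D).
    destruct (arc_denominators c' t Hc' Ht) as (_ & _ & D').
    assert (B := cos_sq_bounds t Ht). set (m := 4 * (cos t * cos t)) in *.
    rewrite Rmult_1_r. apply Rle_minus_l.
    replace (c / (c * c - m) - c' / (c' * c' - m)) with
      ((c' - c) * ((c * c' + m) / ((c * c - m) * (c' * c' - m)))) by (field; lra).
    rewrite (Rabs_minus_sym c c').
    assert (K : 0 <= (c * c' + m) / ((c * c - m) * (c' * c' - m)) <= 1).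
    { assert (DD : 0 < (c * c - m) * (c' * c' - m)) by now apply Rmult_lt_0_compat.
      split. apply Rmult_le_pos. nra. now apply Rlt_le, Rinv_0_lt_compat.
      apply Rle_div_l; auto. rewrite Rmult_1_l.
      assert (3 / 4 * (c * c) <= c * c - m) by nra.
      assert (3 / 4 * (c' * c') <= c' * c' - m) by nra.
      apply Rle_trans with ((3 / 4 * (c * c)) * (3 / 4 * (c' * c'))).
      assert (4 <= c * c') by nra. nra.
      apply Rmult_le_compat; nra. }
    eapply Rle_trans. apply Rmult_le_compat_r. apply K. apply Rle_abs.
    pose proof (Rabs_pos (c' - c)). nra.
  - intros t _. apply continuous_const.
  - now apply kernel_continuous.
Qed.

Lemma phi_sum : phi + / phi = sqrt 5.
Proof.
  unfold phi. assert (S2 := sqrt5_sq). assert (B := sqrt5_bounds).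
  field_simplify_eq; [|lra]. nra.
Qed.

Lemma phi_bounds : 1.618 < phi < 1.619.
Proof. unfold phi. pose proof sqrt5_bounds. lra. Qed.

Lemma phi_sq : phi * phi = phi + 1.
Proof. unfold phi. pose proof sqrt5_sq. nra. Qed.

Lemma rvalue_golden : rvalue phi = golden_value.
Proof. unfold rvalue, golden_value. now rewrite phi_sum. Qed.

Lemma rvalue_nonneg r : 1 <= r -> 0 <= rvalue r.
Proof. intros. apply arc_value_nonneg. now apply two_le_sum_inv. Qed.

Lemma rvalue_le_mass r : 1 <= r -> rvalue r <= arc_mass.
Proof.
  intros Hr. assert (H := two_le_sum_inv r Hr). assert (M := arc_mass_nonneg).
  eapply Rle_trans. apply arc_value_decay; auto.
  apply Rle_div_l; nra.
Qed.

Lemma rvalue_decay r : 1 <= r -> rvalue (1 + r) <= arc_mass / r.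
Proof.
  intros Hr. assert (H := two_le_sum_inv (1 + r) ltac:(lra)). assert (M := arc_mass_nonneg).
  eapply Rle_trans. apply arc_value_decay; auto.
  apply Rmult_le_compat_l; auto. apply Rinv_le_contravar. lra.
  assert (0 < / (1 + r)) by (apply Rinv_0_lt_compat; lra). lra.
Qed.

Lemma rvalue_lipschitz r r' : 1 <= r -> 1 <= r' ->
  Rabs (rvalue r - rvalue r') <= arc_mass * Rabs (r - r').
Proof.
  intros Hr Hr'. assert (M := arc_mass_nonneg).
  assert (L : Rabs (r + / r - (r' + / r')) <= Rabs (r - r')).
  { replace (r + / r - (r' + / r')) with ((r - r') * (1 - / (r * r'))) by (field; lra).
    rewrite Rabs_mult. rewrite <- (Rmult_1_r (Rabs (r - r'))) at 2.
    apply Rmult_le_compat_l. apply Rabs_pos.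
    assert (0 < / (r * r') <= 1). { split. apply Rinv_0_lt_compat; nra.
      rewrite <- Rinv_1. apply Rinv_le_contravar; nra. }
    rewrite Rabs_pos_eq; lra. }
  assert (A := arc_value_lipschitz _ _ (two_le_sum_inv r Hr) (two_le_sum_inv r' Hr')).
  assert (B := arc_value_lipschitz _ _ (two_le_sum_inv r' Hr') (two_le_sum_inv r Hr)).
  rewrite Rabs_minus_sym in B. fold (rvalue r) (rvalue r') in *.
  assert (arc_mass * Rabs (r + / r - (r' + / r')) <= arc_mass * Rabs (r - r'))
    by now apply Rmult_le_compat_l.
  apply Rabs_le. lra.
Qed.

Lemma rvalue_potential d r : 1 <= r ->
  rvalue (rstep d r) + tilt_mass * (/ (r + 1) - / (rstep d r + 1)) <= golden_value.
Proof.
  intros Hr. set (v := rstep d r).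
  assert (Hv : 1 <= v).
  { unfold v, rstep. assert (0 < / r) by (apply Rinv_0_lt_compat; lra). destruct d; lra. }
  assert (H2 := two_le_sum_inv v Hv).
  assert (S5 : 2 <= sqrt 5) by (pose proof sqrt5_bounds; lra).
  unfold rvalue, tilt_mass. rewrite Rmult_comm.
  assert (CT : integrable_kernel (fun t => (/ (r + 1) - / (v + 1)) * tilt (4 * (cos t * cos t)))).
  { intros t Ht. apply (continuous_mult (fun _ => / (r + 1) - / (v + 1)) (fun t => tilt (4 * (cos t * cos t)))).
    apply continuous_const. now apply tilt_continuous. }
  rewrite <- arc_integral_scal by apply tilt_continuous.
  eapply Rle_trans. apply Req_le. apply arc_integral_sum; auto. now apply kernel_continuous.
  apply arc_integral_le.
  - intros t Ht. apply (continuous_plus (fun t => (v + / v) / ((v + / v) * (v + / v) - 4 * (cos t * cos t)))).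
    now apply kernel_continuous. now apply CT.
  - now apply kernel_continuous.
  - intros t Ht. assert (B := cos_sq_bounds t Ht). set (m := 4 * (cos t * cos t)) in *.
    rewrite sqrt5_sq.
    assert (D := arc_denominators _ t H2 Ht). destruct D as (_ & _ & D). fold m in D.
    replace ((v + / v) / ((v + / v) * (v + / v) - m)) with
      (v * (v ^ 2 + 1) / ((v ^ 2 + 1) ^ 2 - m * v ^ 2)).
    2:{ replace ((v + / v) * (v + / v) - m) with (((v ^ 2 + 1) ^ 2 - m * v ^ 2) / (v * v)) in D |- * by (field; lra).
        field. split; [lra|]. intros K. rewrite K in D. unfold Rdiv in D. lra. }
    unfold v, rstep in *. destruct d.
    + eapply Rle_trans; [|apply (kernel_alternation m (1 + / r) B Hv)].
      apply Req_le. f_equal. rewrite Rmult_comm. f_equal. f_equal. field. lra.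
    + eapply Rle_trans; [|apply (kernel_repetition m (1 + r) B); lra].
      apply Req_le. f_equal. rewrite Rmult_comm. f_equal. f_equal. f_equal. ring.
Qed.
End Weights.

(** * Bounds and asymptotics along a word *)

Lemma rsum_telescope a n : rsum (fun k => a (S k) - a k) n = a n - a O.
Proof. induction n; simpl; [ring|rewrite IHn; ring]. Qed.

Lemma rsum_head a n : rsum a (S n) = a O + rsum (fun k => a (S k)) n.
Proof. rewrite rsum_shift. simpl. ring. Qed.

Lemma rsum_nonneg a n : (forall k, (k < n)%nat -> 0 <= a k) -> 0 <= rsum a n.
Proof.
  induction n; simpl; intros H. lra.
  specialize (IHn ltac:(auto)). specialize (H n ltac:(auto)). lra.
Qed.

Definition b2R (b : bool) : R := if b then 1 else 0.

Lemma b2R_bounds b : 0 <= b2R b <= 1.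
Proof. destruct b; simpl; lra. Qed.

Definition alternates (l : nat -> bool) (k : nat) : bool := xorb (l k) (l (S k)).

Section Bounds.
Variable f : C -> C.
Hypothesis f_holo : holoH f.
Hypothesis f_inv : forall A z, SL2Z A -> upper_half z -> f (mobiusC A z) = f z.
Hypothesis f_real : forall t, PI / 3 <= t <= 2 * PI / 3 -> Im (f (arc t)) = 0.
Hypothesis f_pos : forall t, PI / 3 <= t <= 2 * PI / 3 -> 0 <= Re (f (arc t)).

Let M := arc_mass f.
Let g := golden_value f.
Let V := rvalue f.

Lemma rstep_ge1 d r : 1 <= r -> 1 <= rstep d r.
Proof.
  intros Hr. unfold rstep. assert (0 < / r) by (apply Rinv_0_lt_compat; lra). destruct d; lra.
Qed.

Lemma letter_potential q z : 0 < z ->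
  V (rsize (letter_act q z)) <=
  g + tilt_mass f * (/ (rsize (letter_act q z) + 1) - / (rsize z + 1)).
Proof.
  intros Hz. destruct (rsize_letter_cases q z Hz) as [d ->].
  pose proof (rvalue_potential f f_holo f_pos d (rsize z) (rsize_ge1 z Hz)).
  unfold V, g. lra.
Qed.

Lemma I_f_prefix_bounds l n z0 : upper_half z0 -> hyperbolic (prefix l n) ->
  0 <= Re (I_f f z0 (prefix l n)) <= INR n * (2 * g).
Proof.
  intros Hz0 Hyp.
  destruct (Re_I_f_prefix f f_holo f_inv f_real l n z0 Hz0 Hyp)
    as (u & v & Pu & Pv & Ru & Rv & Eu & Ev & ->).
  assert (Val : forall z, 0 < z -> arc_value f (z + / z) = V (rsize z)).
  { intros z Hz. unfold V, rvalue. now rewrite rsize_sum. }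
  rewrite (rsum_ext _ (fun k => V (rsize (u k)) + V (rsize (v k)))).
  2:{ intros k _. now rewrite !Val. }
  split.
  - apply rsum_nonneg. intros k _. apply Rplus_le_le_0_compat; apply rvalue_nonneg; auto using rsize_ge1.
  - rewrite rsum_plus.
    set (h := fun z => / (rsize z + 1)). set (T := tilt_mass f).
    assert (A : rsum (fun k => V (rsize (u k))) n <= INR n * g).
    { replace (rsum (fun k => V (rsize (u k))) n) with (rsum (fun k => V (rsize (u (S k)))) n)
        by (rewrite (rsum_shift (fun k => V (rsize (u k)))), Eu; ring).
      apply Rle_trans with (rsum (fun k => g + T * (h (u (S k)) - h (u k))) n).
      - apply rsum_le. intros k _. rewrite Ru. now apply letter_potential.
      - rewrite rsum_plus, rsum_const, rsum_scal, (rsum_telescope (fun k => h (u k))), Eu. lra. }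
    assert (B : rsum (fun k => V (rsize (v k))) n <= INR n * g).
    { apply Rle_trans with (rsum (fun k => g + (- T) * (h (v (S k)) - h (v k))) n).
      - apply rsum_le. intros k Hk. rewrite (Rv k Hk).
        pose proof (letter_potential (l k) (v (S k)) (Pv _)). unfold h, T. lra.
      - rewrite rsum_plus, rsum_const, rsum_scal, (rsum_telescope (fun k => h (v k))), Ev. lra. }
    lra.
Qed.

(* Measured in this potential, a run of equal alternation marks pays for its own error:
   under [alt = true] the distance to [phi] contracts, under [alt = false] the size grows by one. *)
Definition run_potential (D : R) (alt : bool) (r : R) : R :=
  if alt then - (M * phi * Rmin (Rabs (r - phi)) 1) else M * Rmin r (D + 1).

Definition target (alt : bool) : R := if alt then g else 0.

Lemma step_error D d r : 1 <= D -> 1 <= r ->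
  Rabs (V (rstep d r) - target d) <=
  M / D + (run_potential D d (rstep d r) - run_potential D d r).
Proof.
  intros HD Hr. assert (PM := arc_mass_nonneg f f_holo f_pos). fold M in PM.
  assert (PMD : 0 <= M / D) by (apply Rmult_le_pos; auto; apply Rlt_le, Rinv_0_lt_compat; lra).
  assert (Hr' := rstep_ge1 d r Hr). assert (Pb := phi_bounds). assert (Ps := phi_sq).
  destruct d; unfold target, run_potential.
  - unfold g. rewrite <- (rvalue_golden f). fold V.
    assert (L := rvalue_lipschitz f f_holo f_pos _ phi Hr' ltac:(lra)). fold V M in L.
    assert (Ir : 0 < / r <= 1).
    { split. apply Rinv_0_lt_compat; lra. rewrite <- Rinv_1. apply Rinv_le_contravar; lra. }
    set (r' := rstep true r) in *. set (e := Rabs (r - phi)). set (e' := Rabs (r' - phi)) in *.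
    assert (E : r' - phi = (phi - r) * (/ r * / phi)).
    { unfold r', rstep. apply Rmult_eq_reg_r with (r * phi); [|nra].
      replace ((phi - r) * (/ r * / phi) * (r * phi)) with (phi - r) by (field; lra).
      replace ((1 + / r - phi) * (r * phi)) with ((1 + r - phi * r) * phi) by (field; lra). nra. }
    assert (Ip : / phi = phi - 1).
    { apply Rmult_eq_reg_l with phi; [|lra]. rewrite Rinv_r by lra. lra. }
    assert (Ee : e' = e * (/ r * (phi - 1))).
    { unfold e', e. rewrite E, Rabs_mult, (Rabs_pos_eq (/ r * / phi)), Rabs_minus_sym, Ip; auto.
      rewrite Ip. nra. }
    assert (Pe : 0 <= e) by apply Rabs_pos. assert (Pe' : 0 <= e') by apply Rabs_pos.
    assert (K : e' <= (phi - 1) * Rmin e 1).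
    { unfold Rmin. destruct Rle_dec.
      - rewrite Ee. assert (/ r * (phi - 1) <= phi - 1) by nra. nra.
      - rewrite Rmult_1_r. assert (Hb : phi <= r \/ r < phi) by lra. destruct Hb as [Hb|Hb].
        + assert (e = r - phi) by (unfold e; apply Rabs_pos_eq; lra).
          rewrite Ee, H. assert ((r - phi) * / r <= 1). { apply Rle_div_l; lra. }
          replace ((r - phi) * (/ r * (phi - 1))) with ((r - phi) * / r * (phi - 1)) by ring. nra.
        + assert (e = phi - r) by (unfold e; rewrite Rabs_minus_sym; apply Rabs_pos_eq; lra). lra. }
    assert (K1 : Rmin e 1 <= 1) by apply Rmin_r.
    assert (K0 : 0 <= Rmin e 1) by (apply Rmin_glb; lra).
    rewrite (Rmin_left e' 1) by nra.
    assert (e' <= phi * (Rmin e 1 - e')) by nra.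
    assert (M * e' <= M * (phi * (Rmin e 1 - e'))) by now apply Rmult_le_compat_l. lra.
  - rewrite Rminus_0_r, Rabs_pos_eq by (apply rvalue_nonneg; auto).
    unfold rstep in *.
    destruct (Rle_dec D r) as [Hd|Hd].
    + apply Rle_trans with (M / D).
      * eapply Rle_trans. apply rvalue_decay; auto. apply Rmult_le_compat_l; auto.
        apply Rinv_le_contravar; lra.
      * assert (Rmin r (D + 1) <= Rmin (1 + r) (D + 1)) by (apply Rmin_glb;
          [pose proof (Rmin_l r (D + 1)); lra|apply Rmin_r]). nra.
    + rewrite !Rmin_left by lra.
      assert (V (1 + r) <= M) by (apply rvalue_le_mass; auto). nra.
Qed.

Lemma run_potential_bound D d r : 1 <= D -> 1 <= r ->
  Rabs (run_potential D d r) <= M * (D + 2).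
Proof.
  intros HD Hr. assert (PM := arc_mass_nonneg f f_holo f_pos). fold M in PM.
  assert (Pb := phi_bounds). unfold run_potential. destruct d.
  - assert (0 <= Rmin (Rabs (r - phi)) 1 <= 1).
    { split. apply Rmin_glb; [apply Rabs_pos|lra]. apply Rmin_r. }
    assert (0 <= phi * Rmin (Rabs (r - phi)) 1 <= D + 2) by nra.
    rewrite Rabs_Ropp, Rmult_assoc, Rabs_pos_eq by (apply Rmult_le_pos; lra).
    apply Rmult_le_compat_l; lra.
  - assert (0 <= Rmin r (D + 1) <= D + 1).
    { split. apply Rmin_glb; lra. apply Rmin_r. }
    rewrite Rabs_pos_eq by (apply Rmult_le_pos; lra). apply Rmult_le_compat_l; lra.
Qed.

Section Runs.
Variables (D : R) (d : nat -> bool) (r : nat -> R).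
Hypothesis HD : 1 <= D.
Let B := 2 * (M * (D + 2)).
Let changes n := rsum (fun k => b2R (alternates d k)) n.

Lemma run_potential_change n x : 1 <= x ->
  Rabs (run_potential D (d n) x - run_potential D (d (S n)) x) <= B * b2R (alternates d n).
Proof.
  intros Hx. assert (PM := arc_mass_nonneg f f_holo f_pos). fold M in PM.
  assert (H1 := run_potential_bound D (d n) x HD Hx).
  assert (H2 := run_potential_bound D (d (S n)) x HD Hx).
  unfold alternates. destruct (d n), (d (S n)); cbn [b2R xorb]; unfold B;
    try (rewrite Rminus_diag, Rabs_R0; lra);
    (eapply Rle_trans; [apply Rabs_triang|]; rewrite Rabs_Ropp; lra).
Qed.

Lemma forward_run_error n : (forall k, (k <= n)%nat -> 1 <= r k) ->
  (forall k, (k < n)%nat -> r (S k) = rstep (d k) (r k)) ->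
  rsum (fun k => Rabs (V (r (S k)) - target (d k))) n <= INR n * (M / D) + B + B * changes n.
Proof.
  intros Hr Rr.
  assert (K : rsum (fun k => Rabs (V (r (S k)) - target (d k))) n <= INR n * (M / D) +
    (run_potential D (d n) (r n) - run_potential D (d O) (r O)) + B * changes n).
  { induction n. unfold changes; cbn [rsum INR]; lra.
    specialize (IHn (fun k H => Hr k (le_S _ _ H)) (fun k H => Rr k (le_S _ _ H))).
    cbn [rsum]. rewrite S_INR. unfold changes in *. cbn [rsum].
    assert (E := step_error D (d n) (r n) HD (Hr n ltac:(lia))).
    rewrite <- (Rr n) in E by lia.
    assert (Q := run_potential_change n (r (S n)) (Hr (S n) ltac:(lia))).
    apply Rabs_le_between in Q. lra. }
  pose proof (run_potential_bound D (d n) (r n) HD (Hr n ltac:(lia))) as Q1.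
  pose proof (run_potential_bound D (d O) (r O) HD (Hr O ltac:(lia))) as Q2.
  apply Rabs_le_between in Q1, Q2. unfold B in *. lra.
Qed.

Lemma backward_run_error n : (forall k, (k <= n)%nat -> 1 <= r k) ->
  (forall k, (k < n)%nat -> r k = rstep (d k) (r (S k))) ->
  rsum (fun k => Rabs (V (r k) - target (d k))) n <= INR n * (M / D) + B + B * changes n.
Proof.
  intros Hr Rr.
  assert (K : rsum (fun k => Rabs (V (r k) - target (d k))) n <= INR n * (M / D) +
    (run_potential D (d O) (r O) - run_potential D (d n) (r n)) + B * changes n).
  { induction n. unfold changes; cbn [rsum INR]; lra.
    specialize (IHn (fun k H => Hr k (le_S _ _ H)) (fun k H => Rr k (le_S _ _ H))).
    cbn [rsum]. rewrite S_INR. unfold changes in *. cbn [rsum].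
    assert (E := step_error D (d n) (r (S n)) HD (Hr (S n) ltac:(lia))).
    rewrite <- (Rr n) in E by lia.
    assert (Q := run_potential_change n (r (S n)) (Hr (S n) ltac:(lia))).
    apply Rabs_le_between in Q. lra. }
  pose proof (run_potential_bound D (d n) (r n) HD (Hr n ltac:(lia))) as Q1.
  pose proof (run_potential_bound D (d O) (r O) HD (Hr O ltac:(lia))) as Q2.
  apply Rabs_le_between in Q1, Q2. unfold B in *. lra.
Qed.
End Runs.

Lemma I_f_prefix_estimate D l n z0 : 1 <= D -> upper_half z0 -> hyperbolic (prefix l (S n)) ->
  let d := alternates l in let B := 2 * (M * (D + 2)) in
  Rabs (Re (I_f f z0 (prefix l (S n))) - 2 * g * rsum (fun k => b2R (d k)) n) <=
  2 * (INR n * (M / D) + B + B * rsum (fun k => b2R (alternates d k)) n + M).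
Proof.
  intros HD Hz0 Hyp d B.
  destruct (Re_I_f_prefix f f_holo f_inv f_real l (S n) z0 Hz0 Hyp)
    as (u & v & Pu & Pv & Ru & Rv & Eu & Ev & ->).
  assert (Val : forall z, 0 < z -> arc_value f (z + / z) = V (rsize z)).
  { intros z Hz. unfold V, rvalue. now rewrite rsize_sum. }
  rewrite (rsum_ext _ (fun k => V (rsize (u k)) + V (rsize (v k)))).
  2:{ intros k _. now rewrite !Val. }
  rewrite rsum_plus.
  set (N := rsum (fun k => b2R (d k)) n).
  assert (TN : rsum (fun k => target (d k)) n = g * N).
  { unfold N. rewrite <- rsum_scal. apply rsum_ext. intros k _. destruct (d k); simpl; ring. }
  assert (VM : forall z, 0 < z -> 0 <= V (rsize z) <= M).
  { intros z Hz. assert (H := rsize_ge1 z Hz). split. now apply rvalue_nonneg. now apply rvalue_le_mass. }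
  assert (A : Rabs (rsum (fun k => V (rsize (u k))) (S n) - g * N) <=
    INR n * (M / D) + B + B * rsum (fun k => b2R (alternates d k)) n + M).
  { assert (E := forward_run_error D d (fun k => rsize (u (S k))) HD n
      (fun k _ => rsize_ge1 _ (Pu _))).
    specialize (E ltac:(intros k _; cbv beta; rewrite (Ru (S k)), (Ru k), rsize_two_letters by auto;
      unfold d, alternates; now rewrite xorb_comm)). cbv beta in E. fold B in E.
    replace (rsum (fun k => V (rsize (u k))) (S n)) with (rsum (fun k => V (rsize (u (S k)))) (S n))
        by (rewrite (rsum_shift (fun k => V (rsize (u k)))), Eu; ring).
    rewrite rsum_head, <- TN.
    assert (T := rsum_abs (fun k => V (rsize (u (S (S k)))) - target (d k)) n).
    rewrite (rsum_ext _ (fun k => V (rsize (u (S (S k)))) + -1 * target (d k))) in T at 1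
      by (intros; ring).
    rewrite rsum_plus, rsum_scal in T.
    specialize (VM (u 1%nat) (Pu _)).
    match goal with |- Rabs (?a + ?b - ?c) <= _ =>
      replace (a + b - c) with (a + (b + -1 * c)) by ring end.
    eapply Rle_trans. apply Rabs_triang. rewrite Rabs_pos_eq by lra. lra. }
  assert (A' : Rabs (rsum (fun k => V (rsize (v k))) (S n) - g * N) <=
    INR n * (M / D) + B + B * rsum (fun k => b2R (alternates d k)) n + M).
  { assert (E := backward_run_error D d (fun k => rsize (v k)) HD n
      (fun k _ => rsize_ge1 _ (Pv _))).
    specialize (E ltac:(intros k Hk; cbv beta; rewrite (Rv k), (Rv (S k)), rsize_two_letters by (auto; lia);
      reflexivity)). cbv beta in E. fold B in E.
    cbn [rsum]. rewrite <- TN.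
    assert (T := rsum_abs (fun k => V (rsize (v k)) - target (d k)) n).
    rewrite (rsum_ext _ (fun k => V (rsize (v k)) + -1 * target (d k))) in T at 1
      by (intros; ring).
    rewrite rsum_plus, rsum_scal in T.
    specialize (VM (v n) (Pv _)).
    match goal with |- Rabs (?b + ?a - ?c) <= _ =>
      replace (b + a - c) with (a + (b + -1 * c)) by ring end.
    eapply Rle_trans. apply Rabs_triang. rewrite Rabs_pos_eq by lra. lra. }
  match goal with |- Rabs (?a + ?b - 2 * g * N) <= _ =>
    replace (a + b - 2 * g * N) with ((a - g * N) + (b - g * N)) by ring end.
  eapply Rle_trans. apply Rabs_triang. lra.
Qed.

Lemma I_f_prefix_limit l z0 (theta : R) : upper_half z0 ->
  (exists n0, forall n, (n0 <= n)%nat -> hyperbolic (prefix l n)) ->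
  is_lim_seq (fun n => rsum (fun k => b2R (alternates l k)) n / INR (S n)) theta ->
  is_lim_seq (fun n => rsum (fun k => b2R (alternates (alternates l) k)) n / INR (S n)) 0 ->
  is_lim_seq (fun n => Re (I_f f z0 (prefix l n)) / INR n) (2 * g * theta).
Proof.
  intros Hz0 [n0 Hyp] LN LC. assert (PM := arc_mass_nonneg f f_holo f_pos). fold M in PM.
  set (N := fun n => rsum (fun k => b2R (alternates l k)) n) in *.
  set (Ch := fun n => rsum (fun k => b2R (alternates (alternates l) k)) n) in *.
  apply is_lim_seq_incr_1.
  apply is_lim_seq_ext with (fun n => 2 * g * (N n / INR (S n)) +
    (Re (I_f f z0 (prefix l (S n))) - 2 * g * N n) / INR (S n)).
  { intros n. field. apply not_0_INR. lia. }
  replace (Finite (2 * g * theta)) with (Finite (2 * g * theta + 0)) by (f_equal; ring).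
  apply is_lim_seq_plus'. apply (is_lim_seq_scal_l _ _ theta LN).
  apply is_lim_seq_spec. intros eps.
  set (D := 1 + 4 * M / eps).
  assert (Pe := cond_pos eps).
  assert (HD : 1 <= D). { unfold D. assert (0 <= 4 * M / eps). apply Rmult_le_pos. lra.
    now apply Rlt_le, Rinv_0_lt_compat. lra. }
  set (B := 2 * (M * (D + 2))).
  assert (MD : 2 * (M / D) < eps / 2).
  { apply Rmult_lt_reg_r with D. lra. replace (2 * (M / D) * D) with (2 * M) by (field; lra).
    unfold D. replace (eps / 2 * (1 + 4 * M / eps)) with (eps / 2 + 2 * M) by (field; lra). lra. }
  assert (L : is_lim_seq (fun n => (2 * B + 2 * M) * / INR (S n) + 2 * B * (Ch n / INR (S n))) 0).
  { replace (Finite 0) with (Finite ((2 * B + 2 * M) * 0 + 2 * B * 0)) by (f_equal; ring).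
    apply is_lim_seq_plus'; apply is_lim_seq_scal_l with (lu := Finite 0); auto.
    apply (is_lim_seq_incr_1 (fun n => / INR n)).
    replace (Finite 0) with (Rbar_inv p_infty) by reflexivity.
    apply is_lim_seq_inv. apply is_lim_seq_INR. discriminate. }
  apply is_lim_seq_spec in L. destruct (L (mkposreal (eps / 2) ltac:(lra))) as [n1 Hn1].
  exists (Nat.max n0 n1). intros n Hn. rewrite Rminus_0_r.
  specialize (Hn1 n ltac:(lia)). simpl in Hn1. rewrite Rminus_0_r in Hn1.
  assert (E := I_f_prefix_estimate D l n z0 HD Hz0 (Hyp (S n) ltac:(lia))). cbv zeta in E.
  fold B in E. fold (N n) (Ch n) in E.
  assert (Pn : 0 < INR (S n)) by (apply lt_0_INR; lia).
  unfold Rdiv at 1. rewrite Rabs_mult, (Rabs_pos_eq (/ INR (S n))) by (now apply Rlt_le, Rinv_0_lt_compat).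
  eapply Rle_lt_trans. apply Rmult_le_compat_r. now apply Rlt_le, Rinv_0_lt_compat. apply E.
  apply Rabs_def2 in Hn1. destruct Hn1 as [Hn1 _].
  change (match n with O => 1 | S _ => INR n + 1 end) with (INR (S n)) in Hn1.
  assert (Q : INR n * (2 * (M / D)) * / INR (S n) <= 2 * (M / D)).
  { apply Rle_div_l; auto. assert (0 <= M / D). apply Rmult_le_pos; auto.
    apply Rlt_le, Rinv_0_lt_compat; lra. rewrite S_INR. nra. }
  unfold Rdiv in *. lra.
Qed.
End Bounds.

(** * Farey paths *)

Lemma mat2_ext A B : ma A = ma B -> mb A = mb B -> mc A = mc B -> md A = md B -> A = B.
Proof. destruct A, B; simpl; congruence. Qed.

Lemma minv_mmul A B : SL2Z A -> mmul (minv A) (mmul A B) = B.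
Proof.
  unfold SL2Z. intros H. destruct A as [a b c d], B as [a' b' c' d']. simpl in H.
  apply mat2_ext; simpl.
  - replace a' with ((a * d - b * c) * a')%Z at 3 by (rewrite H; ring). ring.
  - replace b' with ((a * d - b * c) * b')%Z at 3 by (rewrite H; ring). ring.
  - replace c' with ((a * d - b * c) * c')%Z at 3 by (rewrite H; ring). ring.
  - replace d' with ((a * d - b * c) * d')%Z at 3 by (rewrite H; ring). ring.
Qed.

Lemma mmul_minv A B : SL2Z A -> mmul A (mmul (minv A) B) = B.
Proof.
  unfold SL2Z. intros H. destruct A as [a b c d], B as [a' b' c' d']. simpl in H.
  apply mat2_ext; simpl.
  - replace a' with ((a * d - b * c) * a')%Z at 3 by (rewrite H; ring). ring.
  - replace b' with ((a * d - b * c) * b')%Z at 3 by (rewrite H; ring). ring.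
  - replace c' with ((a * d - b * c) * c')%Z at 3 by (rewrite H; ring). ring.
  - replace d' with ((a * d - b * c) * d')%Z at 3 by (rewrite H; ring). ring.
Qed.

Lemma letter_prefix l n : letter (prefix l) n = mat_of_letter (l n).
Proof. unfold letter. simpl. apply minv_mmul, prefix_SL2Z. Qed.

Lemma path_is_prefix A : (forall n, SL2Znonneg (A n)) -> A O = mI ->
  (forall n, letter A n = mT \/ letter A n = mV) ->
  exists l, (forall n, A n = prefix l n) /\ forall n, letter A n = mat_of_letter (l n).
Proof.
  intros H0 H1 H2. set (l := fun n => (mb (letter A n) =? 1)%Z).
  assert (HL : forall n, letter A n = mat_of_letter (l n)).
  { intros n. unfold l. destruct (H2 n) as [-> | ->]; reflexivity. }
  exists l. split; auto. induction n; auto.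
  simpl. rewrite <- IHn, <- HL. unfold letter. symmetry. apply mmul_minv. apply H0.
Qed.

Lemma prefix_relative l n k : let A := prefix l n in let B := prefix l (n + k) in
  (0 <= md A * ma B - mb A * mc B /\ 0 <= md A * mb B - mb A * md B /\
   0 <= ma A * mc B - mc A * ma B /\ 0 <= ma A * md B - mc A * mb B)%Z.
Proof.
  cbv zeta. induction k.
  - rewrite Nat.add_0_r. assert (H := prefix_SL2Z l n). unfold SL2Z in H. lia.
  - rewrite Nat.add_succ_r. destruct (l (n + k)%nat) eqn:E.
    + rewrite (prefix_S_T l _ E). simpl. lia.
    + rewrite (prefix_S_V l _ E). simpl. lia.
Qed.

Lemma prefix_mobius_1 l n : let A := prefix l n in
  mobiusR A 1 = (IZR (ma A) + IZR (mb A)) / (IZR (mc A) + IZR (md A)).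
Proof. unfold mobiusR. now rewrite !Rmult_1_r. Qed.

(* x = A (rem_num A x / rem_den A x); the Farey path of x is the subtractive Euclidean
   algorithm on this pair, started at (x, 1). *)
Definition rem_num (A : mat2) (x : R) : R := IZR (md A) * x - IZR (mb A).
Definition rem_den (A : mat2) (x : R) : R := IZR (ma A) - IZR (mc A) * x.

Lemma rem_T l n x : l n = true ->
  rem_num (prefix l (S n)) x = rem_num (prefix l n) x - rem_den (prefix l n) x /\
  rem_den (prefix l (S n)) x = rem_den (prefix l n) x.
Proof.
  intros H. rewrite prefix_S_T by auto. unfold rem_num, rem_den; simpl. rewrite !plus_IZR. split; ring.
Qed.

Lemma rem_V l n x : l n = false ->
  rem_num (prefix l (S n)) x = rem_num (prefix l n) x /\
  rem_den (prefix l (S n)) x = rem_den (prefix l n) x - rem_num (prefix l n) x.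
Proof.
  intros H. rewrite prefix_S_V by auto. unfold rem_num, rem_den; simpl. rewrite !plus_IZR. split; ring.
Qed.

Lemma rem_identity l n x :
  IZR (mc (prefix l n)) * rem_num (prefix l n) x + IZR (md (prefix l n)) * rem_den (prefix l n) x = 1.
Proof.
  assert (H := prefix_SL2Z l n). unfold SL2Z in H. apply (f_equal IZR) in H.
  rewrite minus_IZR, !mult_IZR in H. unfold rem_num, rem_den. lra.
Qed.

Section Limit.
Variables (l : nat -> bool) (x : R).
Hypothesis conv : is_lim_seq (fun n => mobiusR (prefix l n) 1) x.

Lemma rem_nonneg n : 0 <= rem_num (prefix l n) x /\ 0 <= rem_den (prefix l n) x.
Proof.
  assert (Cn : is_lim_seq (fun k => mobiusR (prefix l (n + k)) 1) x).
  { apply (is_lim_seq_ext (fun k => mobiusR (prefix l (k + n)) 1)).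
    intros k. now rewrite Nat.add_comm. now apply (is_lim_seq_incr_n (fun n => mobiusR (prefix l n) 1)). }
  assert (K : forall k, 0 <= rem_num (prefix l n) (mobiusR (prefix l (n + k)) 1) /\
     0 <= rem_den (prefix l n) (mobiusR (prefix l (n + k)) 1)).
  { intros k. rewrite prefix_mobius_1. destruct (prefix_relative l n k) as (H1 & H2 & H3 & H4).
    destruct (prefix_bounds l (n + k)) as (B1 & B2 & B3 & B4).
    unfold rem_num, rem_den. set (A := prefix l n) in *. set (B := prefix l (n + k)) in *.
    apply IZR_le in H1, H2, H3, H4, B3, B4.
    rewrite minus_IZR, !mult_IZR in H1, H2, H3, H4.
    set (q := IZR (mc B) + IZR (md B)). assert (Pq : 0 < q) by (unfold q; lra).
    split; apply Rmult_le_reg_r with q; auto; rewrite Rmult_0_l.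
    - replace ((IZR (md A) * ((IZR (ma B) + IZR (mb B)) / q) - IZR (mb A)) * q)
       with (IZR (md A) * (IZR (ma B) + IZR (mb B)) - IZR (mb A) * q) by (field; lra). unfold q. lra.
    - replace ((IZR (ma A) - IZR (mc A) * ((IZR (ma B) + IZR (mb B)) / q)) * q)
       with (IZR (ma A) * q - IZR (mc A) * (IZR (ma B) + IZR (mb B))) by (field; lra). unfold q. lra. }
  unfold rem_num, rem_den in *. split.
  - assert (L := is_lim_seq_le (fun _ => 0) _ 0 _ (fun k => proj1 (K k)) (is_lim_seq_const 0)
      (is_lim_seq_minus' _ _ _ _ (is_lim_seq_scal_l _ (IZR (md (prefix l n))) x Cn) (is_lim_seq_const _))).
    exact L.
  - assert (L := is_lim_seq_le (fun _ => 0) _ 0 _ (fun k => proj2 (K k)) (is_lim_seq_const 0)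
      (is_lim_seq_minus' _ _ _ _ (is_lim_seq_const _) (is_lim_seq_scal_l _ (IZR (mc (prefix l n))) x Cn))).
    exact L.
Qed.

Hypothesis V_infinite : forall N, exists n, (N <= n)%nat /\ l n = false.

Lemma rem_den_pos n : 0 < rem_den (prefix l n) x.
Proof.
  destruct (rem_nonneg n) as [Hp [Hd|Hd]]; auto. exfalso. symmetry in Hd.
  assert (Pp : 0 < rem_num (prefix l n) x).
  { assert (E := rem_identity l n x). destruct Hp as [|Hp]; auto. rewrite Hd, <- Hp in E. lra. }
  destruct (V_infinite n) as [m [Hm Lm]].
  assert (K : forall k, rem_den (prefix l (n + k)) x = 0 /\ 0 < rem_num (prefix l (n + k)) x).
  { induction k. now rewrite Nat.add_0_r. rewrite Nat.add_succ_r.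
    destruct IHk as [I1 I2]. destruct (l (n + k)%nat) eqn:E.
    - destruct (rem_T l _ x E) as [-> ->]. split; lra.
    - destruct (rem_V l _ x E) as [R1 R2]. destruct (rem_nonneg (S (n + k))). exfalso. lra. }
  specialize (K (m - n)%nat). replace (n + (m - n))%nat with m in K by lia.
  destruct (rem_V l m x Lm) as [R1 R2]. destruct (rem_nonneg (S m)). lra.
Qed.

Lemma letter_from_remainders n :
  l n = true <-> rem_den (prefix l n) x <= rem_num (prefix l n) x.
Proof.
  destruct (l n) eqn:E.
  - destruct (rem_T l n x E) as [R1 R2]. destruct (rem_nonneg (S n)). split; auto. intros _. lra.
  - destruct (rem_V l n x E) as [R1 R2]. pose proof (rem_den_pos (S n)). split; [discriminate|lra].
Qed.
End Limit.

Lemma prefix_ext l l' n : (forall k, (k < n)%nat -> l k = l' k) -> prefix l n = prefix l' n.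
Proof. induction n; simpl; intros H; auto. now rewrite IHn, H by auto. Qed.

Lemma prefix_limit_unique l l' (x : R) :
  is_lim_seq (fun n => mobiusR (prefix l n) 1) x -> is_lim_seq (fun n => mobiusR (prefix l' n) 1) x ->
  (forall N, exists n, (N <= n)%nat /\ l n = false) ->
  (forall N, exists n, (N <= n)%nat /\ l' n = false) ->
  forall n, l n = l' n.
Proof.
  intros C1 C2 I1 I2. apply (well_founded_induction lt_wf). intros n IH.
  assert (A := letter_from_remainders l x C1 I1 n). assert (B := letter_from_remainders l' x C2 I2 n).
  rewrite (prefix_ext l l' n IH) in A. destruct (l n), (l' n); auto.
  - symmetry. tauto.
  - tauto.
Qed.

Lemma prefix_den_growth l n0 : l n0 = false -> forall k,
  (1 <= mc (prefix l (S n0 + k)) /\ Z.of_nat k + 2 <= mc (prefix l (S n0 + k)) + md (prefix l (S n0 + k)))%Z.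
Proof.
  intros H k. induction k.
  - rewrite Nat.add_0_r, (prefix_S_V l n0 H). destruct (prefix_bounds l n0) as (_ & _ & B3 & B4).
    simpl. lia.
  - rewrite Nat.add_succ_r. destruct (prefix_bounds l (S n0 + k)) as (_ & _ & B3 & B4).
    destruct (l (S n0 + k)%nat) eqn:E.
    + rewrite (prefix_S_T l _ E). simpl in *. lia.
    + rewrite (prefix_S_V l _ E). simpl in *. lia.
Qed.

Lemma prefix_inv_den_lim l n0 : l n0 = false ->
  is_lim_seq (fun n => / (IZR (mc (prefix l n)) + IZR (md (prefix l n)))) 0.
Proof.
  intros H. apply (is_lim_seq_incr_n _ (S n0)).
  apply is_lim_seq_le_le with (fun _ => 0) (fun n => / INR (S n)).
  - intros n. replace (n + S n0)%nat with (S n0 + n)%nat by lia.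
    destruct (prefix_den_growth l n0 H n) as [_ G]. apply IZR_le in G.
    rewrite !plus_IZR, <- INR_IZR_INZ in G.
    assert (P : 0 < INR (S n)) by (apply lt_0_INR; lia). rewrite S_INR in *.
    split. apply Rlt_le, Rinv_0_lt_compat; lra. apply Rinv_le_contravar; lra.
  - apply is_lim_seq_const.
  - apply (is_lim_seq_incr_1 (fun n => / INR n)).
    replace (Finite 0) with (Rbar_inv p_infty) by reflexivity.
    apply is_lim_seq_inv. apply is_lim_seq_INR. discriminate.
Qed.

Lemma prefix_limit_exists l n0 n1 : l n0 = false -> l n1 = true ->
  exists x, 0 < x /\ is_lim_seq (fun n => mobiusR (prefix l n) 1) x.
Proof.
  intros H0 H1. set (e := fun n => IZR (mb (prefix l n)) / IZR (md (prefix l n))).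
  assert (Bd : forall n, 1 <= IZR (md (prefix l n))).
  { intros n. destruct (prefix_bounds l n) as (_ & _ & _ & B). now apply IZR_le in B. }
  assert (Bc : forall n, 0 <= IZR (mc (prefix l n))).
  { intros n. destruct (prefix_bounds l n) as (_ & _ & B & _). now apply IZR_le in B. }
  assert (Mono : forall n k, e n <= e (n + k)%nat).
  { intros n k. destruct (prefix_relative l n k) as (_ & H & _). apply IZR_le in H.
    rewrite minus_IZR, !mult_IZR in H. unfold e.
    pose proof (Bd n). pose proof (Bd (n + k)%nat).
    apply Rle_div_l. lra. apply Rmult_le_reg_r with (IZR (md (prefix l (n + k)))). lra.
    unfold Rdiv. rewrite !Rmult_assoc, (Rmult_comm (/ _)), !Rmult_assoc, Rinv_r by lra. lra. }
  set (N := S n0).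
  assert (CN : 1 <= IZR (mc (prefix l N))).
  { destruct (prefix_den_growth l n0 H0 0) as [G _]. rewrite Nat.add_0_r in G. now apply IZR_le in G. }
  assert (Up : forall n, e n <= IZR (ma (prefix l N)) / IZR (mc (prefix l N))).
  { intros n. apply Rle_trans with (e (n + N)%nat). apply Mono. rewrite Nat.add_comm.
    destruct (prefix_relative l N n) as (_ & _ & _ & H). apply IZR_le in H.
    rewrite minus_IZR, !mult_IZR in H. unfold e. pose proof (Bd (N + n)%nat).
    apply Rle_div_l. lra. apply Rmult_le_reg_r with (IZR (mc (prefix l N))). lra.
    unfold Rdiv. rewrite !Rmult_assoc, (Rmult_comm (/ _)), !Rmult_assoc, Rinv_r by lra. lra. }
  destruct (ex_finite_lim_seq_incr e _ (fun n => eq_rect _ (fun m => e n <= e m) (Mono n 1%nat) _ (Nat.add_1_r n)) Up)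
    as [x Hx].
  exists x. split.
  - assert (P1 : 0 < e (S n1)).
    { unfold e. destruct (prefix_bounds l n1) as (Ba & Bb & _ & Bd1).
      rewrite (prefix_S_T l n1 H1). simpl.
      apply Rdiv_lt_0_compat; apply IZR_lt; destruct (prefix_bounds l n1); lia. }
    apply Rlt_le_trans with (1 := P1).
    assert (Hs := proj1 (is_lim_seq_incr_n e (S n1) x) Hx).
    assert (L := is_lim_seq_le (fun _ => e (S n1)) _ (e (S n1)) x
      (fun k => eq_rect _ (fun m => e (S n1) <= e m) (Mono (S n1) k) _ (Nat.add_comm (S n1) k))
      (is_lim_seq_const _) Hs). exact L.
  - apply is_lim_seq_ext with (fun n => e n + (mobiusR (prefix l n) 1 - e n)). intros; ring.
    replace (Finite x) with (Finite (x + 0)) by (f_equal; ring). apply is_lim_seq_plus'; auto.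
    apply is_lim_seq_le_le with (3 := prefix_inv_den_lim l n0 H0) (u := fun _ => 0).
    2: apply is_lim_seq_const.
    intros n. rewrite prefix_mobius_1. unfold e. assert (D := prefix_SL2Z l n). unfold SL2Z in D.
    apply (f_equal IZR) in D. rewrite minus_IZR, !mult_IZR in D.
    specialize (Bd n). specialize (Bc n).
    set (a := IZR (ma (prefix l n))) in *. set (b := IZR (mb (prefix l n))) in *.
    set (c := IZR (mc (prefix l n))) in *. set (d := IZR (md (prefix l n))) in *.
    replace ((a + b) / (c + d) - b / d) with ((a * d - b * c) / (d * (c + d))) by (field; lra).
    rewrite D. unfold Rdiv. rewrite Rmult_1_l. split. apply Rlt_le, Rinv_0_lt_compat; nra.
    apply Rinv_le_contravar; nra.
Qed.

Definition euclid_letter (x : R) (A : mat2) : bool :=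
  if Rle_dec (rem_den A x) (rem_num A x) then true else false.

Fixpoint euclid_path (x : R) (n : nat) : mat2 :=
  match n with
  | O => mI
  | S n => mmul (euclid_path x n) (mat_of_letter (euclid_letter x (euclid_path x n)))
  end.

Definition euclid_word (x : R) (n : nat) : bool := euclid_letter x (euclid_path x n).

Lemma euclid_path_prefix x n : euclid_path x n = prefix (euclid_word x) n.
Proof. induction n; simpl; auto. unfold euclid_word at 2. now rewrite IHn. Qed.

Lemma euclid_word_true x n : euclid_word x n = true <->
  rem_den (prefix (euclid_word x) n) x <= rem_num (prefix (euclid_word x) n) x.
Proof.
  rewrite <- euclid_path_prefix. unfold euclid_word, euclid_letter.
  destruct Rle_dec; split; auto; discriminate || contradiction.
Qed.

Section Euclid.
Variable x : R.
Hypothesis x_pos : 0 < x.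
Let l := euclid_word x.
Let P n := rem_num (prefix l n) x.
Let Rm n := rem_den (prefix l n) x.

Lemma euclid_rem n : 0 <= P n <= x /\ 0 < Rm n <= 1.
Proof.
  induction n.
  - unfold P, Rm, rem_num, rem_den; simpl. lra.
  - destruct (l n) eqn:E.
    + destruct (rem_T l n x E) as [R1 R2]. fold (P (S n)) (P n) (Rm n) (Rm (S n)) in *.
      apply euclid_word_true in E. fold l (P n) (Rm n) in E. lra.
    + destruct (rem_V l n x E) as [R1 R2]. fold (P (S n)) (P n) (Rm n) (Rm (S n)) in *.
      assert (~ Rm n <= P n). { intros K. apply (euclid_word_true x n) in K. fold l in K. congruence. }
      lra.
Qed.

Lemma euclid_V_infinite N : exists n, (N <= n)%nat /\ l n = false.
Proof.
  apply NNPP. intros H.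
  assert (A : forall n, (N <= n)%nat -> l n = true).
  { intros n Hn. destruct (l n) eqn:E; auto. exfalso. apply H. now exists n. }
  assert (K : forall k, P (N + k)%nat = P N - INR k * Rm N /\ Rm (N + k)%nat = Rm N).
  { induction k. rewrite Nat.add_0_r. simpl. split; [ring|auto].
    rewrite Nat.add_succ_r, S_INR. destruct (rem_T l _ x (A (N + k)%nat ltac:(lia))) as [R1 R2].
    unfold P, Rm in *. rewrite R1, R2. destruct IHk as [-> ->]. split; ring. }
  destruct (euclid_rem N) as [_ PR].
  destruct (INR_archimed (Rm N) (P N)) as [k Hk]. lra.
  destruct (K k) as [K1 _]. destruct (euclid_rem (N + k)) as [Q _]. lra.
Qed.

Lemma euclid_T_infinite : ~ rational x -> forall N, exists n, (N <= n)%nat /\ l n = true.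
Proof.
  intros Irr N. apply NNPP. intros H. apply Irr.
  assert (A : forall n, (N <= n)%nat -> l n = false).
  { intros n Hn. destruct (l n) eqn:E; auto. exfalso. apply H. now exists n. }
  assert (K : forall k, Rm (N + k)%nat = Rm N - INR k * P N /\ P (N + k)%nat = P N).
  { induction k. rewrite Nat.add_0_r. simpl. split; [ring|auto].
    rewrite Nat.add_succ_r, S_INR. destruct (rem_V l _ x (A (N + k)%nat ltac:(lia))) as [R1 R2].
    unfold P, Rm in *. rewrite R1, R2. destruct IHk as [-> ->]. split; ring. }
  assert (P0 : P N = 0).
  { destruct (euclid_rem N) as [[[Q|Q] _] _]; auto. exfalso.
    destruct (INR_archimed (P N) (Rm N) Q) as [k Hk].
    destruct (K k) as [K1 _]. destruct (euclid_rem (N + k)) as [_ K2]. lra. }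
  unfold P, rem_num in P0. destruct (prefix_bounds l N) as (_ & _ & _ & Bd).
  exists (mb (prefix l N) # Z.to_pos (md (prefix l N)))%Q. unfold Q2R; simpl.
  rewrite Z2Pos.id by lia. apply IZR_le in Bd.
  apply Rmult_eq_reg_l with (IZR (md (prefix l N))); [|lra].
  rewrite <- Rmult_assoc, (Rmult_comm _ (IZR (mb _))), Rmult_assoc, Rinv_r by lra. lra.
Qed.

Lemma euclid_rational : rational x -> exists N, forall n, (N <= n)%nat -> l n = false.
Proof.
  intros [r Hr]. set (p := Qnum r). set (q := Zpos (Qden r)).
  assert (Pq : 1 <= IZR q) by (apply IZR_le; unfold q; lia).
  assert (Ex : IZR q * x = IZR p).
  { rewrite <- Hr. unfold Q2R, p, q. field. unfold q in Pq. lra. }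
  set (z := fun n => ((md (prefix l n) * p - mb (prefix l n) * q) + (ma (prefix l n) * q - mc (prefix l n) * p))%Z).
  set (zr := fun n => (ma (prefix l n) * q - mc (prefix l n) * p)%Z).
  assert (Zr : forall n, IZR (zr n) = IZR q * Rm n).
  { intros n. unfold zr, Rm, rem_den. rewrite minus_IZR, !mult_IZR, <- Ex. ring. }
  assert (Zz : forall n, IZR (z n) = IZR q * (P n + Rm n)).
  { intros n. unfold z, P, Rm, rem_num, rem_den. rewrite plus_IZR, !minus_IZR, !mult_IZR, <- Ex. ring. }
  assert (Step : forall n, (z (S n) <= z n)%Z /\ (l n = true -> z (S n) <= z n - 1)%Z).
  { intros n. destruct (euclid_rem n) as [Q1 Q2]. destruct (l n) eqn:E.
    - destruct (rem_T l n x E) as [R1 R2]. fold (P (S n)) (P n) (Rm n) (Rm (S n)) in *.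
      assert (Z1 : (1 <= zr n)%Z). { assert (0 < zr n)%Z; [|lia]. apply lt_IZR. rewrite Zr. nra. }
      assert (Z2 : z (S n) = (z n - zr n)%Z).
      { apply eq_IZR. rewrite minus_IZR, !Zz, Zr, R1, R2. ring. }
      lia.
    - split; [|discriminate]. destruct (rem_V l n x E) as [R1 R2].
      fold (P (S n)) (P n) (Rm n) (Rm (S n)) in *. apply le_IZR. rewrite !Zz, R1, R2. nra. }
  assert (Mono : forall n k, (z (n + k)%nat <= z n)%Z).
  { intros n k. induction k. rewrite Nat.add_0_r; lia. rewrite Nat.add_succ_r.
    destruct (Step (n + k)%nat). lia. }
  assert (Pos : forall n, (0 <= z n)%Z).
  { intros n. apply le_IZR. rewrite Zz. destruct (euclid_rem n). nra. }
  assert (Main : forall k n, (z n <= Z.of_nat k)%Z -> exists N, forall m, (N <= m)%nat -> l m = false).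
  { induction k; intros n Hk; destruct (classic (exists m, (n <= m)%nat /\ l m = true)) as [[m [Hm Lm]]|No].
    2,4: exists n; intros m Hm; destruct (l m) eqn:E; auto; exfalso; apply No; now exists m.
    - specialize (Mono n (m - n)%nat). replace (n + (m - n))%nat with m in Mono by lia.
      destruct (Step m) as [_ St]. specialize (St Lm). specialize (Pos (S m)). lia.
    - apply (IHk (S m)). specialize (Mono n (m - n)%nat). replace (n + (m - n))%nat with m in Mono by lia.
      destruct (Step m) as [_ St]. specialize (St Lm). lia. }
  apply (Main (Z.to_nat (z O)) O). specialize (Pos O). lia.
Qed.

Lemma euclid_converges : is_lim_seq (fun n => mobiusR (prefix l n) 1) x.
Proof.
  destruct (euclid_V_infinite 0) as [n0 [_ H0]].
  assert (L := prefix_inv_den_lim l n0 H0).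
  apply is_lim_seq_ext with (fun n => x + (mobiusR (prefix l n) 1 - x)). intros; ring.
  replace (Finite x) with (Finite (x + 0)) by (f_equal; ring).
  apply is_lim_seq_plus'. apply is_lim_seq_const.
  assert (L' := is_lim_seq_scal_l _ (x + 1) _ L). simpl in L'. rewrite Rmult_0_r in L'.
  apply is_lim_seq_abs_0.
  apply is_lim_seq_le_le with (3 := L') (u := fun _ => 0). 2: apply is_lim_seq_const.
  intros n. split. apply Rabs_pos. rewrite prefix_mobius_1.
  destruct (euclid_rem n) as [Q1 Q2]. unfold P, Rm, rem_num, rem_den in Q1, Q2.
  destruct (prefix_bounds l n) as (_ & _ & Bc & Bd). apply IZR_le in Bc, Bd.
  set (a := IZR (ma _)) in *. set (b := IZR (mb _)) in *.
  set (c := IZR (mc _)) in *. set (d := IZR (md _)) in *.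
  replace ((a + b) / (c + d) - x) with (((a - c * x) - (d * x - b)) * / (c + d)) by (field; lra).
  assert (0 < / (c + d)) by (apply Rinv_0_lt_compat; lra).
  rewrite Rabs_mult, (Rabs_pos_eq (/ _)) by lra. apply Rmult_le_compat_r. lra.
  apply Rabs_le. lra.
Qed.

Lemma euclid_is_farey_path : is_farey_path x (prefix l).
Proof.
  split; [|split; [|split; [|split; [|split]]]].
  - intros n. destruct (prefix_bounds l n). split. apply prefix_SL2Z. lia.
  - reflexivity.
  - intros n. rewrite letter_prefix. destruct (l n); auto.
  - apply euclid_converges.
  - intros Irr. split; intros N.
    + destruct (euclid_T_infinite Irr N) as [n [Hn E]]. exists n. split; auto. rewrite letter_prefix, E. auto.
    + destruct (euclid_V_infinite N) as [n [Hn E]]. exists n. split; auto. rewrite letter_prefix, E. auto.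
  - intros Rat. destruct (euclid_rational Rat) as [N HN]. exists N. intros n Hn.
    rewrite letter_prefix, (HN n Hn). auto.
Qed.

Lemma farey_path_prefix : exists l', (forall n, farey_path x n = prefix l' n) /\
  is_lim_seq (fun n => mobiusR (prefix l' n) 1) x /\
  (forall N, exists n, (N <= n)%nat /\ l' n = false).
Proof.
  assert (S := epsilon_spec (inhabits (fun _ => mI)) (is_farey_path x)
    (ex_intro _ _ euclid_is_farey_path)).
  fold (farey_path x) in S. destruct S as (S1 & S2 & S3 & S4 & S5 & S6).
  destruct (path_is_prefix _ S1 S2 S3) as (l' & E1 & E2). exists l'. split; auto. split.
  - apply is_lim_seq_ext with (2 := S4). intros n. now rewrite E1.
  - assert (HV : forall n, letter (farey_path x) n = mV -> l' n = false).
    { intros n. rewrite E2. destruct (l' n); auto. discriminate. }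
    intros N. destruct (classic (rational x)) as [Rat|Irr].
    + destruct (S6 Rat) as [N' H]. exists (Nat.max N N'). split. lia. apply HV, H. lia.
    + destruct (S5 Irr) as [_ H]. destruct (H N) as [n [Hn E]]. exists n. auto.
Qed.

Lemma farey_path_eq w : is_lim_seq (fun n => mobiusR (prefix w n) 1) x ->
  (forall N, exists n, (N <= n)%nat /\ w n = false) ->
  forall n, farey_path x n = prefix w n.
Proof.
  intros Cw Iw n. destruct farey_path_prefix as (l' & E & C & I). rewrite E. apply prefix_ext.
  intros k _. now apply (prefix_limit_unique l' w x).
Qed.
End Euclid.

Lemma farey_path_euclid x : 0 < x -> forall n, farey_path x n = prefix (euclid_word x) n.
Proof.
  intros Hx. apply farey_path_eq; auto. now apply euclid_converges. now apply euclid_V_infinite.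
Qed.

Lemma euclid_word_phi n : euclid_word phi n = Nat.even n.
Proof.
  assert (Pb := phi_bounds). assert (Ps := phi_sq).
  assert (Dec : forall n, euclid_word phi n = true \/
    rem_num (prefix (euclid_word phi) n) phi < rem_den (prefix (euclid_word phi) n) phi).
  { intros m. destruct (Rle_lt_dec (rem_den (prefix (euclid_word phi) m) phi)
      (rem_num (prefix (euclid_word phi) m) phi)) as [H|H]; auto. left. now apply euclid_word_true. }
  set (l := euclid_word phi) in *.
  assert (Rd : forall m, 0 < rem_den (prefix l m) phi) by (intros m; apply euclid_rem; lra).
  assert (K : rem_num (prefix l n) phi =
      if Nat.even n then phi * rem_den (prefix l n) phi else (phi - 1) * rem_den (prefix l n) phi).
  { induction n. unfold rem_num, rem_den; simpl; ring.
    rewrite Nat.even_succ, <- Nat.negb_even. specialize (Rd n). destruct (Nat.even n); simpl negb; cbv iota.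
    - assert (E : l n = true) by (apply euclid_word_true; fold l; nra).
      destruct (rem_T l n phi E) as [-> ->]. rewrite IHn. ring.
    - assert (E : l n = false).
      { destruct (l n) eqn:E; auto. apply euclid_word_true in E. fold l in E. nra. }
      destruct (rem_V l n phi E) as [-> ->]. rewrite IHn.
      replace (phi * (rem_den (prefix l n) phi - (phi - 1) * rem_den (prefix l n) phi))
        with ((2 * phi - phi * phi) * rem_den (prefix l n) phi) by ring. rewrite Ps. ring. }
  specialize (Rd n). destruct (Nat.even n).
  - apply euclid_word_true. fold l. nra.
  - destruct (l n) eqn:E; auto. apply euclid_word_true in E. fold l in E. nra.
Qed.

(** * Words with prescribed density of alternations *)

Lemma prefix_hyperbolic_eventually l n0 n1 : l n0 = false -> l n1 = true ->
  exists N, forall n, (N <= n)%nat -> hyperbolic (prefix l n).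
Proof.
  intros H0 H1. exists (S n0 + S n1)%nat. intros n Hn. apply hyperbolic_prefix. split.
  - assert (K : forall k, (1 <= mb (prefix l (S n1 + k)))%Z).
    { intros k. induction k.
      - rewrite Nat.add_0_r, (prefix_S_T l n1 H1). destruct (prefix_bounds l n1). simpl. lia.
      - rewrite Nat.add_succ_r. destruct (prefix_bounds l (S n1 + k)). destruct (l (S n1 + k)%nat) eqn:E.
        + rewrite (prefix_S_T l _ E). simpl in *. lia.
        + rewrite (prefix_S_V l _ E). simpl in *. lia. }
    replace n with (S n1 + (n - S n1))%nat by lia. apply K.
  - replace n with (S n0 + (n - S n0))%nat by lia. apply (prefix_den_growth l n0 H0).
Qed.

Lemma rsum_app a n k : rsum a (n + k) = rsum a n + rsum (fun j => a (n + j)%nat) k.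
Proof. induction k. rewrite Nat.add_0_r. simpl. ring. rewrite Nat.add_succ_r. simpl. rewrite IHk. ring. Qed.

Lemma lim_inv_sqrt : is_lim_seq (fun n => / INR (S (Nat.sqrt n))) 0.
Proof.
  apply is_lim_seq_spec. intros eps.
  destruct (archimed_cor1 eps (cond_pos eps)) as [m [Hm Pm]].
  exists (m * m)%nat. intros n Hn. rewrite Rminus_0_r.
  assert (K : (m <= Nat.sqrt n)%nat).
  { rewrite <- (Nat.sqrt_square m). now apply Nat.sqrt_le_mono. }
  assert (P : 0 < INR m) by (apply lt_0_INR; lia).
  assert (Q : INR m <= INR (S (Nat.sqrt n))) by (apply le_INR; lia).
  rewrite Rabs_pos_eq by (apply Rlt_le, Rinv_0_lt_compat; lra).
  eapply Rle_lt_trans; [|apply Hm]. apply Rinv_le_contravar; lra.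
Qed.

Lemma lim_of_sqrt_error (a : nat -> R) theta K : 0 <= theta <= 1 ->
  (forall n, Rabs (a n - theta * INR n) <= 2 * INR (Nat.sqrt n) + K) -> 0 <= K ->
  is_lim_seq (fun n => a n / INR (S n)) theta.
Proof.
  intros Ht H HK.
  apply is_lim_seq_ext with (fun n => theta + (a n / INR (S n) - theta)). intros; ring.
  replace (Finite theta) with (Finite (theta + 0)) by (f_equal; ring).
  apply is_lim_seq_plus'. apply is_lim_seq_const. apply is_lim_seq_abs_0.
  assert (L := is_lim_seq_scal_l _ (6 + 2 * K) _ lim_inv_sqrt). simpl in L. rewrite Rmult_0_r in L.
  apply is_lim_seq_le_le with (3 := L) (u := fun _ => 0). 2: apply is_lim_seq_const.
  intros n. split. apply Rabs_pos.
  specialize (H n). assert (Pn : 0 < INR (S n)) by (apply lt_0_INR; lia).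
  assert (Sq : INR (Nat.sqrt n) * INR (Nat.sqrt n) <= INR n).
  { rewrite <- mult_INR. apply le_INR. apply Nat.sqrt_spec. lia. }
  change (match Nat.sqrt n with O => 1 | S _ => INR (Nat.sqrt n) + 1 end) with (INR (S (Nat.sqrt n))).
  assert (Pi := pos_INR (Nat.sqrt n)). rewrite !S_INR in *. set (i := INR (Nat.sqrt n)) in *.
  replace (a n / (INR n + 1) - theta) with ((a n - theta * INR n - theta) / (INR n + 1)) by (field; lra).
  unfold Rdiv. rewrite Rabs_mult, (Rabs_pos_eq (/ _)) by (apply Rlt_le, Rinv_0_lt_compat; lra).
  apply Rle_div_l. lra.
  apply Rle_trans with (2 * i + K + 1).
  { eapply Rle_trans. apply Rabs_triang. rewrite Rabs_Ropp, (Rabs_pos_eq theta) by lra. lra. }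
  replace ((6 + 2 * K) * / (i + 1) * (INR n + 1)) with ((6 + 2 * K) * (INR n + 1) / (i + 1)) by (field; lra).
  apply Rle_div_r. lra.
  assert (K * (i + 1) <= K * (2 * (INR n + 1))) by (apply Rmult_le_compat_l; nra).
  nra.
Qed.

Section Density.
Variable theta : R.
Hypothesis Ht : 0 < theta < 1.

(* Within the block [i^2, (i+1)^2) the first [mark_width i] positions are marked, so that
   exactly [mark_floor i] positions below i^2 are marked. *)
Definition mark_floor (i : nat) : nat := Z.to_nat (Int_part (theta * (INR i * INR i))).
Definition mark_width (i : nat) : nat := (mark_floor (S i) - mark_floor i)%nat.
Definition mark (n : nat) : bool := (n - Nat.sqrt n * Nat.sqrt n <? mark_width (Nat.sqrt n))%nat.

Lemma mark_floor_bounds i : INR (mark_floor i) <= theta * (INR i * INR i) < INR (mark_floor i) + 1.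
Proof.
  unfold mark_floor. set (y := theta * (INR i * INR i)).
  assert (Py : 0 <= y) by (pose proof (pos_INR i); unfold y; nra).
  destruct (base_Int_part y) as [B1 B2].
  assert (0 <= Int_part y)%Z. { apply le_IZR. apply Rnot_lt_le. intros K. apply (lt_IZR _ 0) in K.
    assert (Int_part y <= -1)%Z by lia. apply IZR_le in H. lra. }
  rewrite INR_IZR_INZ, Z2Nat.id by auto. lra.
Qed.

Lemma mark_floor_step i : (mark_floor i <= mark_floor (S i) <= mark_floor i + (2 * i + 1))%nat.
Proof.
  destruct (mark_floor_bounds i) as [A1 A2]. destruct (mark_floor_bounds (S i)) as [B1 B2].
  assert (Pi := pos_INR i). rewrite S_INR in B1, B2.
  split; apply Nat.lt_succ_r; apply INR_lt; rewrite S_INR.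
  - nra.
  - rewrite !plus_INR, mult_INR. simpl. nra.
Qed.

Lemma mark_block i j : (j <= 2 * i)%nat -> mark (i * i + j) = (j <? mark_width i)%nat.
Proof.
  intros Hj. unfold mark. rewrite (Nat.sqrt_unique (i * i + j) i) by lia. f_equal. lia.
Qed.

Lemma block_decomposition n : exists i j, n = (i * i + j)%nat /\ (j <= 2 * i)%nat /\ Nat.sqrt n = i.
Proof.
  exists (Nat.sqrt n), (n - Nat.sqrt n * Nat.sqrt n)%nat. assert (H := Nat.sqrt_spec n ltac:(lia)).
  repeat split; lia.
Qed.

Lemma mark_count_block i j : (j <= 2 * i + 1)%nat ->
  rsum (fun k => b2R (mark (i * i + k))) j = INR (Nat.min j (mark_width i)).
Proof.
  induction j; intros Hj. reflexivity.
  cbn [rsum]. rewrite IHj, mark_block by lia. destruct (Nat.ltb_spec j (mark_width i)).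
  - rewrite !Nat.min_l by lia. rewrite S_INR. reflexivity.
  - rewrite !Nat.min_r by lia. simpl. ring.
Qed.

Lemma mark_count_square i : rsum (fun k => b2R (mark k)) (i * i) = INR (mark_floor i).
Proof.
  induction i.
  - simpl. symmetry. apply (Rle_antisym _ 0); [|apply pos_INR].
    eapply Rle_trans. apply mark_floor_bounds. simpl. lra.
  - replace (S i * S i)%nat with (i * i + (2 * i + 1))%nat by lia.
    rewrite rsum_app, IHi, mark_count_block, <- plus_INR by lia. f_equal.
    unfold mark_width. pose proof (mark_floor_step i). lia.
Qed.

Lemma mark_density : is_lim_seq (fun n => rsum (fun k => b2R (mark k)) n / INR (S n)) theta.
Proof.
  apply (lim_of_sqrt_error _ theta 2); [lra| |lra]. intros n.
  destruct (block_decomposition n) as (i & j & E & Hj & ->).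
  rewrite E, rsum_app, mark_count_square, mark_count_block, plus_INR, mult_INR by lia.
  destruct (mark_floor_bounds i) as [B1 B2].
  assert (Q : INR (Nat.min j (mark_width i)) <= 2 * INR i).
  { apply Rle_trans with (INR j). apply le_INR; lia.
    replace (2 * INR i) with (INR (2 * i)) by (rewrite mult_INR; simpl; ring). now apply le_INR. }
  assert (Q' : INR j <= 2 * INR i).
  { replace (2 * INR i) with (INR (2 * i)) by (rewrite mult_INR; simpl; ring). now apply le_INR. }
  assert (P1 := pos_INR (Nat.min j (mark_width i))). assert (P2 := pos_INR j).
  apply Rabs_le. nra.
Qed.

Lemma mark_changes_block i j : (j <= 2 * i)%nat ->
  rsum (fun k => b2R (alternates mark (i * i + k))) j <= if (j <? mark_width i)%nat then 0 else 1.
Proof.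
  induction j; intros Hj. simpl rsum. destruct (0 <? mark_width i)%nat; lra.
  cbn [rsum]. specialize (IHj ltac:(lia)). unfold alternates at 2.
  rewrite <- Nat.add_succ_r, !mark_block by lia.
  destruct (Nat.ltb_spec j (mark_width i)), (Nat.ltb_spec (S j) (mark_width i)); simpl b2R; try lra. lia.
Qed.

Lemma mark_changes_square i : rsum (fun k => b2R (alternates mark k)) (i * i) <= 2 * INR i.
Proof.
  induction i. simpl. lra.
  replace (S i * S i)%nat with (i * i + S (2 * i))%nat by lia.
  rewrite rsum_app. cbn [rsum]. rewrite S_INR.
  assert (H := mark_changes_block i (2 * i) (le_n _)).
  pose proof (b2R_bounds (alternates mark (i * i + 2 * i))).
  destruct (2 * i <? mark_width i)%nat; lra.
Qed.

Lemma mark_changes_density :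
  is_lim_seq (fun n => rsum (fun k => b2R (alternates mark k)) n / INR (S n)) 0.
Proof.
  apply (lim_of_sqrt_error _ 0 1); [lra| |lra]. intros n.
  rewrite Rmult_0_l, Rminus_0_r, Rabs_pos_eq by (apply rsum_nonneg; intros; apply b2R_bounds).
  destruct (block_decomposition n) as (i & j & E & Hj & ->).
  rewrite E, rsum_app. assert (H1 := mark_changes_square i). assert (H2 := mark_changes_block i j Hj).
  destruct (j <? mark_width i)%nat; lra.
Qed.

Lemma mark_infinite N : exists n, (N <= n)%nat /\ mark n = true.
Proof.
  apply NNPP. intros H.
  assert (Z : forall k, rsum (fun j => b2R (mark (N + j))) k = 0).
  { induction k; auto. cbn [rsum]. rewrite IHk. destruct (mark (N + k)) eqn:E.
    exfalso. apply H. exists (N + k)%nat. split; auto; lia. simpl; ring. }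
  assert (L := mark_density).
  assert (L0 : is_lim_seq (fun n => rsum (fun k => b2R (mark k)) n / INR (S n)) 0).
  { apply (is_lim_seq_incr_n _ N).
    apply is_lim_seq_ext with (fun n => rsum (fun k => b2R (mark k)) N * / INR (S (n + N))).
    { intros n. rewrite (Nat.add_comm n N), (rsum_app _ N n), Z, Rplus_0_r. reflexivity. }
    replace (Finite 0) with (Rbar_mult (rsum (fun k => b2R (mark k)) N) 0) by (simpl; f_equal; ring).
    apply is_lim_seq_scal_l. apply (is_lim_seq_incr_n (fun n => / INR (S n)) N).
    apply (is_lim_seq_incr_1 (fun n => / INR n)).
    replace (Finite 0) with (Rbar_inv p_infty) by reflexivity.
    apply is_lim_seq_inv. apply is_lim_seq_INR. discriminate. }
  assert (E := is_lim_seq_unique _ _ L). rewrite (is_lim_seq_unique _ _ L0) in E.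
  injection E. lra.
Qed.

Fixpoint marked_word (n : nat) : bool :=
  match n with O => false | S n => xorb (marked_word n) (mark n) end.

Lemma alternates_marked_word n : alternates marked_word n = mark n.
Proof. unfold alternates. simpl. destruct (marked_word n), (mark n); reflexivity. Qed.

Lemma marked_word_infinite b N : exists n, (N <= n)%nat /\ marked_word n = b.
Proof.
  destruct (mark_infinite N) as [n [Hn E]].
  destruct (Bool.bool_dec (marked_word n) b) as [H|H]. now exists n.
  exists (S n). split. lia. simpl. rewrite E. destruct (marked_word n), b; simpl; congruence.
Qed.
End Density.

Section Final.
Variable f : C -> C.
Hypothesis f_holo : holoH f.
Hypothesis f_inv : forall A z, SL2Z A -> upper_half z -> f (mobiusC A z) = f z.
Hypothesis f_real : forall t, PI / 3 <= t <= 2 * PI / 3 -> Im (f (arc t)) = 0.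
Hypothesis f_pos : forall t, PI / 3 <= t <= 2 * PI / 3 -> 0 <= Re (f (arc t)).
Variable z0 : C.
Hypothesis Hz0 : upper_half z0.

Lemma Lambda_pos_bounds x : 0 < x ->
  Rbar_le 0 (Lambda_pos f z0 x) /\ Rbar_le (Lambda_pos f z0 x) (2 * golden_value f).
Proof.
  intros Hx. assert (S5 : 2 <= sqrt 5) by (pose proof sqrt5_bounds; lra).
  assert (Pg := arc_value_nonneg f f_holo f_pos (sqrt 5) S5). fold (golden_value f) in Pg.
  assert (B : forall n, (1 <= n)%nat ->
    0 <= Re (I_f f z0 (farey_path x n)) / INR n <= 2 * golden_value f).
  { intros n Hn. rewrite farey_path_euclid by auto.
    assert (Pn : 0 < INR n) by (apply lt_0_INR; lia).
    destruct (excluded_middle_informative (hyperbolic (prefix (euclid_word x) n))) as [H|H].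
    - destruct (I_f_prefix_bounds f f_holo f_inv f_real f_pos _ _ _ Hz0 H) as [H1 H2]. split.
      apply Rmult_le_pos; auto. now apply Rlt_le, Rinv_0_lt_compat.
      apply Rle_div_l; auto. lra.
    - unfold I_f. destruct excluded_middle_informative; [contradiction|].
      replace (Re (RtoC 0) / INR n) with 0 by (simpl; field; lra). lra. }
  unfold Lambda_pos. split.
  - rewrite <- (LimSup_seq_const 0). apply LimSup_le. exists 1%nat. intros n Hn. now apply B.
  - rewrite <- (LimSup_seq_const (2 * golden_value f)). apply LimSup_le. exists 1%nat.
    intros n Hn. now apply B.
Qed.

Lemma Lambda_pos_limit x l (theta : R) : (forall n, farey_path x n = prefix l n) ->
  (exists n, l n = false) -> (exists n, l n = true) ->
  is_lim_seq (fun n => rsum (fun k => b2R (alternates l k)) n / INR (S n)) theta ->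
  is_lim_seq (fun n => rsum (fun k => b2R (alternates (alternates l) k)) n / INR (S n)) 0 ->
  Lambda_pos f z0 x = 2 * golden_value f * theta.
Proof.
  intros E [n0 H0] [n1 H1] L1 L2. unfold Lambda_pos. apply is_LimSup_seq_unique, is_lim_LimSup_seq.
  apply is_lim_seq_ext with (fun n => Re (I_f f z0 (prefix l n)) / INR n).
  intros n. now rewrite E.
  apply I_f_prefix_limit; auto. now apply prefix_hyperbolic_eventually with n0 n1.
Qed.

Lemma Lambda_phi : Lambda_pos f z0 phi = 2 * golden_value f.
Proof.
  assert (Pb := phi_bounds).
  replace (2 * golden_value f) with (2 * golden_value f * 1) by ring.
  apply Lambda_pos_limit with (l := euclid_word phi).
  - apply farey_path_euclid. lra.
  - exists 1%nat. now rewrite euclid_word_phi.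
  - exists 0%nat. now rewrite euclid_word_phi.
  - assert (A : forall k, alternates (euclid_word phi) k = true).
    { intros k. unfold alternates. rewrite !euclid_word_phi, Nat.even_succ, <- Nat.negb_even.
      destruct (Nat.even k); reflexivity. }
    apply (lim_of_sqrt_error _ 1 0); [lra| |lra]. intros n.
    rewrite (rsum_ext _ (fun _ => 1)) by (intros k _; now rewrite A).
    rewrite rsum_const. replace (INR n * 1 - 1 * INR n) with 0 by ring. rewrite Rabs_R0.
    pose proof (pos_INR (Nat.sqrt n)). lra.
  - assert (A : forall k, alternates (euclid_word phi) k = true).
    { intros k. unfold alternates. rewrite !euclid_word_phi, Nat.even_succ, <- Nat.negb_even.
      destruct (Nat.even k); reflexivity. }
    apply (lim_of_sqrt_error _ 0 0); [lra| |lra]. intros n.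
    rewrite (rsum_ext _ (fun _ => 0)) by (intros k _; unfold alternates at 1; now rewrite !A).
    rewrite rsum_const. replace (INR n * 0 - 0 * INR n) with 0 by ring. rewrite Rabs_R0.
    pose proof (pos_INR (Nat.sqrt n)). lra.
Qed.

Lemma Lambda_attains y : 0 < y < 2 * golden_value f -> exists x, 0 < x /\ Lambda_pos f z0 x = y.
Proof.
  intros Hy. set (theta := y / (2 * golden_value f)).
  assert (Ht : 0 < theta < 1).
  { unfold theta. split. apply Rdiv_lt_0_compat; lra. apply Rlt_div_l; lra. }
  destruct (marked_word_infinite theta Ht false 0) as [n0 [_ H0]].
  destruct (marked_word_infinite theta Ht true 0) as [n1 [_ H1]].
  destruct (prefix_limit_exists _ n0 n1 H0 H1) as [x [Px Cx]].
  exists x. split; auto.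
  replace y with (2 * golden_value f * theta) by (unfold theta; field; lra).
  apply Lambda_pos_limit with (l := marked_word theta).
  - apply farey_path_eq; auto. intros N. now apply marked_word_infinite.
  - now exists n0.
  - now exists n1.
  - apply is_lim_seq_ext with (2 := mark_density theta Ht). intros n. f_equal.
    apply rsum_ext. intros k _. now rewrite alternates_marked_word.
  - apply is_lim_seq_ext with (2 := mark_changes_density theta Ht). intros n. f_equal.
    apply rsum_ext. intros k _. unfold alternates at 1 2. now rewrite !alternates_marked_word.
Qed.
End Final.

Theorem theorem1p7 (f : C -> C) (tau0 : C)
  (hf : weakly_holomorphic_modular_function f)
  (hf0 : exists tau : C, upper_half tau /\ f tau <> RtoC 0)
  (hpos : forall t : R, PI / 3 <= t <= 2 * PI / 3 ->
     Im (f (cos t, sin t)) = 0 /\ 0 <= Re (f (cos t, sin t)))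
  (htau0 : upper_half tau0) :
  is_finite (Lambda f tau0 (P1_fin phi)) /\
  (forall x : P1R,
     Rbar_le (Finite 0) (Lambda f tau0 x) /\
     Rbar_le (Lambda f tau0 x) (Lambda f tau0 (P1_fin phi))) /\
  (forall y : Rbar,
     (exists x : P1R, Lambda f tau0 x = y) <->
     (Rbar_le (Finite 0) y /\ Rbar_le y (Lambda f tau0 (P1_fin phi)))).
Proof.
  destruct hf as (hd & hinv & _).
  assert (f_holo : holoH f).
  { intros z Hz. destruct (hd z Hz) as [l Hl]. exists l. now apply is_derive_cderiv. }
  assert (f_real : forall t, PI / 3 <= t <= 2 * PI / 3 -> Im (f (arc t)) = 0) by apply hpos.
  assert (f_pos : forall t, PI / 3 <= t <= 2 * PI / 3 -> 0 <= Re (f (arc t))) by apply hpos.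
  assert (Pb := phi_bounds).
  assert (E : Lambda f tau0 (P1_fin phi) = 2 * golden_value f).
  { simpl. destruct (Rlt_dec 0 phi); [|lra]. now apply Lambda_phi. }
  rewrite E.
  assert (Pg : 0 <= 2 * golden_value f).
  { pose proof (arc_value_nonneg f f_holo f_pos (sqrt 5)). unfold golden_value.
    pose proof sqrt5_bounds. lra. }
  assert (B : forall x, Rbar_le 0 (Lambda f tau0 x) /\ Rbar_le (Lambda f tau0 x) (2 * golden_value f)).
  { intros [x|]; [|simpl; lra]. unfold Lambda. destruct (Rlt_dec 0 x); [now apply Lambda_pos_bounds|].
    destruct (Rlt_dec x 0); [apply Lambda_pos_bounds; auto; lra|simpl; lra]. }
  split; [reflexivity|]. split; [exact B|].
  intros y. split. intros [x <-]. apply B.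
  intros [H1 H2]. destruct y as [y| |]; simpl in H1, H2; try contradiction.
  destruct H1 as [H1|<-]; [|now exists P1_inf].
  destruct H2 as [H2| ->]; [|now exists (P1_fin phi)].
  destruct (Lambda_attains f f_holo hinv f_real f_pos tau0 htau0 y (conj H1 H2)) as [x [Px Ex]].
  exists (P1_fin x). simpl. destruct (Rlt_dec 0 x); [exact Ex|contradiction].
Qed.
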